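(* Let $K$ be a commutative ring, let $B$ be a $K$-algebra which is projective as a $K$-module, let $e\in B$ be an idempotent, $e'=1-e$ its complementary idempotent and $C=eBe$, $C'=e'Be'$. If $$\mathrm{Tor}^{C}_i(Be,eB)=0=\mathrm{Tor}^{C'}_i(Be',e'B)\quad\text{for all } i>0,$$ then there is a long exact sequence $$\cdots\to\mathrm{Ext}^n_{B^{\mathrm{ev}}}(B,B)\xrightarrow{\;g_n\;}\mathrm{Ext}^n_{C^{\mathrm{ev}}}(C,C)\oplus\mathrm{Ext}^n_{(C')^{\mathrm{ev}}}(C',C')\to\mathrm{Ext}^n_{B^{\mathrm{ev}}}(\Omega^1_B,B)\to\mathrm{Ext}^{n+1}_{B^{\mathrm{ev}}}(B,B)\to\cdots$$ induced from the canonical short exact sequence of $B^{\mathrm{ev}}$-modules $$0\to\Omega^1_B\to(Be\otimes_CeB)\oplus(Be'\otimes_{C'}e'B)\to B\to0 .$$ Moreover, the map $g_\ast\colon\mathrm{HH}^\ast(B)\to\mathrm{HH}^\ast(eBe)\times\mathrm{HH}^\ast(e'Be')$ is a homomorphism of strict Gerstenhaber algebras.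
   Context: Conventions. Algebras are unital and associative; $\otimes=\otimes_K$; $\Lambda^{\mathrm{ev}}=\Lambda\otimes\Lambda^{\mathrm{op}}$; $\mathrm{Mod}$ denotes left modules. In the short exact sequence the map onto $B$ is induced by the multiplication maps $Be\otimes_CeB\to B$ and $Be'\otimes_{C'}e'B\to B$, and $\Omega^1_B$ is by definition its kernel. The long exact sequence is the one obtained by applying $\mathrm{Hom}_{B^{\mathrm{ev}}}(-,B)$, using the isomorphism $\mathrm{Ext}^\ast_{B^{\mathrm{ev}}}(Be\otimes_CeB,B)\cong\mathrm{Ext}^\ast_{C^{\mathrm{ev}}}(C,C)$ (and likewise for $e'$) obtained as follows: if $\mathbb P\to C$ is a projective resolution over $C^{\mathrm{ev}}$, then $Be\otimes_C\mathbb P\otimes_CeB$ is a projective resolution of $Be\otimes_CeB$ over $B^{\mathrm{ev}}$, and one uses the adjunction between $Be\otimes_C(-)\otimes_CeB$ and $e(-)e$. Hochschild cohomology. For a $K$-projective $K$-algebra $\Lambda$, $\mathrm{HH}^\ast(\Lambda)$ is the cohomology of the Hochschild cocomplex $C^n(\Lambda,\Lambda)=\mathrm{Hom}_K(\Lambda^{\otimes n},\Lambda)$ with its usual differential, identified via the bar resolution with the graded algebra $\mathrm{Ext}^\ast_{\Lambda^{\mathrm{ev}}}(\Lambda,\Lambda)$. Its strict Gerstenhaber structure consists of: the cup product $(f\cup g)(a_1\otimes\cdots\otimes a_{m+n})=f(a_1\otimes\cdots\otimes a_m)g(a_{m+1}\otimes\cdots\otimes a_{m+n})$; the bracket induced by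 $\{f,g\}=f\bullet g-(-1)^{(m-1)(n-1)}g\bullet f$ (degree $-1$), where for $f\in C^m$, $g\in C^n$, $f\bullet g=\sum_{i=1}^m(-1)^{(i-1)(n-1)}f\bullet_i g$ and $(f\bullet_i g)(a_1\otimes\cdots\otimes a_{m+n-1})=f(a_1\otimes\cdots\otimes a_{i-1}\otimes g(a_i\otimes\cdots\otimes a_{i+n-1})\otimes a_{i+n}\otimes\cdots\otimes a_{m+n-1})$; and the squaring map $sq\colon\mathrm{HH}^{2n}(\Lambda)\to\mathrm{HH}^{4n-1}(\Lambda)$ induced by $f\mapsto f\bullet f$. A homomorphism of strict Gerstenhaber algebras is a graded $K$-algebra homomorphism commuting with brackets and squaring maps; a product of strict Gerstenhaber algebras carries the componentwise structure. *)

(* Defs.v *)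
From HB Require Import structures.
From mathcomp Require Import all_boot all_algebra.
From mathcomp Require Import boolp classical_sets functions.
From mathcomp Require Import zify.

Set Implicit Arguments.
Unset Strict Implicit.
Unset Printing Implicit Defensive.

Import GRing.Theory.
Local Open Scope ring_scope.
Local Open Scope quotient_scope.

(* The library's algType excludes the zero ring, but e B e is zero for e = 0.
   A K-algebra is therefore a possibly trivial ring together with a ring
   morphism from K to its centre. *)
HB.mixin Record isKAlgebra (K : comPzRingType) A of GRing.PzRing A := {
  kin_subdef : K -> A;
  kin_additive : zmod_morphism kin_subdef;
  kin_multiplicative : monoid_morphism kin_subdef;
  kin_central : forall (k : K) (x : A), kin_subdef k * x = x * kin_subdef k }.

#[short(type="kAlgType")]
HB.structure Definition KAlgebra (K : comPzRingType) :=
  {A of GRing.PzRing A & isKAlgebra K A}.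

Section StructureMap.
Variables (K : comPzRingType) (A : kAlgType K).

Definition kin : K -> A := @kin_subdef K A.

HB.instance Definition _ := GRing.isZmodMorphism.Build K A kin kin_additive.
HB.instance Definition _ := GRing.isMonoidMorphism.Build K A kin kin_multiplicative.

Lemma kinC (k : K) (x : A) : kin k * x = x * kin k.
Proof. exact: kin_central. Qed.
End StructureMap.

Section RestrictionOfScalars.
Variables (K : comPzRingType) (R : kAlgType K).

Definition kres (M : lmodType R) : Type := M.

Variable M : lmodType R.
HB.instance Definition _ := GRing.Zmodule.on (kres M).

Definition kscale (k : K) (x : kres M) : kres M :=
  kin R k *: (x : M).

Fact kscaleA k l x : kscale k (kscale l x) = kscale (k * l) x.
Proof. by rewrite /kscale scalerA -rmorphM. Qed.
Fact kscale1 : left_id 1 kscale.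
Proof. by move=> x; rewrite /kscale rmorph1 scale1r. Qed.
Fact kscaleDr : right_distributive kscale +%R.
Proof. by move=> k x y; rewrite /kscale scalerDr. Qed.
Fact kscaleDl x : {morph kscale^~ x : k l / k + l}.
Proof. by move=> k l; rewrite /kscale rmorphD scalerDl. Qed.

HB.instance Definition _ :=
  GRing.Zmodule_isLmodule.Build K (kres M) kscaleA kscale1 kscaleDr kscaleDl.
End RestrictionOfScalars.

(* M (x)_S N, for a right action ra of S on M and a left action la of S on N:
   finite formal sums of pairs, two of them being identified when every
   balanced biadditive map takes the same value on both.  (As - (m, n) is
   (- m, n), the formal sums are just sequences of pairs.) *)
Section Tensor.
Variables (S : Type) (M N : zmodType) (ra : M -> S -> M) (la : S -> N -> N).

Definition balanced (A : zmodType) (f : M -> N -> A) : Prop :=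
  [/\ forall m m' n, f (m + m') n = f m n + f m' n,
      forall m n n', f m (n + n') = f m n + f m n' &
      forall m s n, f (ra m s) n = f m (la s n)].

Definition fsum (A : zmodType) (f : M -> N -> A) (s : seq (M * N)) : A :=
  \sum_(p <- s) f p.1 p.2.

Definition tens_eq (s t : seq (M * N)) : bool :=
  `[< forall (A : zmodType) (f : M -> N -> A), balanced f -> fsum f s = fsum f t >].

Fact tens_eq_refl : reflexive tens_eq.
Proof. by move=> s; apply/asboolP. Qed.
Fact tens_eq_sym : symmetric tens_eq.
Proof. by move=> s t; apply/asboolP/asboolP => h A f /h. Qed.
Fact tens_eq_trans : transitive tens_eq.
Proof.
move=> t s u /asboolP st /asboolP tu; apply/asboolP => A f bf.
by rewrite st // tu.
Qed.

Canonical tens_equiv := EquivRel tens_eq tens_eq_refl tens_eq_sym tens_eq_trans.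

Definition tens : Type := {eq_quot tens_equiv}.
HB.instance Definition _ := Choice.on tens.
HB.instance Definition _ := EqQuotient.on tens.

Definition tens_neg (s : seq (M * N)) := [seq (- p.1, p.2) | p <- s].

Definition tens0 : tens := \pi_tens [::].
Definition tensN (x : tens) : tens := \pi_tens (tens_neg (repr x)).
Definition tensD (x y : tens) : tens := \pi_tens (repr x ++ repr y).

Definition tpure (m : M) (n : N) : tens := \pi_tens [:: (m, n)].
Definition tlift (A : zmodType) (f : M -> N -> A) (x : tens) : A :=
  fsum f (repr x).

Lemma tens_eqP (x y : tens) :
  (forall (A : zmodType) (f : M -> N -> A), balanced f -> tlift f x = tlift f y) ->
  x = y.
Proof.
move=> h; rewrite -[x]reprK -[y]reprK; apply/eqP; rewrite eqmodE.
exact/asboolP.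
Qed.

Lemma fsum_cat (A : zmodType) (f : M -> N -> A) s t : fsum f (s ++ t) = fsum f s + fsum f t.
Proof. by rewrite /fsum big_cat. Qed.

Section Balanced.
Variables (A : zmodType) (f : M -> N -> A).
Hypothesis bf : balanced f.

Lemma tlift_pi s : tlift f (\pi_tens s) = fsum f s.
Proof.
have /eqP := reprK (\pi_tens s); rewrite eqmodE => /asboolP h.
exact: h.
Qed.

Lemma balanced0 n : f 0 n = 0.
Proof. by case: bf => h _ _; apply: (addrI (f 0 n)); rewrite -h !addr0. Qed.

Lemma balancedN m n : f (- m) n = - f m n.
Proof.
by case: bf => h _ _; apply: (addrI (f m n)); rewrite -h !subrr balanced0.
Qed.

Lemma fsum_neg s : fsum f (tens_neg s) = - fsum f s.
Proof.
rewrite /fsum /tens_neg big_map -sumrN; apply: eq_bigr => p _ /=.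
exact: balancedN.
Qed.

Lemma tlift_pure m n : tlift f (tpure m n) = f m n.
Proof. by rewrite tlift_pi /fsum big_seq1. Qed.
Lemma tlift_add x y : tlift f (tensD x y) = tlift f x + tlift f y.
Proof. by rewrite tlift_pi fsum_cat. Qed.
Lemma tlift_opp x : tlift f (tensN x) = - tlift f x.
Proof. by rewrite tlift_pi fsum_neg. Qed.
Lemma tlift_zero : tlift f tens0 = 0.
Proof. by rewrite tlift_pi /fsum big_nil. Qed.
End Balanced.

Fact tensA : associative tensD.
Proof. by move=> x y z; apply: tens_eqP => A f bf; rewrite !tlift_add // addrA. Qed.
Fact tensC : commutative tensD.
Proof. by move=> x y; apply: tens_eqP => A f bf; rewrite !tlift_add // addrC. Qed.
Fact tens0D : left_id tens0 tensD.
Proof.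
by move=> x; apply: tens_eqP => A f bf; rewrite tlift_add // tlift_zero // add0r.
Qed.
Fact tensND : left_inverse tens0 tensN tensD.
Proof.
move=> x; apply: tens_eqP => A f bf.
by rewrite tlift_add // tlift_opp // tlift_zero // addNr.
Qed.

HB.instance Definition _ := GRing.isZmodule.Build tens tensA tensC tens0D tensND.

Lemma tliftD (A : zmodType) (f : M -> N -> A) : balanced f -> {morph tlift f : x y / x + y}.
Proof. by move=> bf x y; apply: tlift_add. Qed.

Lemma tpure_balanced : balanced tpure.
Proof.
split=> [m m' n|m n n'|m s n]; apply: tens_eqP => A f bf; have [fl fr fb] := bf;
  by rewrite ?tliftD // !tlift_pure.
Qed.

Lemma tens_sum (x : tens) : x = fsum tpure (repr x).
Proof.
apply: tens_eqP => A f bf; rewrite {1}/tlift; elim: (repr x) => [|p s IH].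
  by rewrite /fsum !big_nil (tlift_zero bf).
by rewrite /fsum !big_cons tliftD // tlift_pure // -/(fsum _ _) IH.
Qed.

Lemma tens_ind (P : tens -> Prop) :
  P 0 -> (forall m n x, P x -> P (tpure m n + x)) -> forall x, P x.
Proof.
move=> P0 PD x; rewrite (tens_sum x) /fsum.
by elim: (repr x) => [|p s IH]; rewrite ?big_nil ?big_cons //; apply: PD.
Qed.

Lemma tens_ext (A : zmodType) (f g : tens -> A) :
  {morph f : x y / x + y} -> {morph g : x y / x + y} ->
  (forall m n, f (tpure m n) = g (tpure m n)) -> f =1 g.
Proof.
have z (h : tens -> A) : {morph h : x y / x + y} -> h 0 = 0.
  by move=> hD; apply: (addrI (h 0)); rewrite -hD !addr0.
move=> fD gD fg; apply: tens_ind => [|m n x IH]; first by rewrite !z.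
by rewrite fD gD fg IH.
Qed.

End Tensor.

Section TensorMap.
Variables (S : Type) (M N M' N' : zmodType).
Variables (ra : M -> S -> M) (la : S -> N -> N).
Variables (ra' : M' -> S -> M') (la' : S -> N' -> N').

Definition tmap (f : M -> M') (g : N -> N') : tens ra la -> tens ra' la' :=
  tlift (fun m n => tpure ra' la' (f m) (g n)).

Variables (f : M -> M') (g : N -> N').
Hypothesis fD : {morph f : x y / x + y}.
Hypothesis gD : {morph g : x y / x + y}.
Hypothesis fS : forall m s, f (ra m s) = ra' (f m) s.
Hypothesis gS : forall s n, g (la s n) = la' s (g n).

Lemma tmap_balanced : balanced ra la (fun m n => tpure ra' la' (f m) (g n)).
Proof.
have [hl hr hb] := tpure_balanced ra' la'.
by split=> *; rewrite ?fD ?gD ?fS ?gS ?hl ?hr ?hb.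
Qed.

Lemma tmapE m n : tmap f g (tpure ra la m n) = tpure ra' la' (f m) (g n).
Proof. exact/tlift_pure/tmap_balanced. Qed.

Lemma tmapD : {morph tmap f g : x y / x + y}.
Proof. exact/tliftD/tmap_balanced. Qed.
End TensorMap.

Section Enveloping.
Variables (K : comPzRingType) (L : kAlgType K).

Definition ev : Type :=
  tens (fun (x : L) (k : K) => x * kin L k) (fun (k : K) (x : L) => kin L k * x).
HB.instance Definition _ := GRing.Zmodule.on ev.

(* x (x) y in L (x) L^op *)
Definition evp (x y : L) : ev := tpure _ _ x y.

Definition ev_balanced (A : zmodType) (f : L -> L -> A) :=
  balanced (fun (x : L) (k : K) => x * kin L k) (fun (k : K) (x : L) => kin L k * x) f.

Lemma evp_balanced : ev_balanced evp.
Proof. exact: tpure_balanced. Qed.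

Definition evmul1 (x y : L) : ev -> ev := tlift (fun x' y' => evp (x * x') (y' * y)).
Definition evmul (s t : ev) : ev := tlift (fun x y => evmul1 x y t) s.

Lemma evmul1_balanced x y : ev_balanced (fun x' y' => evp (x * x') (y' * y)).
Proof.
have [hl hr hb] := evp_balanced.
split=> * /=; rewrite ?mulrDr ?mulrDl ?hl ?hr //.
by rewrite mulrA hb mulrA.
Qed.

Lemma evmul1E x y x' y' : evmul1 x y (evp x' y') = evp (x * x') (y' * y).
Proof. exact/tlift_pure/evmul1_balanced. Qed.

Lemma evmul1D x y : {morph evmul1 x y : s t / s + t}.
Proof. exact/tliftD/evmul1_balanced. Qed.

Lemma evmul_balanced t : ev_balanced (fun x y => evmul1 x y t).
Proof.
have [hl hr hb] := evp_balanced.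
split=> [x x' y|x y y'|x k y]; move: t.
- apply: tens_ext => [|s t|m n]; first exact: evmul1D.
    by rewrite !evmul1D addrACA.
  by rewrite !evmul1E mulrDl hl.
- apply: tens_ext => [|s t|m n]; first exact: evmul1D.
    by rewrite !evmul1D addrACA.
  by rewrite !evmul1E mulrDr hr.
- apply: tens_ext => [||m n]; [exact: evmul1D|exact: evmul1D|].
  by rewrite !evmul1E -(mulrA x) (kinC k m) (mulrA x) hb mulrA kinC -mulrA.
Qed.

Lemma evmulDl : left_distributive evmul +%R.
Proof. by move=> s t u; apply/tliftD/evmul_balanced. Qed.

Lemma evmulE x y t : evmul (evp x y) t = evmul1 x y t.
Proof. exact/tlift_pure/evmul_balanced. Qed.

Lemma evmulDr : right_distributive evmul +%R.
Proof.
move=> s t u; move: s; apply: tens_ext => [s s'|s s'|x y].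
- exact: evmulDl.
- by rewrite !evmulDl addrACA.
- by rewrite !evmulE evmul1D.
Qed.

Lemma evmulA : associative evmul.
Proof.
move=> s t u; move: s; apply: tens_ext => [s s'|s s'|x y].
- by rewrite evmulDl.
- by rewrite !evmulDl.
move: t; apply: tens_ext => [t t'|t t'|x' y'].
- by rewrite evmulDl evmulDr.
- by rewrite evmulDr evmulDl.
move: u; apply: tens_ext => [u u'|u u'|x'' y''].
- by rewrite !evmulDr.
- by rewrite !evmulDr.
by rewrite !evmulE !evmul1E evmulE evmul1E !mulrA.
Qed.

Lemma evmul1l : left_id (evp 1 1) evmul.
Proof.
move=> t; rewrite evmulE; move: t; apply: tens_ext => // [|x y].
  exact: evmul1D.
by rewrite evmul1E mul1r mulr1.
Qed.

Lemma evmul1r : right_id (evp 1 1) evmul.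
Proof.
apply: tens_ext => // [s t|x y]; first exact: evmulDl.
by rewrite evmulE evmul1E mul1r mulr1.
Qed.

HB.instance Definition _ :=
  GRing.Zmodule_isPzRing.Build ev evmulA evmul1l evmul1r evmulDl evmulDr.

Lemma evpM x y x' y' : evp x y * evp x' y' = evp (x * x') (y' * y).
Proof. by rewrite [LHS]evmulE evmul1E. Qed.

Definition evin (k : K) : ev := evp (kin L k) 1.

Fact evin_additive : zmod_morphism evin.
Proof.
have [hl _ _] := evp_balanced => k l.
by apply: (addIr (evin l)); rewrite subrK /evin -hl -rmorphD subrK.
Qed.
Fact evin_multiplicative : monoid_morphism evin.
Proof.
by split=> [|k l]; rewrite /evin ?rmorph1 // evpM mulr1 rmorphM.
Qed.
HB.instance Definition _ := GRing.isZmodMorphism.Build K ev evin evin_additive.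
HB.instance Definition _ := GRing.isMonoidMorphism.Build K ev evin evin_multiplicative.

Fact evinC (k : K) (t : ev) : evin k * t = t * evin k.
Proof.
move: t; apply: tens_ext => [s t|s t|x y]; rewrite ?mulrDr ?mulrDl //.
by rewrite !evpM mulr1 mul1r kinC.
Qed.
HB.instance Definition _ := isKAlgebra.Build K ev evin_additive evin_multiplicative evinC.

Record bimodule (M : zmodType) (la : L -> M -> M) (ra : M -> L -> M) : Prop := Bimodule {
  bim_laDl : forall x y m, la (x + y) m = la x m + la y m;
  bim_laDr : forall x m n, la x (m + n) = la x m + la x n;
  bim_raDl : forall m n x, ra (m + n) x = ra m x + ra n x;
  bim_raDr : forall m x y, ra m (x + y) = ra m x + ra m y;
  bim_la1 : forall m, la 1 m = m;
  bim_ra1 : forall m, ra m 1 = m;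
  bim_laA : forall x y m, la x (la y m) = la (x * y) m;
  bim_raA : forall m x y, ra (ra m x) y = ra m (x * y);
  bim_lara : forall x m y, la x (ra m y) = ra (la x m) y;
  bim_kin : forall k m, la (kin L k) m = ra m (kin L k) }.

Section OfBimodule.
Variables (M : zmodType) (la : L -> M -> M) (ra : M -> L -> M).

Definition evact (t : ev) (m : M) : M := tlift (fun x y => la x (ra m y)) t.

Hypothesis H : bimodule la ra.

Lemma evact_balanced m : ev_balanced (fun x y => la x (ra m y)).
Proof.
split=> [x x' y|x y y'|x k y].
- exact: (bim_laDl H).
- by rewrite (bim_raDr H) (bim_laDr H).
- by rewrite -(bim_laA H) (bim_kin H) (bim_raA H) kinC.
Qed.

Lemma evactE x y m : evact (evp x y) m = la x (ra m y).
Proof. exact/tlift_pure/evact_balanced. Qed.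

Lemma evactDl m : {morph evact^~ m : s t / s + t}.
Proof. exact/tliftD/evact_balanced. Qed.

Lemma evactDr : right_distributive evact +%R.
Proof.
move=> t m n; move: t; apply: tens_ext => [s t|s t|x y].
- exact: evactDl.
- by rewrite !evactDl addrACA.
- by rewrite !evactE (bim_raDl H) (bim_laDr H).
Qed.

Lemma evactA s t m : evact s (evact t m) = evact (s * t) m.
Proof.
move: s; apply: tens_ext => [s s'|s s'|x y]; rewrite ?mulrDl ?evactDl //.
move: t; apply: tens_ext => [t t'|t t'|x' y'].
- by rewrite evactDl evactDr.
- by rewrite mulrDr evactDl.
by rewrite evpM !evactE -(bim_lara H x') (bim_raA H) (bim_laA H).
Qed.

Lemma evact1 : left_id 1 evact.
Proof. by move=> m; rewrite evactE (bim_la1 H) (bim_ra1 H). Qed.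

(* A bimodule viewed as a module over L^ev, (x (x) y) m = x m y. *)
Definition evmod (_ : bimodule la ra) : Type := M.
HB.instance Definition _ := GRing.Zmodule.on (evmod H).
HB.instance Definition _ :=
  GRing.Zmodule_isLmodule.Build ev (evmod H) evactA evact1 evactDr evactDl.
End OfBimodule.

(* The two one-sided structures of an L^ev-module. *)
Section Sides.
Variable M : lmodType ev.
Definition lact (x : L) (m : M) : M := evp x 1 *: m.
Definition ract (m : M) (x : L) : M := evp 1 x *: m.

Lemma ev_bimodule : bimodule lact ract.
Proof.
have [hl hr hb] := evp_balanced.
split=> *; rewrite /lact /ract ?hl ?hr ?scalerDl ?scalerDr ?scale1r //.
- by rewrite scalerA evpM mulr1.
- by rewrite scalerA evpM mulr1.
- by rewrite !scalerA !evpM !mulr1 !mul1r.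
- by rewrite -[X in evp X 1]mul1r hb mulr1.
Qed.
End Sides.

Fact evreg_bimodule : bimodule (@GRing.mul L) (@GRing.mul L).
Proof.
split=> *; rewrite ?mul1r ?mulr1 ?mulrA ?mulrDl ?mulrDr //.
exact: kinC.
Qed.
Definition evreg : lmodType ev := evmod evreg_bimodule.

Lemma evregE (x y : L) (m : evreg) : evp x y *: m = x * ((m : L) * y) :> L.
Proof. exact: (evactE evreg_bimodule). Qed.
End Enveloping.

Lemma evmod_linear (K : comPzRingType) (L : kAlgType K) (M N : zmodType)
    (la : L -> M -> M) (ra : M -> L -> M) (H : bimodule la ra)
    (la' : L -> N -> N) (ra' : N -> L -> N) (H' : bimodule la' ra') (f : M -> N) :
  {morph f : x y / x + y} -> (forall x m, f (la x m) = la' x (f m)) ->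
  (forall m x, f (ra m x) = ra' (f m) x) ->
  linear (f : evmod H -> evmod H').
Proof.
move=> fD fl fr t u v; rewrite [LHS]fD; congr (_ + _).
have E (s : ev L) : f (evact la ra s u) = evact la' ra' s (f u).
  move: s; apply: tens_ext => [s s'|s s'|x y].
  - by rewrite evactDl // fD.
  - by rewrite evactDl.
  - by rewrite !evactE // fl fr.
exact: E.
Qed.

Section TensorBimodule.
Variables (K : comPzRingType) (L : kAlgType K) (S : Type) (M N : zmodType).
Variables (ra : M -> S -> M) (la : S -> N -> N).
Variables (lM : L -> M -> M) (rN : N -> L -> N).
Hypothesis lMDl : forall x y m, lM (x + y) m = lM x m + lM y m.
Hypothesis lMDr : forall x, {morph lM x : m n / m + n}.
Hypothesis lM1 : forall m, lM 1 m = m.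
Hypothesis lMA : forall x y m, lM x (lM y m) = lM (x * y) m.
Hypothesis lMS : forall x m s, lM x (ra m s) = ra (lM x m) s.
Hypothesis rNDr : forall m x y, rN m (x + y) = rN m x + rN m y.
Hypothesis rNDl : forall x, {morph rN^~ x : m n / m + n}.
Hypothesis rN1 : forall m, rN m 1 = m.
Hypothesis rNA : forall m x y, rN (rN m x) y = rN m (x * y).
Hypothesis rNS : forall x s n, rN (la s n) x = la s (rN n x).
Hypothesis kMN : forall k : K, exists s : S,
  (forall m, lM (kin L k) m = ra m s) /\ (forall n, rN n (kin L k) = la s n).

Definition tlact (x : L) : tens ra la -> tens ra la := tmap _ _ (lM x) id.
Definition tract (t : tens ra la) (x : L) : tens ra la := tmap _ _ id (rN^~ x) t.

Lemma tlactE x m n : tlact x (tpure ra la m n) = tpure ra la (lM x m) n.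
Proof. exact: tmapE. Qed.
Lemma tractE x m n : tract (tpure ra la m n) x = tpure ra la m (rN n x).
Proof. by rewrite /tract tmapE. Qed.
Lemma tlactD x : {morph tlact x : s t / s + t}.
Proof. exact: tmapD. Qed.
Lemma tractD x : {morph tract^~ x : s t / s + t}.
Proof. by apply: tmapD. Qed.

Fact tens_bimodule : bimodule tlact tract.
Proof.
have [hl hr hb] := tpure_balanced ra la.
have cD (f g : tens ra la -> tens ra la) : {morph f : s t / s + t} ->
    {morph g : s t / s + t} -> {morph (fun t => f t + g t) : s t / s + t}.
  by move=> fD gD s t; rewrite fD gD addrACA.
have cC (f g : tens ra la -> tens ra la) : {morph f : s t / s + t} ->
    {morph g : s t / s + t} -> {morph (fun t => f (g t)) : s t / s + t}.
  by move=> fD gD s t; rewrite gD fD.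
split.
- move=> x y; apply: tens_ext; [exact: tlactD|apply: cD; exact: tlactD|].
  by move=> m n; rewrite !tlactE lMDl hl.
- exact: tlactD.
- by move=> s t x; apply: tractD.
- move=> t x y; move: t; apply: tens_ext; [exact: tractD|apply: cD; exact: tractD|].
  by move=> m n; rewrite !tractE rNDr hr.
- by apply: tens_ext => // [|m n]; [exact: tlactD|rewrite tlactE lM1].
- by apply: tens_ext => // [|m n]; [exact: tractD|rewrite tractE rN1].
- move=> x y; apply: tens_ext; [apply: cC; exact: tlactD|exact: tlactD|].
  by move=> m n; rewrite !tlactE lMA.
- move=> t x y; move: t; apply: tens_ext.
  + by apply: (cC (tract^~ y)); exact: tractD.
  + exact: tractD.
  + by move=> m n; rewrite !tractE rNA.
- move=> x t y; move: t; apply: tens_ext.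
  + by apply: cC; [exact: tlactD|exact: tractD].
  + by apply: (cC (tract^~ y)); [exact: tractD|exact: tlactD].
  + by move=> m n; rewrite !(tlactE, tractE).
- move=> k; have [s [lk rk]] := kMN k.
  apply: tens_ext; [exact: tlactD|exact: tractD|].
  by move=> m n; rewrite tlactE tractE lk rk hb.
Qed.
End TensorBimodule.

Section Idempotents.
Variables (K : comPzRingType) (B : kAlgType K).

Record idem := Idem { idv :> B; idvK : idv * idv = idv }.

Definition idem1 : idem := Idem (mulr1 1).

Fact idemC_proof (e : idem) : (1 - idv e) * (1 - idv e) = 1 - idv e.
Proof. by rewrite mulrBr mulr1 mulrBl mul1r idvK subrr subr0. Qed.
Definition idemC (e : idem) : idem := Idem (idemC_proof e).

Section Peirce.
Variables e f : idem.

Definition peirce_pred : {pred B} := [pred x : B | (e : B) * x * (f : B) == x].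

Fact peirce_zmod_closed : zmod_closed peirce_pred.
Proof.
split=> [|x y]; rewrite !inE ?mulr0 ?mul0r // => /eqP hx /eqP hy.
by rewrite mulrBr mulrBl hx hy.
Qed.
HB.instance Definition _ := GRing.isZmodClosed.Build B peirce_pred peirce_zmod_closed.

Definition peirce : Type := {x : B | x \in peirce_pred}.
HB.instance Definition _ := SubType.copy peirce {x : B | x \in peirce_pred}.
HB.instance Definition _ := [Choice of peirce by <:].
HB.instance Definition _ := [SubChoice_isSubZmodule of peirce by <:].

Lemma peirceP (x : peirce) : (e : B) * val x * (f : B) = val x.
Proof. exact/eqP/(valP x). Qed.
Lemma peircel (x : peirce) : (e : B) * val x = val x.
Proof. by rewrite -[in LHS](peirceP x) !mulrA idvK peirceP. Qed.
Lemma peircer (x : peirce) : val x * (f : B) = val x.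
Proof. by rewrite -[in LHS](peirceP x) -!mulrA idvK mulrA peirceP. Qed.
End Peirce.
End Idempotents.

Section PeirceProduct.
Variables (K : comPzRingType) (B : kAlgType K).
Implicit Types e f g h : idem B.

Lemma peirce_mem e f (x : B) : (e : B) * x = x -> x * (f : B) = x -> x \in peirce_pred e f.
Proof. by move=> ex xf; rewrite inE ex xf. Qed.

Fact pmul_mem e f g (x : peirce e f) (y : peirce f g) :
  val x * val y \in peirce_pred e g.
Proof. by apply: peirce_mem; rewrite ?mulrA ?peircel // -mulrA peircer. Qed.
Definition pmul e f g (x : peirce e f) (y : peirce f g) : peirce e g :=
  exist _ (val x * val y) (pmul_mem x y).

Fact pid_mem e : (e : B) \in peirce_pred e e.
Proof. by apply: peirce_mem; rewrite idvK. Qed.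
Definition pid e : peirce e e := exist _ (e : B) (pid_mem e).

Fact plmul_mem f (b : B) (x : peirce (idem1 B) f) :
  b * val x \in peirce_pred (idem1 B) f.
Proof. by apply: peirce_mem; rewrite ?mul1r // -mulrA peircer. Qed.
Definition plmul f (b : B) (x : peirce (idem1 B) f) : peirce (idem1 B) f :=
  exist _ (b * val x) (plmul_mem b x).

Fact prmul_mem f (x : peirce f (idem1 B)) (b : B) :
  val x * b \in peirce_pred f (idem1 B).
Proof. by apply: peirce_mem; rewrite ?mulr1 // mulrA peircel. Qed.
Definition prmul f (x : peirce f (idem1 B)) (b : B) : peirce f (idem1 B) :=
  exist _ (val x * b) (prmul_mem x b).

Fact pe_mem e : (e : B) \in peirce_pred (idem1 B) e.
Proof. by apply: peirce_mem; rewrite ?mul1r ?idvK. Qed.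
Definition pe e : peirce (idem1 B) e := exist _ (e : B) (pe_mem e).
Fact ep_mem e : (e : B) \in peirce_pred e (idem1 B).
Proof. by apply: peirce_mem; rewrite ?mulr1 ?idvK. Qed.
Definition ep e : peirce e (idem1 B) := exist _ (e : B) (ep_mem e).

Lemma pmulDl e f g (x x' : peirce e f) (y : peirce f g) :
  pmul (x + x') y = pmul x y + pmul x' y.
Proof. by apply: val_inj; apply: mulrDl. Qed.
Lemma pmulDr e f g (x : peirce e f) (y y' : peirce f g) :
  pmul x (y + y') = pmul x y + pmul x y'.
Proof. by apply: val_inj; apply: mulrDr. Qed.
Lemma pmulA e f g h (x : peirce e f) (y : peirce f g) (z : peirce g h) :
  pmul x (pmul y z) = pmul (pmul x y) z.
Proof. by apply: val_inj; apply: mulrA. Qed.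
Lemma pmul1l e f (x : peirce e f) : pmul (pid e) x = x.
Proof. by apply: val_inj; apply: peircel. Qed.
Lemma pmul1r e f (x : peirce e f) : pmul x (pid f) = x.
Proof. by apply: val_inj; apply: peircer. Qed.

Section OneSided.
Variables (e f : idem B) (b b' : B).
Implicit Types (x : peirce (idem1 B) f) (y : peirce f (idem1 B)).
Lemma plmulDl x : plmul (b + b') x = plmul b x + plmul b' x.
Proof. by apply: val_inj; apply: mulrDl. Qed.
Lemma plmulDr x x' : plmul b (x + x') = plmul b x + plmul b x'.
Proof. by apply: val_inj; apply: mulrDr. Qed.
Lemma plmul1 x : plmul 1 x = x.
Proof. by apply: val_inj; apply: mul1r. Qed.
Lemma plmulA x : plmul b (plmul b' x) = plmul (b * b') x.
Proof. by apply: val_inj; apply: mulrA. Qed.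
Lemma plmul_pmul x (c : peirce f e) : plmul b (pmul x c) = pmul (plmul b x) c.
Proof. by apply: val_inj; apply: mulrA. Qed.
Lemma prmulDr y : prmul y (b + b') = prmul y b + prmul y b'.
Proof. by apply: val_inj; apply: mulrDr. Qed.
Lemma prmulDl y y' : prmul (y + y') b = prmul y b + prmul y' b.
Proof. by apply: val_inj; apply: mulrDl. Qed.
Lemma prmul1 y : prmul y 1 = y.
Proof. by apply: val_inj; apply: mulr1. Qed.
Lemma prmulA y : prmul (prmul y b) b' = prmul y (b * b').
Proof. by apply: val_inj; apply/esym/mulrA. Qed.
Lemma prmul_pmul (c : peirce e f) y : prmul (pmul c y) b = pmul c (prmul y b).
Proof. by apply: val_inj; apply/esym/mulrA. Qed.
End OneSided.

End PeirceProduct.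

Section Corner.
Variables (K : comPzRingType) (B : kAlgType K) (e : idem B).

(* the K-algebra e B e, with unit e *)
Definition corner : Type := peirce e e.
HB.instance Definition _ := GRing.Zmodule.on corner.
HB.instance Definition _ :=
  GRing.Zmodule_isPzRing.Build corner (@pmulA _ _ e e e e) (@pmul1l _ _ e e)
    (@pmul1r _ _ e e) (@pmulDl _ _ e e e) (@pmulDr _ _ e e e).

Fact cornin_mem (k : K) : kin B k * (e : B) \in peirce_pred e e.
Proof. by apply: peirce_mem; rewrite -?mulrA ?idvK // mulrA -kinC -mulrA idvK. Qed.
Definition cornin (k : K) : corner := exist _ (kin B k * (e : B)) (cornin_mem k).
Fact cornin_additive : zmod_morphism cornin.
Proof. by move=> k l; apply: val_inj; rewrite /= rmorphB mulrBl. Qed.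
Fact cornin_multiplicative : monoid_morphism cornin.
Proof.
split=> [|k l]; apply: val_inj; rewrite /= ?rmorph1 ?mul1r // rmorphM.
by rewrite -!mulrA; congr (_ * _); rewrite mulrA -kinC -mulrA idvK.
Qed.
Fact cornin_central (k : K) (x : corner) : cornin k * x = x * cornin k.
Proof. by apply: val_inj; rewrite /= -mulrA peircel mulrA -kinC -mulrA peircer. Qed.
HB.instance Definition _ :=
  isKAlgebra.Build K corner cornin_additive cornin_multiplicative cornin_central.

(* B e as a right and e B as a left module over e B e; right modules are left
   modules over the converse ring *)
Definition Bidem : Type := peirce (idem1 B) e.
HB.instance Definition _ := GRing.Zmodule.on Bidem.
Definition Bidem_scale (c : corner^c) (x : Bidem) : Bidem := pmul x (c : corner).
Fact Bidem_scaleA c d x : Bidem_scale c (Bidem_scale d x) = Bidem_scale (c * d) x.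
Proof. exact/esym/pmulA. Qed.
Fact Bidem_scale1 : left_id 1 Bidem_scale.
Proof. exact: pmul1r. Qed.
Fact Bidem_scaleDr : right_distributive Bidem_scale +%R.
Proof. by move=> c x y; apply: pmulDl. Qed.
Fact Bidem_scaleDl x : {morph Bidem_scale^~ x : c d / c + d}.
Proof. by move=> c d; apply: pmulDr. Qed.
HB.instance Definition _ := GRing.Zmodule_isLmodule.Build (corner^c) Bidem
  Bidem_scaleA Bidem_scale1 Bidem_scaleDr Bidem_scaleDl.

Definition idemB : Type := peirce e (idem1 B).
HB.instance Definition _ := GRing.Zmodule.on idemB.
Definition idemB_scale (c : corner) (x : idemB) : idemB := pmul c x.
Fact idemB_scaleA c d x : idemB_scale c (idemB_scale d x) = idemB_scale (c * d) x.
Proof. exact: pmulA. Qed.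
Fact idemB_scale1 : left_id 1 idemB_scale.
Proof. exact: pmul1l. Qed.
Fact idemB_scaleDr : right_distributive idemB_scale +%R.
Proof. by move=> c x y; apply: pmulDr. Qed.
Fact idemB_scaleDl x : {morph idemB_scale^~ x : c d / c + d}.
Proof. by move=> c d; apply: pmulDl. Qed.
HB.instance Definition _ := GRing.Zmodule_isLmodule.Build corner idemB
  idemB_scaleA idemB_scale1 idemB_scaleDr idemB_scaleDl.

Lemma pkin_left (k : K) (x : Bidem) :
  plmul (kin B k) x = pmul x (kin corner k : peirce e e).
Proof. by apply: val_inj; rewrite /= mulrA -kinC -mulrA peircer. Qed.
Lemma pkin_right (k : K) (x : idemB) :
  prmul x (kin B k) = pmul (kin corner k : peirce e e) x.
Proof. by apply: val_inj; rewrite /= -mulrA peircel kinC. Qed.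

Definition Bract (x : Bidem) (c : corner) : Bidem := pmul x c.
Definition Blact (c : corner) (y : idemB) : idemB := pmul c y.

(* B e (x)_C e B over B^ev, where C = e B e *)
Fact BeB_bimodule : bimodule (tlact (ra := Bract) (la := Blact) (@plmul K B e))
                             (tract (ra := Bract) (la := Blact) (@prmul K B e)).
Proof.
apply: (@tens_bimodule K B) => [???|b ??|?|???|???|???|b ??|?|???|???|k].
- exact: plmulDl.
- exact: plmulDr.
- exact: plmul1.
- exact: plmulA.
- exact: plmul_pmul.
- exact: prmulDr.
- exact: prmulDl.
- exact: prmul1.
- exact: prmulA.
- exact: prmul_pmul.
- by eexists; split=> ?; [apply: pkin_left|apply: pkin_right].
Qed.
Definition BeB : lmodType (ev B) := evmod BeB_bimodule.

Definition BeB_mul : BeB -> evreg B :=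
  tlift (fun (x : Bidem) (y : idemB) => val x * val y).

Fact BeB_mul_balanced :
  balanced Bract Blact (fun (x : Bidem) (y : idemB) => val x * val y).
Proof.
split=> [x x' y|x y y'|x c y]; [exact: mulrDl|exact: mulrDr|exact/esym/mulrA].
Qed.

Lemma BeB_lactD b : {morph tlact (ra := Bract) (la := Blact) (@plmul K B e) b : s t / s + t}.
Proof.
by apply: tlactD => *; [exact: plmulDr|exact: plmul_pmul].
Qed.
Lemma BeB_ractD b :
  {morph (tract (ra := Bract) (la := Blact) (@prmul K B e))^~ b : s t / s + t}.
Proof.
by apply: tractD => *; [exact: prmulDl|exact: prmul_pmul].
Qed.
Lemma BeB_lactE b x y : tlact (@plmul K B e) b (tpure Bract Blact x y) =
  tpure Bract Blact (plmul b x) y.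
Proof. by apply: tlactE => *; [exact: plmulDr|exact: plmul_pmul]. Qed.
Lemma BeB_ractE b x y : tract (@prmul K B e) (tpure Bract Blact x y) b =
  tpure Bract Blact x (prmul y b).
Proof. by apply: tractE => *; [exact: prmulDl|exact: prmul_pmul]. Qed.

Fact BeB_mul_linear : linear BeB_mul.
Proof.
have bf := BeB_mul_balanced.
have D := tliftD bf.
apply: evmod_linear => // [b|t b]; [|move: t]; apply: tens_ext => [s t|s t|x y].
- by rewrite BeB_lactD; apply: D.
- by rewrite /BeB_mul D mulrDr.
- by rewrite BeB_lactE /BeB_mul !tlift_pure // /= mulrA.
- by rewrite BeB_ractD; apply: D.
- by rewrite /BeB_mul D mulrDl.
- by rewrite BeB_ractE /BeB_mul !tlift_pure // /= mulrA.
Qed.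
HB.instance Definition _ :=
  GRing.isLinear.Build (ev B) BeB (evreg B) _ BeB_mul BeB_mul_linear.

End Corner.

(* The functor B e (x)_C - (x)_C e B from C^ev-modules to B^ev-modules. *)
Section Induction.
Variables (K : comPzRingType) (B : kAlgType K) (e : idem B).
Local Notation C := (corner e).
Local Notation Be := (Bidem e).
Local Notation eB := (idemB e).

Section Object.
Variable P : lmodType (ev C).

Definition BeP : Type := tens (@Bract _ _ e) (@lact _ C P).
HB.instance Definition _ := GRing.Zmodule.on BeP.
Definition bep (x : Be) (p : P) : BeP := tpure (@Bract _ _ e) (@lact _ C P) x p.

Lemma bep_balanced : balanced (@Bract _ _ e) (@lact _ C P) bep.
Proof. exact: tpure_balanced. Qed.

Definition BePl (b : B) : BeP -> BeP := tmap _ _ (@plmul _ _ e b) id.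
Definition BePr (t : BeP) (c : C) : BeP := tmap _ _ id ((@ract _ C P)^~ c) t.

Lemma BePlD b : {morph BePl b : s t / s + t}.
Proof. by apply: tmapD => // *; [exact: plmulDr|exact: plmul_pmul]. Qed.
Lemma BePlE b x p : BePl b (bep x p) = bep (plmul b x) p.
Proof. by apply: tmapE => // *; [exact: plmulDr|exact: plmul_pmul]. Qed.
Lemma BePrD c : {morph BePr^~ c : s t / s + t}.
Proof.
have H := ev_bimodule P.
by apply: tmapD => // *; [move=> ? ?; exact: (bim_raDl H)|exact/esym/(bim_lara H)].
Qed.
Lemma BePrE c x p : BePr (bep x p) c = bep x (ract p c).
Proof.
have H := ev_bimodule P.
by apply: tmapE => // *; [move=> ? ?; exact: (bim_raDl H)|exact/esym/(bim_lara H)].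
Qed.
Lemma BePlr b t c : BePl b (BePr t c) = BePr (BePl b t) c.
Proof.
move: t; apply: tens_ext => [s t|s t|x p].
- by rewrite (BePrD c) BePlD.
- by rewrite BePlD (BePrD c).
- by rewrite BePrE !BePlE BePrE.
Qed.

Fact ind_bimodule : bimodule (tlact (ra := BePr) (la := @Blact _ _ e) BePl)
                             (tract (ra := BePr) (la := @Blact _ _ e) (@prmul K B e)).
Proof.
have H := ev_bimodule P.
have [hl hr hb] := bep_balanced.
apply: (@tens_bimodule K B) => [b b'|b ??||b b'|b + c|???|b ??|?|???|???|k].
- apply: tens_ext => [|s t|x p]; first exact: BePlD.
    by rewrite !BePlD addrACA.
  by rewrite !BePlE plmulDl hl.
- exact: BePlD.
- by apply: tens_ext => // [|x p]; [exact: BePlD|rewrite BePlE plmul1].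
- apply: tens_ext => [s t||x p]; [by rewrite !BePlD|exact: BePlD|].
  by rewrite !BePlE plmulA.
- by move=> t; apply: BePlr.
- exact: prmulDr.
- exact: prmulDl.
- exact: prmul1.
- exact: prmulA.
- exact: prmul_pmul.
exists (kin C k); split=> [|y]; last exact: pkin_right.
apply: tens_ext => [||x p]; [exact: BePlD|exact: BePrD|].
by rewrite BePlE BePrE -(bim_kin H) -hb pkin_left.
Qed.
Definition ind : lmodType (ev B) := evmod ind_bimodule.

Definition indp (x : Be) (p : P) (y : eB) : ind := tpure BePr (@Blact _ _ e) (bep x p) y.

Lemma ind_lactD b : {morph tlact (ra := BePr) (la := @Blact _ _ e) BePl b : s t / s + t}.
Proof. by apply: tlactD => *; [exact: BePlD|exact: BePlr]. Qed.
Lemma ind_ractD b :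
  {morph (tract (ra := BePr) (la := @Blact _ _ e) (@prmul K B e))^~ b : s t / s + t}.
Proof. by apply: tractD => *; [exact: prmulDl|exact: prmul_pmul]. Qed.
Lemma ind_lactE b t y : tlact BePl b (tpure BePr (@Blact _ _ e) t y) =
  tpure BePr (@Blact _ _ e) (BePl b t) y.
Proof. by apply: tlactE => *; [exact: BePlD|exact: BePlr]. Qed.
Lemma ind_ractE b t y : tract (@prmul K B e) (tpure BePr (@Blact _ _ e) t y) b =
  tpure BePr (@Blact _ _ e) t (prmul y b).
Proof. by apply: tractE => *; [exact: prmulDl|exact: prmul_pmul]. Qed.

End Object.

Section Functor.
Variables (P Q : lmodType (ev C)) (f : {linear P -> Q}).

Definition BeP_map : BeP P -> BeP Q := tmap _ _ id f.
Definition ind_map : ind P -> ind Q := tmap _ _ BeP_map id.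

Lemma BeP_mapD : {morph BeP_map : s t / s + t}.
Proof. by apply: tmapD => // *; [exact: linearD|exact: linearZ]. Qed.
Lemma BeP_mapE x p : BeP_map (bep x p) = bep x (f p).
Proof. by apply: tmapE => // *; [exact: linearD|exact: linearZ]. Qed.
Lemma BeP_map_r t c : BeP_map (BePr t c) = BePr (BeP_map t) c.
Proof.
move: t; apply: tens_ext => [s t|s t|x p].
- by rewrite (BePrD c) BeP_mapD.
- by rewrite BeP_mapD (BePrD c).
- by rewrite BePrE !BeP_mapE BePrE linearZ.
Qed.
Lemma ind_mapD : {morph ind_map : s t / s + t}.
Proof. by apply: tmapD => // *; [exact: BeP_mapD|exact: BeP_map_r]. Qed.
Lemma ind_map_pure t y : ind_map (tpure (@BePr P) (@Blact _ _ e) t y) =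
  tpure (@BePr Q) (@Blact _ _ e) (BeP_map t) y.
Proof. by apply: tmapE => // *; [exact: BeP_mapD|exact: BeP_map_r]. Qed.
Lemma ind_mapE x p y : ind_map (indp x p y) = indp x (f p) y.
Proof. by rewrite /indp ind_map_pure BeP_mapE. Qed.

Fact ind_map_linear : linear ind_map.
Proof.
apply: evmod_linear => [|b|t b]; [exact: ind_mapD| |move: t];
  apply: tens_ext => [s t|s t|t y].
- by rewrite ind_lactD ind_mapD.
- by rewrite ind_mapD ind_lactD.
- rewrite ind_lactE !ind_map_pure ind_lactE; congr (tpure _ _ _ _).
  move: t; apply: tens_ext => [s t|s t|x p].
  + by rewrite BePlD BeP_mapD.
  + by rewrite BeP_mapD BePlD.
  + by rewrite BePlE !BeP_mapE BePlE.
- by rewrite ind_ractD ind_mapD.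
- by rewrite ind_mapD ind_ractD.
- by rewrite ind_ractE !ind_map_pure ind_ractE.
Qed.
HB.instance Definition _ :=
  GRing.isLinear.Build (ev B) (ind P) (ind Q) _ ind_map ind_map_linear.
End Functor.

Section Augmentation.
Variables (P : lmodType (ev C)) (f : {linear P -> evreg C}).

Definition BeP_aug : BeP P -> Be := tlift (fun x p => Bract x (f p)).
Definition ind_aug : ind P -> BeB e := tmap _ _ BeP_aug id.

Fact BeP_aug_balanced :
  balanced (@Bract _ _ e) (@lact _ C P) (fun x p => Bract x (f p)).
Proof.
split=> [x x' p|x p q|x c p].
- exact: pmulDl.
- by rewrite linearD; apply: pmulDr.
- have -> : f (lact c p) = (c * f p : C).
    have -> : f (lact c p) = evp c 1 *: f p by exact: linearZ.
    by rewrite [LHS]evregE mulr1.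
  exact/esym/pmulA.
Qed.
Lemma BeP_augD : {morph BeP_aug : s t / s + t}.
Proof. exact/tliftD/BeP_aug_balanced. Qed.
Lemma BeP_augE x p : BeP_aug (bep x p) = Bract x (f p).
Proof. exact/tlift_pure/BeP_aug_balanced. Qed.
Lemma BeP_aug_r t c : BeP_aug (BePr t c) = Bract (BeP_aug t) c.
Proof.
move: t; apply: tens_ext => [s t|s t|x p].
- by rewrite (BePrD c) BeP_augD.
- by rewrite BeP_augD; apply: pmulDl.
- rewrite BePrE !BeP_augE; have -> : f (ract p c) = (f p * c : C).
    have -> : f (ract p c) = evp 1 c *: f p by exact: linearZ.
    by rewrite [LHS]evregE mul1r.
  exact: pmulA.
Qed.
Lemma ind_augD : {morph ind_aug : s t / s + t}.
Proof. by apply: tmapD => // *; [exact: BeP_augD|exact: BeP_aug_r]. Qed.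
Lemma ind_aug_pure t y : ind_aug (tpure (@BePr P) (@Blact _ _ e) t y) =
  tpure (@Bract _ _ e) (@Blact _ _ e) (BeP_aug t) y.
Proof. by apply: tmapE => // *; [exact: BeP_augD|exact: BeP_aug_r]. Qed.
Lemma ind_augE x p y : ind_aug (indp x p y) =
  tpure (@Bract _ _ e) (@Blact _ _ e) (Bract x (f p)) y.
Proof. by rewrite /indp ind_aug_pure BeP_augE. Qed.

Fact ind_aug_linear : linear ind_aug.
Proof.
apply: evmod_linear => [|b|t b]; [exact: ind_augD| |move: t];
  apply: tens_ext => [s t|s t|t y].
- by rewrite ind_lactD ind_augD.
- by rewrite ind_augD BeB_lactD.
- rewrite ind_lactE !ind_aug_pure BeB_lactE; congr (tpure _ _ _ _).
  move: t; apply: tens_ext => [s t|s t|x p].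
  + by rewrite BePlD BeP_augD.
  + by rewrite BeP_augD; apply: plmulDr.
  + by rewrite BePlE !BeP_augE; apply/esym/plmul_pmul.
- by rewrite ind_ractD ind_augD.
- by rewrite ind_augD BeB_ractD.
- by rewrite ind_ractE !ind_aug_pure BeB_ractE.
Qed.
HB.instance Definition _ :=
  GRing.isLinear.Build (ev B) (ind P) (BeB e) _ ind_aug ind_aug_linear.
End Augmentation.

End Induction.
(* ker f / (im g n ker f), for  W --g--> U --f--> V *)
Section Homology.
Variables (W U V : zmodType) (g : {additive W -> U}) (f : {additive U -> V}).

Definition cyc_pred : {pred U} := [pred x | f x == 0].
Fact cyc_zmod_closed : zmod_closed cyc_pred.
Proof.
split=> [|x y]; rewrite !inE ?raddf0 // => /eqP fx /eqP fy.
by rewrite raddfB fx fy subrr.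
Qed.
HB.instance Definition _ := GRing.isZmodClosed.Build U cyc_pred cyc_zmod_closed.

Definition cyc : Type := {x : U | x \in cyc_pred}.
HB.instance Definition _ := SubType.copy cyc {x : U | x \in cyc_pred}.
HB.instance Definition _ := [Choice of cyc by <:].
HB.instance Definition _ := [SubChoice_isSubZmodule of cyc by <:].

Definition bnd_pred : {pred cyc} := [pred z | `[< exists w, g w = val z >]].
Fact bnd_zmod_closed : zmod_closed bnd_pred.
Proof.
split=> [|x y]; rewrite !inE; first by exists 0; rewrite raddf0.
move=> [v gv] [w gw]; exists (v - w).
by rewrite raddfB gv gw.
Qed.
HB.instance Definition _ := GRing.isZmodClosed.Build cyc bnd_pred bnd_zmod_closed.

Definition homology : Type := Quotient.quot bnd_pred.
HB.instance Definition _ := GRing.Zmodule.on homology.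
HB.instance Definition _ := EqQuotient.on homology.

Definition is_class (z : U) (x : homology) : Prop :=
  exists c : cyc, val c = z /\ \pi_homology c = x.
End Homology.

Section LinearHomology.
Variables (K : comPzRingType) (W U V : lmodType K).
Variables (g : {linear W -> U}) (f : {linear U -> V}).

Definition lhomology : Type := homology g f.
HB.instance Definition _ := GRing.Zmodule.on lhomology.

Fact cycZ_mem (k : K) (c : cyc f) : k *: val c \in cyc_pred f.
Proof.
apply/eqP; apply: etrans (linearZZ f k (val c)) _.
by have /eqP fc := valP c; apply: etrans (congr1 _ fc) (scaler0 _ _).
Qed.
Definition cycZ (k : K) (c : cyc f) : cyc f := exist _ (k *: val c) (cycZ_mem k c).
Definition hscale (k : K) (x : lhomology) : lhomology :=
  \pi_(homology g f) (cycZ k (repr (x : homology g f))).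


Lemma pi_eqP (c d : cyc f) :
  reflect (\pi_(homology g f) c = \pi_(homology g f) d) (c - d \in bnd_pred g (f := f)).
Proof. by rewrite Quotient.idealrBE; apply: eqP. Qed.

Lemma hscale_pi k (c : cyc f) : hscale k (\pi_(homology g f) c) = \pi_(homology g f) (cycZ k c).
Proof.
apply/pi_eqP; have /pi_eqP := reprK (\pi_(homology g f) c).
rewrite !inE => -[w gw]; exists (k *: w); apply: etrans (linearZZ g k w) _. rewrite gw.
exact: scalerBr.
Qed.

Lemma pi_surj (x : lhomology) : exists c, x = \pi_(homology g f) c.
Proof. by exists (repr (x : homology g f)); rewrite reprK. Qed.

Fact hscaleA k l x : hscale k (hscale l x) = hscale (k * l) x.
Proof.
have [c ->] := pi_surj x; rewrite !hscale_pi; congr (\pi _).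
by apply: val_inj; apply: scalerA.
Qed.
Fact hscale1 : left_id 1 hscale.
Proof.
move=> x; have [c ->] := pi_surj x; rewrite hscale_pi; congr (\pi _).
by apply: val_inj; apply: scale1r.
Qed.
Fact hscaleDr : right_distributive hscale +%R.
Proof.
move=> k x y; have [c ->] := pi_surj x; have [d ->] := pi_surj y.
rewrite -[X in hscale k X]Quotient.pi_add !hscale_pi -[RHS]Quotient.pi_add.
by congr (\pi _); apply: val_inj; apply: scalerDr.
Qed.
Fact hscaleDl x : {morph hscale^~ x : k l / k + l}.
Proof.
move=> k l; have [c ->] := pi_surj x; rewrite !hscale_pi -[RHS]Quotient.pi_add.
by congr (\pi _); apply: val_inj; apply: scalerDl.
Qed.
HB.instance Definition _ := GRing.Zmodule_isLmodule.Build K lhomology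
  hscaleA hscale1 hscaleDr hscaleDl.

End LinearHomology.
Lemma linear_eq (R : pzRingType) (M N : lmodType R) (f g : {linear M -> N}) :
  f =1 g -> f = g.
Proof.
case: f g => [f [[hf] [sf]]] [g [[hg] [sg]]] /funext /= E; case: _ / E in hg sg *.
by rewrite (Prop_irrelevance hf hg) (Prop_irrelevance sf sg).
Qed.

Section Hom.
Variables (K : comPzRingType) (R : kAlgType K) (M N : lmodType R).

Definition Hom : Type := {linear M -> N}.
HB.instance Definition _ := gen_eqMixin Hom.
HB.instance Definition _ := gen_choiceMixin Hom.

Implicit Types f g : {linear M -> N}.

Definition hom_scale (k : K) f (x : M) : N := kin R k *: f x.
Fact hom_scale_linear (k : K) f : linear (hom_scale k f).
Proof. by move=> a x y; rewrite /hom_scale linearP scalerDr !scalerA kinC. Qed.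
HB.instance Definition _ (k : K) f :=
  GRing.isLinear.Build R M N _ (hom_scale k f) (hom_scale_linear k f).

Definition hom0 : Hom := \0 : {linear M -> N}.
Definition homN (f : Hom) : Hom := (\- (f : {linear M -> N})) : {linear M -> N}.
Definition homD (f g : Hom) : Hom :=
  ((f : {linear M -> N}) \+ (g : {linear M -> N})) : {linear M -> N}.
Definition homZ (k : K) (f : Hom) : Hom := hom_scale k f : {linear M -> N}.

Fact homDA : associative homD.
Proof. by move=> f g h; apply: linear_eq => x; apply: addrA. Qed.
Fact homDC : commutative homD.
Proof. by move=> f g; apply: linear_eq => x; apply: addrC. Qed.
Fact hom0D : left_id hom0 homD.
Proof. by move=> f; apply: linear_eq => x; apply: add0r. Qed.
Fact homND : left_inverse hom0 homN homD.
Proof. by move=> f; apply: linear_eq => x; apply: addNr. Qed.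
HB.instance Definition _ := GRing.isZmodule.Build Hom homDA homDC hom0D homND.

Fact homZA k l f : homZ k (homZ l f) = homZ (k * l) f.
Proof. by apply: linear_eq => x; rewrite /= /hom_scale /= /hom_scale scalerA rmorphM. Qed.
Fact hom1Z : left_id 1 homZ.
Proof. by move=> f; apply: linear_eq => x; rewrite /= /hom_scale rmorph1 scale1r. Qed.
Fact homZDr : right_distributive homZ +%R.
Proof. by move=> k f g; apply: linear_eq => x; apply: scalerDr. Qed.
Fact homZDl f : {morph homZ^~ f : k l / k + l}.
Proof.
by move=> k l; apply: linear_eq => x; rewrite /= /hom_scale rmorphD scalerDl.
Qed.
HB.instance Definition _ :=
  GRing.Zmodule_isLmodule.Build K Hom homZA hom1Z homZDr homZDl.
End Hom.

Section Precomposition.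
Variables (K : comPzRingType) (R : kAlgType K) (M M' N : lmodType R).
Variable u : {linear M -> M'}.

Definition precomp (f : Hom M' N) : Hom M N :=
  ((f : {linear M' -> N}) \o u) : {linear M -> N}.
Fact precomp_linear : linear precomp.
Proof. by move=> k f g; apply: linear_eq. Qed.
HB.instance Definition _ :=
  GRing.isLinear.Build K (Hom M' N) (Hom M N) _ precomp precomp_linear.
End Precomposition.

Record cochain (K : pzRingType) := Cochain {
  cch_mod :> nat -> lmodType K;
  cch_d : forall n, {linear cch_mod n -> cch_mod n.+1} }.

Record chain (R : pzRingType) := Chain {
  ch_mod :> nat -> lmodType R;
  ch_d : forall n, {linear ch_mod n.+1 -> ch_mod n} }.

Section Cohomology.
Variables (K : comPzRingType) (X : cochain K).

Definition cch_din (n : nat) : {linear X n.-1 -> X n} :=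
  match n with 0 => \0 | m.+1 => cch_d X m end.

Definition coh (n : nat) : lmodType K := lhomology (cch_din n) (cch_d X n).

Definition coh_class n (z : X n) (x : coh n) : Prop :=
  is_class (g := cch_din n) (f := cch_d X n) z x.
End Cohomology.

Section Exactness.
Variable R : pzRingType.

Definition exact_at (U V W : lmodType R) (g : U -> V) (f : V -> W) : Prop :=
  forall y, f y = 0 <-> exists x, g x = y.

Definition short_exact (U V W : lmodType R) (g : U -> V) (f : V -> W) : Prop :=
  [/\ injective g, exact_at g f & forall z, exists y, f y = z].

Definition projective (P : lmodType R) : Prop :=
  forall (M N : lmodType R) (p : {linear M -> N}) (f : {linear P -> N}),
    (forall y, exists x, p x = y) ->
    exists f' : {linear P -> M}, forall x, p (f' x) = f x.

Definition proj_resolution (P : chain R) (M : lmodType R) (eps : {linear P 0 -> M}) :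
    Prop :=
  [/\ forall n, projective (P n),
      forall m, exists x, eps x = m,
      exact_at (ch_d P 0) eps &
      forall n, exact_at (ch_d P n.+1) (ch_d P n)].

Definition chain_map (P P' : chain R) (M M' : lmodType R) (eps : {linear P 0 -> M})
    (eps' : {linear P' 0 -> M'}) (u : {linear M -> M'})
    (phi : forall n, {linear P n -> P' n}) : Prop :=
  (forall x, eps' (phi 0 x) = u (eps x)) /\
  (forall n x, ch_d P' n (phi n.+1 x) = phi n (ch_d P n x)).
End Exactness.

Section Ext.
Variables (K : comPzRingType) (R : kAlgType K).

Definition hom_cochain (P : chain R) (N : lmodType R) : cochain K :=
  @Cochain K (fun n => Hom (P n) N) (fun n => precomp (N := N) (ch_d P n)).

(* Ext^n_R (M, N), computed with a projective resolution P of M *)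
Definition Ext (P : chain R) (N : lmodType R) (n : nat) : lmodType K :=
  coh (hom_cochain P N) n.

Definition Ext_class (P : chain R) (N : lmodType R) (n : nat)
    (f : {linear P n -> N}) (x : Ext P N n) : Prop :=
  coh_class (X := hom_cochain P N) (f : Hom (P n) N) x.

(* F is the map Ext (M', N) -> Ext (M, N) induced by u : M -> M' *)
Definition Ext_induced (P P' : chain R) (M M' : lmodType R) (eps : {linear P 0 -> M})
    (eps' : {linear P' 0 -> M'}) (u : {linear M -> M'}) (N : lmodType R)
    (F : forall n, {linear Ext P' N n -> Ext P N n}) : Prop :=
  exists2 phi : forall n, {linear P n -> P' n}, chain_map eps eps' u phi &
    forall n (f : {linear P' n -> N}) (x : Ext P' N n),
      Ext_class f x -> Ext_class (f \o phi n : {linear P n -> N}) (F n x).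

(* D is the connecting map Ext^n (M', N) -> Ext^(n+1) (M'', N) attached to
   0 -> M' --i--> M --p--> M'' -> 0, that is, the connecting map of the short
   exact sequence of complexes 0 -> Hom (P'', N) -> Hom (P, N) -> Hom (P', N) -> 0
   for a short exact sequence 0 -> P' -> P -> P'' -> 0 of projective resolutions. *)
Definition Ext_connecting (M' M M'' : lmodType R) (i : {linear M' -> M})
    (p : {linear M -> M''}) (P' P'' : chain R) (eps' : {linear P' 0 -> M'})
    (eps'' : {linear P'' 0 -> M''}) (N : lmodType R)
    (D : forall n, {linear Ext P' N n -> Ext P'' N n.+1}) : Prop :=
  exists (P : chain R) (eps : {linear P 0 -> M})
         (j : forall n, {linear P' n -> P n}) (q : forall n, {linear P n -> P'' n}),
  [/\ proj_resolution eps,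
      chain_map eps' eps i j /\ chain_map eps eps'' p q,
      forall n, short_exact (j n) (q n) &
      forall n (f : {linear P' n -> N}) (h : {linear P n -> N})
             (c : {linear P'' n.+1 -> N}) (x : Ext P' N n),
        Ext_class f x ->
        (forall y, h (j n y) = f y) ->
        (forall y, c (q n.+1 y) = h (ch_d P n y)) ->
        Ext_class c (D n x)].
End Ext.

(* Tor^R_n (M, N), computed with a projective resolution Q of the right R-module
   M; right modules are left modules over the converse ring R^c *)
Section Tor.
Variables (R : pzRingType) (Q : chain R^c) (N : lmodType R).

Definition rtact (M : lmodType R^c) (m : M) (c : R) : M := (c : R^c) *: m.
Definition rtens (M : lmodType R^c) : zmodType :=
  tens (@rtact M) (fun (c : R) (x : N) => c *: x).

Definition rtens_map (M M' : lmodType R^c) (f : {linear M -> M'}) :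
  rtens M -> rtens M' := tmap _ _ f id.

Fact rtens_map_additive (M M' : lmodType R^c) (f : {linear M -> M'}) : zmod_morphism (rtens_map f).
Proof.
have D : {morph rtens_map f : x y / x + y}.
  by apply: tmapD => // *; [exact: linearD|exact: linearZ].
by move=> x y; apply: (addIr (rtens_map f y)); rewrite -D !subrK.
Qed.
HB.instance Definition _ (M M' : lmodType R^c) (f : {linear M -> M'}) :=
  GRing.isZmodMorphism.Build (rtens M) (rtens M') (rtens_map f) (rtens_map_additive f).

Definition Tor_dout (n : nat) : {additive rtens (Q n) -> rtens (Q n.-1)} :=
  match n with 0 => \0 | m.+1 => rtens_map (ch_d Q m) end.

Definition Tor (n : nat) : zmodType :=
  homology (rtens_map (ch_d Q n)) (Tor_dout n).
End Tor.
(* a_0, ..., a_(n-1) as an infinite sequence, padded with zeros *)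
Definition pad (T : nmodType) (n : nat) (a : 'I_n -> T) (k : nat) : T :=
  if insub k is Some i then a i else 0.

Definition upd (T : Type) (n : nat) (a : 'I_n -> T) (i : 'I_n) (x : T) : 'I_n -> T :=
  fun j => if j == i then x else a j.

Lemma pad_ord (T : nmodType) n (a : 'I_n -> T) (i : 'I_n) : pad a i = a i.
Proof. by rewrite /pad insubT //= => h; congr a; apply: val_inj. Qed.

Lemma pad_upd (T : nmodType) n (a : 'I_n -> T) (i : 'I_n) x k :
  pad (upd a i x) k = if k == i then x else pad a k.
Proof.
rewrite /pad; case: insubP => [j hj <-|hk]; first by rewrite /upd.
by case: eqP hk => // ->; rewrite ltn_ord.
Qed.

Section Multilinear.
Variables (K : comPzRingType) (L : kAlgType K).

Definition kmod : lmodType K := kres (L^o : lmodType L).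

(* K-multilinear maps L^n -> V, i.e. K-linear maps from the n-th tensor power *)
Definition multilinear (n : nat) (V : lmodType K) (f : ('I_n -> L) -> V) : Prop :=
  forall a i k x y,
    f (upd a i (kin L k * x + y)) = k *: f (upd a i x) + f (upd a i y).

Lemma kmodZ (k : K) (x : L) : k *: (x : kmod) = kin L k * x :> L.
Proof. by []. Qed.

Definition klin (psi : L -> L) : Prop :=
  forall k x y, psi (kin L k * x + y) = kin L k * psi x + psi y.

Lemma klin_id : klin id.
Proof. by []. Qed.

Lemma multilinear_comp m n (V : lmodType K) (phi : ('I_m -> L) -> ('I_n -> L)) f :
  (forall a i, exists j psi, klin psi /\
     forall x, phi (upd a i x) = upd (phi a) j (psi x)) ->
  multilinear (V := V) f -> multilinear (fun a => f (phi a)).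
Proof.
move=> H hf a i k x y; have [j [psi [lpsi E]]] := H a i.
by rewrite !E lpsi hf.
Qed.

Lemma multilinear_sum n (V : lmodType K) (I : finType) (F : I -> ('I_n -> L) -> V) :
  (forall i, multilinear (F i)) -> multilinear (fun a => \sum_i F i a).
Proof.
move=> H a i k x y; rewrite scaler_sumr -big_split /=.
by apply: eq_bigr => j _; apply: H.
Qed.

Lemma multilinearD n (V : lmodType K) (f g : ('I_n -> L) -> V) :
  multilinear f -> multilinear g -> multilinear (fun a => f a + g a).
Proof. by move=> hf hg a i k x y; rewrite hf hg scalerDr addrACA. Qed.

Lemma multilinear_sign n (s : nat) (f : ('I_n -> L) -> kmod) :
  multilinear f -> multilinear (fun a => (-1) ^+ s * (f a : L) : kmod).
Proof.
move=> hf a i k x y; rewrite hf.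
case: (odd s) (signr_odd L s) => <-; rewrite ?expr0 ?expr1 ?mul1r // !mulN1r.
by rewrite scalerN opprD.
Qed.

Definition hcoch_pred (n : nat) : {pred ('I_n -> L) -> kmod} :=
  [pred f | `[< multilinear f >]].
Arguments hcoch_pred n _ : clear implicits.
Fact hcoch_submod_closed n : submod_closed (hcoch_pred n).
Proof.
split=> [|c f g]; rewrite !inE.
  by move=> a i k x y; rewrite /= scaler0 addr0.
move=> hf hg a i k x y; have E b : (c *: f + g) b = c *: f b + g b by [].
rewrite !E hf hg !scalerDr !scalerA addrACA.
by rewrite [c * k]mulrC.
Qed.
HB.instance Definition _ n :=
  GRing.isSubmodClosed.Build K (('I_n -> L) -> kmod) (hcoch_pred n)
    (hcoch_submod_closed n).

Definition hcoch (n : nat) : Type := {f : ('I_n -> L) -> kmod | f \in hcoch_pred n}.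
HB.instance Definition _ n := SubType.copy (hcoch n) {f : ('I_n -> L) -> kmod | f \in hcoch_pred n}.
HB.instance Definition _ n := [Choice of hcoch n by <:].
HB.instance Definition _ n := [SubChoice_isSubLmodule of hcoch n by <:].

Lemma hcochP n (f : hcoch n) : multilinear (val f).
Proof. by have := valP f; rewrite inE. Qed.

Definition merge (n i : nat) (a : nat -> L) : 'I_n -> L := fun j =>
  if (j < i)%N then a j else if j == i :> nat then a i * a i.+1 else a j.+1.

Definition hdiff_fun (n : nat) (f : ('I_n -> L) -> L) (a : nat -> L) : L :=
  a 0%N * f (fun j => a j.+1)
  + \sum_(i < n) (-1) ^+ i.+1 * f (merge i a)
  + (-1) ^+ n.+1 * (f (fun j => a j) * a n).

Ltac pad_cases :=
  repeat (case: ltnP => ?); repeat (case: eqP => ?); first [done|exfalso; lia].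

Lemma merge_upd n (i : 'I_n) (a : 'I_n.+1 -> L) (q : 'I_n.+1) :
  exists j psi, klin psi /\
    forall x, @merge n i (pad (upd a q x)) = upd (@merge n i (pad a)) j (psi x).
Proof.
case: i q => i ilt [q qlt] /=; have [qi|iq|qi] := ltngtP q i.
- have qn : (q < n)%N by lia.
  exists (Ordinal qn), id; split=> // x; apply/funext => -[j jlt].
  by rewrite /merge /upd !pad_upd -val_eqE /=; pad_cases.
- case: (ltngtP q i.+1) => qi1; first by lia.
  + have qn : (q.-1 < n)%N by lia.
    exists (Ordinal qn), id; split=> // x; apply/funext => -[j jlt].
    by rewrite /merge /upd !pad_upd -val_eqE /=; pad_cases.
  + exists (Ordinal ilt), (fun x => pad a i * x); split=> [k x y|x].
      by rewrite mulrDr !mulrA kinC.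
    apply/funext => -[j jlt].
    by rewrite /merge /upd !pad_upd -val_eqE /=; pad_cases.
- exists (Ordinal ilt), (fun x => x * pad a i.+1); split=> [k x y|x].
    by rewrite mulrDl !mulrA.
  apply/funext => -[j jlt].
  by rewrite /merge /upd !pad_upd -val_eqE /=; pad_cases.
Qed.

Lemma multilinear_mul m (F G : ('I_m -> L) -> L) :
  (forall a i,
     klin (fun x => F (upd a i x)) /\ (forall x, G (upd a i x) = G a) \/
     (forall x, F (upd a i x) = F a) /\ klin (fun x => G (upd a i x))) ->
  multilinear (fun a => F a * G a : kmod).
Proof.
move=> H a i k x y; case: (H a i) => -[hF hG]; rewrite [RHS]/(_ + _) /=.
  by rewrite hF !hG mulrDl -mulrA.
by rewrite !hF hG mulrDr mulrA -kinC -mulrA.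
Qed.

Lemma multilinear_klin n (f : ('I_n -> L) -> kmod) a i :
  multilinear f -> klin (fun x => f (upd a i x)).
Proof. by move=> hf k x y; apply: hf. Qed.

Lemma multilinear_hdiff n (f : ('I_n -> L) -> kmod) :
  multilinear f -> multilinear (fun a : 'I_n.+1 -> L => hdiff_fun f (pad a) : kmod).
Proof.
move=> hf; apply: multilinearD; first apply: multilinearD.
- apply: multilinear_mul => a [[|q] qlt].
    left; split=> [k x y|x]; first by rewrite !pad_upd.
    by congr f; apply/funext => j; rewrite pad_upd.
  have qn : (q < n)%N by [].
  right; split=> [x|]; first by rewrite pad_upd.
  have E x : (fun j : 'I_n => pad (upd a (Ordinal qlt) x) j.+1) =
      upd (fun j : 'I_n => pad a j.+1) (Ordinal qn) x.
    by apply/funext => -[j jlt]; rewrite /upd !pad_upd -val_eqE.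
  by move=> k x y; rewrite !E hf.
- apply: multilinear_sum => i; apply: multilinear_sign.
  apply: (multilinear_comp (phi := fun a : 'I_n.+1 -> L => merge i (pad a))) hf.
  by move=> a q; apply: merge_upd.
- apply: multilinear_sign; apply: multilinear_mul => a [q qlt].
  have [qn|nq] := ltnP q n; [left|right]; split.
  + have E x : (fun j : 'I_n => pad (upd a (Ordinal qlt) x) j) =
        upd (fun j : 'I_n => pad a j) (Ordinal qn) x.
      by apply/funext => -[j jlt]; rewrite /upd !pad_upd -val_eqE.
    by move=> k x y; rewrite !E hf.
  + by move=> x; rewrite pad_upd /=; case: eqP => //; lia.
  + move=> x; congr f; apply/funext => -[j jlt]; rewrite pad_upd /=.
    by case: eqP => //; lia.
  + by move=> k x y; rewrite !pad_upd /=; case: eqP => //; lia.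
Qed.

Definition hcoch_mk n (f : ('I_n -> L) -> kmod) (hf : multilinear f) : hcoch n :=
  exist _ f (introT (asboolP _) hf).

Definition hdiff n (f : hcoch n) : hcoch n.+1 := hcoch_mk (multilinear_hdiff (hcochP f)).

Fact hdiff_linear n : linear (@hdiff n).
Proof.
move=> c f g; apply: val_inj; apply/funext => a.
change (hdiff_fun (val (c *: f + g)) (pad a) =
  kin L c * hdiff_fun (val f) (pad a) + hdiff_fun (val g) (pad a) :> L).
have E b : (c *: val f + val g) b = kin L c * val f b + val g b :> L by [].
have D x y z : x * (kin L c * y + z) = kin L c * (x * y) + x * z :> L.
  by rewrite mulrDr mulrA -kinC -mulrA.
rewrite /hdiff_fun /= !E !D.
under eq_bigr do rewrite E D.
rewrite big_split /= -mulr_sumr mulrDl -[_ * _ * pad a n]mulrA D.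
by rewrite (addrACA (kin L c * _)) [LHS]addrACA !mulrDr.
Qed.
HB.instance Definition _ n :=
  GRing.isLinear.Build K (hcoch n) (hcoch n.+1) _ (@hdiff n) (@hdiff_linear n).

Definition hochschild : cochain K := @Cochain K hcoch hdiff.

Definition hcup_fun (m n : nat) (f : ('I_m -> L) -> L) (g : ('I_n -> L) -> L)
    (a : nat -> L) : L :=
  f (fun j => a j) * g (fun j => a (m + j)%N).

Definition insert (m n i : nat) (g : ('I_n -> L) -> L) (a : nat -> L) : 'I_m -> L :=
  fun j => if (j < i)%N then a j
           else if j == i :> nat then g (fun k => a (i + k)%N)
           else a (j + n).-1.

(* The insertion index starts at 0, and n + 1 replaces n - 1 in the sign: n may be 0. *)
Definition hcirc_fun (m n : nat) (f : ('I_m -> L) -> L) (g : ('I_n -> L) -> L)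
    (a : nat -> L) : L :=
  \sum_(i < m) (-1) ^+ (i * n.+1) * f (insert i g a).

Definition hbrk_fun (m n : nat) (f : ('I_m -> L) -> L) (g : ('I_n -> L) -> L)
    (a : nat -> L) : L :=
  hcirc_fun f g a - (-1) ^+ (m.+1 * n.+1) * hcirc_fun g f a.

Lemma multilinear_hcup m n (f : hcoch m) (g : hcoch n) :
  multilinear (fun a : 'I_(m + n) -> L => hcup_fun (val f) (val g) (pad a) : kmod).
Proof.
have [hf hg] := (hcochP f, hcochP g).
apply: multilinear_mul => a [q qlt].
have [qn|nq] := ltnP q m; [left|right]; split.
+ have E x : (fun j : 'I_m => pad (upd a (Ordinal qlt) x) j) =
      upd (fun j : 'I_m => pad a j) (Ordinal qn) x.
    by apply/funext => -[j jlt]; rewrite /upd !pad_upd -val_eqE.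
  by move=> k x y; rewrite !E hf.
+ move=> x; congr (val g _); apply/funext => -[j jlt]; rewrite pad_upd /=.
  by case: eqP => //; lia.
+ move=> x; congr (val f _); apply/funext => -[j jlt]; rewrite pad_upd /=.
  by case: eqP => //; lia.
+ have qm : (q - m < n)%N by lia.
  have E x : (fun j : 'I_n => pad (upd a (Ordinal qlt) x) (m + j)%N) =
      upd (fun j : 'I_n => pad a (m + j)%N) (Ordinal qm) x.
    apply/funext => -[j jlt]; rewrite /upd !pad_upd -val_eqE /=; pad_cases.
  by move=> k x y; rewrite !E hg.
Qed.

Lemma multilinear_hcirc m n p (f : hcoch m) (g : hcoch n) : p = (m + n).-1 ->
  multilinear (fun a : 'I_p -> L => hcirc_fun (val f) (val g) (pad a) : kmod).
Proof.
have [hf hg] := (hcochP f, hcochP g).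
move=> pE; apply: multilinear_sum => -[i ilt]; apply: multilinear_sign.
apply: (multilinear_comp (phi := fun a : 'I_p -> L => insert i (val g) (pad a))) hf.
move=> a [q qlt]; have [qi|iq] := ltnP q i.
  have qm : (q < m)%N by lia.
  exists (Ordinal qm), id; split=> // x; apply/funext => -[j jlt].
  rewrite /insert /upd !pad_upd -val_eqE /=.
  have -> : (fun k : 'I_n => pad (upd a (Ordinal qlt) x) (i + k)%N) =
            (fun k : 'I_n => pad a (i + k)%N).
    by apply/funext => k; rewrite pad_upd /=; case: eqP => //; lia.
  by pad_cases.
have [qin|inq] := ltnP q (i + n).
  have qn : (q - i < n)%N by lia.
  exists (Ordinal ilt).
  exists (fun x => val g (upd (fun k : 'I_n => pad a (i + k)%N) (Ordinal qn) x)).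
  split=> [|x]; first exact: multilinear_klin.
  apply/funext => -[j jlt].
  rewrite /insert /upd !pad_upd -val_eqE /=.
  have -> : (fun k : 'I_n => pad (upd a (Ordinal qlt) x) (i + k)%N) =
            upd (fun k : 'I_n => pad a (i + k)%N) (Ordinal qn) x.
    by apply/funext => -[k klt]; rewrite /upd pad_upd -val_eqE /=; pad_cases.
  by pad_cases.
have qm : (q.+1 - n < m)%N by lia.
exists (Ordinal qm), id; split=> // x; apply/funext => -[j jlt].
rewrite /insert /upd !pad_upd -val_eqE /=.
have -> : (fun k : 'I_n => pad (upd a (Ordinal qlt) x) (i + k)%N) =
          (fun k : 'I_n => pad a (i + k)%N).
  by apply/funext => -[k klt]; rewrite pad_upd /=; case: eqP => //; lia.
by pad_cases.
Qed.

Lemma multilinear_hbrk m n (f : hcoch m) (g : hcoch n) :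
  multilinear (fun a : 'I_((m + n).-1) -> L =>
    hbrk_fun (val f) (val g) (pad a) : kmod).
Proof.
have E b : hbrk_fun (val f) (val g) b = hcirc_fun (val f) (val g) b +
    (-1) ^+ (m.+1 * n.+1).+1 * hcirc_fun (val g) (val f) b.
  by rewrite /hbrk_fun exprS mulN1r mulNr.
move=> a i k x y; rewrite !E.
apply: (multilinearD (multilinear_hcirc f g erefl)
  (multilinear_sign (m.+1 * n.+1).+1 (multilinear_hcirc g f _))).
by rewrite addnC.
Qed.

Definition hcup m n (f : hcoch m) (g : hcoch n) : hcoch (m + n) :=
  hcoch_mk (multilinear_hcup f g).
Definition hcirc m n (f : hcoch m) (g : hcoch n) : hcoch (m + n).-1 :=
  hcoch_mk (multilinear_hcirc f g erefl).
Definition hbrk m n (f : hcoch m) (g : hcoch n) : hcoch (m + n).-1 :=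
  hcoch_mk (multilinear_hbrk f g).
Fact multilinear_hone : multilinear (fun _ : 'I_0 -> L => 1 : kmod).
Proof. by move=> a []. Qed.
Definition hone : hcoch 0 := hcoch_mk multilinear_hone.

End Multilinear.

(* A graded K-module with a cup product, a bracket of degree -1 and a squaring
   map H^(2n) -> H^(4n - 1).  In degree (0, 0), where the bracket and the squaring
   map take values in H^(-1) = 0, the truncated index m + n - 1 is 0. *)
Record gerstenhaber (K : comPzRingType) := Gerstenhaber {
  gdeg :> nat -> lmodType K;
  gone : gdeg 0;
  gcup : forall m n, gdeg m -> gdeg n -> gdeg (m + n);
  gbrk : forall m n, gdeg m -> gdeg n -> gdeg (m + n).-1;
  gsq : forall n, gdeg n.*2 -> gdeg (n.*2 + n.*2).-1 }.

Definition gprod (K : comPzRingType) (G H : gerstenhaber K) : gerstenhaber K :=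
  @Gerstenhaber K (fun n => (G n * H n)%type)
    (gone G, gone H)
    (fun m n x y => (gcup x.1 y.1, gcup x.2 y.2))
    (fun m n x y => (gbrk x.1 y.1, gbrk x.2 y.2))
    (fun n x => (gsq x.1, gsq x.2)).

Definition gerstenhaber_hom (K : comPzRingType) (G H : gerstenhaber K)
    (phi : forall n, {linear G n -> H n}) : Prop :=
  [/\ phi 0 (gone G) = gone H,
      forall m n (x : G m) (y : G n), phi _ (gcup x y) = gcup (phi m x) (phi n y),
      forall m n (x : G m) (y : G n), phi _ (gbrk x y) = gbrk (phi m x) (phi n y) &
      forall n (x : G n.*2), phi _ (gsq x) = gsq (phi _ x)].

Section HH.
Variables (K : comPzRingType) (L : kAlgType K).

Definition HHn (n : nat) : lmodType K := coh (hochschild L) n.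

(* The operation on cohomology induced by an operation on cochains: the class z
   represented by op f g for all cocycles f and g representing x and y. *)
Definition HHop (m n p : nat) (op : hcoch L m -> hcoch L n -> hcoch L p)
    (x : HHn m) (y : HHn n) : HHn p :=
  xget 0 [set z : HHn p | forall f g,
    coh_class (X := hochschild L) f x -> coh_class (X := hochschild L) g y ->
    coh_class (X := hochschild L) (op f g) z].

Definition HHone : HHn 0 :=
  xget 0 [set z : HHn 0 | coh_class (X := hochschild L) (hone L) z].

Definition HHsq (n : nat) (x : HHn n.*2) : HHn (n.*2 + n.*2).-1 :=
  xget 0 [set z : HHn (n.*2 + n.*2).-1 | forall f,
    coh_class (X := hochschild L) f x -> coh_class (X := hochschild L) (hcirc f f) z].

Definition HH : gerstenhaber K :=
  @Gerstenhaber K HHn HHone (fun m n => HHop (@hcup K L m n))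
    (fun m n => HHop (@hbrk K L m n)) HHsq.

(* A chain map over the identity of L from the bar resolution, with terms
   L (x) L^(x)n (x) L, to the resolution P, given by the images beta_n (a_1, ..., a_n)
   of the generators 1 (x) a_1 (x) ... (x) a_n (x) 1. *)
Definition bar_map (P : chain (ev L)) (eps : {linear P 0 -> evreg L})
    (beta : forall n, ('I_n -> L) -> P n) : Prop :=
  [/\ forall n, multilinear (V := kres (P n)) (@beta n),
      forall a, eps (beta 0 a) = (1 : L) &
      forall n (a : 'I_n.+1 -> L),
        ch_d P n (beta n.+1 a) =
          lact (pad a 0%N) (beta n (fun j => pad a j.+1))
          + \sum_(i < n) (-1) ^+ i.+1 *: beta n (merge i (pad a))
          + (-1) ^+ n.+1 *: ract (beta n (fun j => pad a j)) (pad a n)].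

(* k is the identification of Ext_(L^ev) (L, L) with HH (L) via the bar resolution *)
Definition Ext_HH (P : chain (ev L)) (eps : {linear P 0 -> evreg L})
    (k : forall n, {linear Ext P (evreg L) n -> HH n}) : Prop :=
  exists2 beta : forall n, ('I_n -> L) -> P n, bar_map eps beta &
    forall n (f : {linear P n -> evreg L}) (x : Ext P (evreg L) n), Ext_class f x ->
      exists2 c : hcoch L n, forall a, val c a = f (beta n a) &
        coh_class (X := hochschild L) c (k n x).
End HH.

Section Complementary.
Variables (K : comPzRingType) (B : kAlgType K) (e : idem B).
Local Notation e' := (idemC e).
Local Notation C := (corner e).
Local Notation C' := (corner e').

(* (B e (x)_C e B) (+) (B e' (x)_C' e' B) *)
Definition BeBsum : lmodType (ev B) := (BeB e * BeB e')%type.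

Definition BeBsum_mul (x : BeBsum) : evreg B := BeB_mul x.1 + BeB_mul x.2.
Fact BeBsum_mul_linear : linear BeBsum_mul.
Proof. by move=> t x y; rewrite /BeBsum_mul !linearP scalerDr addrACA. Qed.
HB.instance Definition _ :=
  GRing.isLinear.Build (ev B) BeBsum (evreg B) _ BeBsum_mul BeBsum_mul_linear.

Definition Omega_pred : {pred BeBsum} := [pred x | BeBsum_mul x == 0].
Fact Omega_submod_closed : submod_closed Omega_pred.
Proof.
split=> [|t x y]; rewrite !inE ?linear0 // => /eqP hx /eqP hy.
by rewrite BeBsum_mul_linear hx hy scaler0 addr0.
Qed.
HB.instance Definition _ :=
  GRing.isSubmodClosed.Build (ev B) BeBsum Omega_pred Omega_submod_closed.

Definition Omega : Type := {x : BeBsum | x \in Omega_pred}.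
HB.instance Definition _ := SubType.copy Omega {x : BeBsum | x \in Omega_pred}.
HB.instance Definition _ := [Choice of Omega by <:].
HB.instance Definition _ := [SubChoice_isSubLmodule of Omega by <:].

Definition Omega_incl (x : Omega) : BeBsum := val x.
Fact Omega_incl_linear : linear Omega_incl.
Proof. by []. Qed.
HB.instance Definition _ :=
  GRing.isLinear.Build (ev B) Omega BeBsum _ Omega_incl Omega_incl_linear.

Section InducedComplex.
Variables (R : chain (ev C)) (R' : chain (ev C')).

Definition indsum_d (n : nat) (x : (ind (R n.+1) * ind (R' n.+1))%type) :
    (ind (R n) * ind (R' n))%type :=
  (ind_map (ch_d R n) x.1, ind_map (ch_d R' n) x.2).
Fact indsum_d_linear n : linear (@indsum_d n).
Proof. by move=> t x y; rewrite /indsum_d !linearP. Qed.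
HB.instance Definition _ n :=
  GRing.isLinear.Build (ev B) (ind (R n.+1) * ind (R' n.+1))%type
    (ind (R n) * ind (R' n))%type _ (@indsum_d n) (@indsum_d_linear n).

(* (B e (x)_C R (x)_C e B) (+) (B e' (x)_C' R' (x)_C' e' B) *)
Definition indsum : chain (ev B) :=
  @Chain _ (fun n => (ind (R n) * ind (R' n))%type) indsum_d.

Variables (r : {linear R 0 -> evreg C}) (r' : {linear R' 0 -> evreg C'}).

Definition indsum_eps (x : indsum 0) : BeBsum := (ind_aug r x.1, ind_aug r' x.2).
Fact indsum_eps_linear : linear indsum_eps.
Proof. by move=> t x y; rewrite /indsum_eps !linearP. Qed.
HB.instance Definition _ :=
  GRing.isLinear.Build (ev B) (indsum 0) BeBsum _ indsum_eps indsum_eps_linear.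

(* A is induced by the adjunction between B e (x)_C - (x)_C e B and e (-) e, sending
   f : B e (x)_C M (x)_C e B -> B to  M -> e B e, p |-> f (e (x) p (x) e),
   and likewise for e' *)
Definition adjunction
    (A : forall n, {linear Ext indsum (evreg B) n ->
                           (Ext R (evreg C) n * Ext R' (evreg C') n)%type}) : Prop :=
  forall n (f : {linear indsum n -> evreg B}) (x : Ext indsum (evreg B) n),
    Ext_class f x ->
    exists (h : {linear R n -> evreg C}) (h' : {linear R' n -> evreg C'}),
      [/\ forall p, val (h p : C) = f (indp (pe e) p (ep e), 0),
          forall p, val (h' p : C') = f (0, indp (pe e') p (ep e')),
          Ext_class h (A n x).1 &
          Ext_class h' (A n x).2].
End InducedComplex.
End Complementary.

(* Main.v *)
(* The kernel of the sum of the two multiplication maps is Omega by definition, and the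
   sum is onto because 1 = e + e'.  Splicing projective resolutions of Omega and of B by a
   twisting map theta gives a resolution of the middle term, hence the long exact
   sequence; no snake lemma is needed.

   That B e (x)_C R (x)_C e B resolves B e (x)_C e B is checked on the bar resolution R
   of C: there B e (x)_C R is contractible over B e, and consists of projective C^op-modules
   because B e is a K-direct summand of B.  So it is a projective resolution of B e, and
   tensoring it with e B computes Tor^C (B e, e B), which vanishes in positive degrees.

   Under the identifications with Hochschild cohomology, the component of g at e sends
   the class of a cocycle F to that of its restriction e F(-) e to C.  This
   restriction is not multiplicative on arbitrary cochains, but it commutes with the cup
   product, the circle product and hence the bracket and the squaring map on cochains F
   that preserve the subalgebra C x C' of B compatibly with the product.  Averaging the
   bar resolution over the separable subalgebra K e + K e' shows that every cocycle on B
   is cohomologous to such a cochain. *)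

Require Import Defs.
From HB Require Import structures.
From mathcomp Require Import all_boot all_algebra.
From mathcomp Require Import boolp classical_sets functions.
From mathcomp Require Import zify.

Set Implicit Arguments.
Unset Strict Implicit.
Unset Printing Implicit Defensive.

Import GRing.Theory.
Local Open Scope ring_scope.
Local Open Scope quotient_scope.

(** The resolutions in the theorem are arbitrary, while each argument works on a particular one,
    twisted or bar. Every fact is proved on the convenient resolution and carried over by chain maps
    and homotopies. The comparison lemmas therefore ask for projective terms only in the source and
    for exactness only in the target.

    This asymmetry decides the identification of g with restriction: both maps come from chain maps
    of the bar resolution of C into the complex e P e, which is exact over C^ev but whose terms are
    not assumed projective. Projectivity of the source makes the two chain maps homotopic.

    Cochains are treated as functions of infinite sequences that see finitely many entries.
    Inserting and merging arguments then never changes a type, and a degree such as m + n - 1 only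
    enters as a side condition on the arity.

    The squaring map is not additive, and the bracket controls only 2 (D . D) for D of even degree.
    That D . D is a boundary when D = dH needs the extra cochains H . D and H u H. *)

(* [linearN] with the opposite elaborated at the lmodType, so that lemmas such as
   [oppr0] rewrite its result. *)
Lemma linN (R : pzRingType) (M N : lmodType R) (f : {linear M -> N}) x : f (- x) = - f x.
Proof. exact: linearN. Qed.

Lemma linZ (R : pzRingType) (M N : lmodType R) (f : {linear M -> N}) a x :
  f (a *: x) = a *: f x.
Proof. exact: linearZ. Qed.

(** The invariant [Q] records what makes the next lifting problem solvable. Chain maps, homotopies
    and averaging maps are all built one degree at a time in this way. *)
Lemma dependent_choice_nat (T : nat -> Type) (Q : forall n, T n -> Prop)
    (S : forall n, T n -> T n.+1 -> Prop) (x0 : T 0) : Q 0 x0 ->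
  (forall n x, Q n x -> exists2 y, Q n.+1 y & S n x y) ->
  exists f : forall n, T n, f 0 = x0 /\ forall n, S n (f n) (f n.+1).
Proof.
move=> Qx0 step.
have step' n (x : {x : T n | Q n x}) :
    {y : {y : T n.+1 | Q n.+1 y} | S n (sval x) (sval y)}.
  by apply: cid; case: x => x Qx; have [y Qy Sxy] := step n x Qx; exists (exist _ y Qy).
pose F := fix F n : {x : T n | Q n x} :=
  if n is m.+1 then sval (step' m (F m)) else exist _ x0 Qx0.
exists (fun n => sval (F n)); split=> // n.
exact: (svalP (step' n (F n))).
Qed.

Definition linear_pack (R : pzRingType) (M N : lmodType R) (f : M -> N)
    (fL : linear f) : {linear M -> N} :=
  HB.pack f (GRing.isLinear.Build R M N _ f fL).

(** * Resolutions and cohomology classes *)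

Section Pullback.
Variables (R : pzRingType) (M N P : lmodType R).
Variables (g : {linear M -> N}) (f : {linear P -> N}).

Definition pullback_pred : {pred (M * P)%type} := [pred x | g x.1 == f x.2].
Fact pullback_submod_closed : submod_closed pullback_pred.
Proof.
split=> [|t x y]; rewrite !inE ?linear0 // => /eqP hx /eqP hy.
by rewrite !linearP hx hy.
Qed.
HB.instance Definition _ :=
  GRing.isSubmodClosed.Build R (M * P)%type pullback_pred pullback_submod_closed.

Definition pullback : Type := {x : (M * P)%type | x \in pullback_pred}.
HB.instance Definition _ := SubType.copy pullback {x : (M * P)%type | x \in pullback_pred}.
HB.instance Definition _ := [Choice of pullback by <:].
HB.instance Definition _ := [SubChoice_isSubLmodule of pullback by <:].

Definition pullback_fst (x : pullback) : M := (val x).1.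
Definition pullback_snd (x : pullback) : P := (val x).2.
Fact pullback_fst_linear : linear pullback_fst. Proof. by []. Qed.
Fact pullback_snd_linear : linear pullback_snd. Proof. by []. Qed.
HB.instance Definition _ :=
  GRing.isLinear.Build R pullback M _ pullback_fst pullback_fst_linear.
HB.instance Definition _ :=
  GRing.isLinear.Build R pullback P _ pullback_snd pullback_snd_linear.
End Pullback.

(** [projective] speaks of surjections only. Pulling g back along f gives a projection onto P that
    is onto because the image of f lies in that of g; a section of it followed by the other
    projection is the lift. *)
Lemma projective_lift (R : pzRingType) (P M N : lmodType R)
    (g : {linear M -> N}) (f : {linear P -> N}) :
  projective P -> (forall x, exists y, g y = f x) ->
  exists f' : {linear P -> M}, forall x, g (f' x) = f x.
Proof.
move=> prP fg.
have surj x : exists z : pullback g f, pullback_snd z = x.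
  have [y gy] := fg x.
  have h : (y, x) \in pullback_pred g f by rewrite inE /= gy.
  by exists (exist _ (y, x) h).
have [s sE] := prP _ _ (@pullback_snd _ _ _ _ g f : {linear _ -> _}) idfun surj.
exists (@pullback_fst _ _ _ _ g f \o s) => x /=.
have /eqP -> := valP (s x).
by congr (f _); apply: sE.
Qed.

Lemma projective_retract (R : pzRingType) (P Q : lmodType R)
    (i : {linear Q -> P}) (p : {linear P -> Q}) :
  cancel i p -> projective P -> projective Q.
Proof.
move=> ip prP M N g f gS.
have [f' E] := prP M N g (f \o p) gS.
by exists (f' \o i) => x /=; rewrite E /= ip.
Qed.

Lemma projective_prod (R : pzRingType) (P Q : lmodType R) :
  projective P -> projective Q -> projective (P * Q)%type.
Proof.
move=> prP prQ M N g f gS.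
have lP : linear (fun x : P => f (x, 0)).
  by move=> a x y; rewrite -linearP; congr (f (_, _)); rewrite /= scaler0 addr0.
have lQ : linear (fun x : Q => f (0, x)).
  by move=> a x y; rewrite -linearP; congr (f (_, _)); rewrite /= scaler0 addr0.
have [fP EP] := prP M N g (linear_pack lP) gS.
have [fQ EQ] := prQ M N g (linear_pack lQ) gS.
have lF : linear (fun x : P * Q => fP x.1 + fQ x.2).
  by move=> a x y; rewrite !linearP scalerDr addrACA.
exists (linear_pack lF) => -[x y] /=.
rewrite linearD EP EQ /= -linearD; congr (f _).
by rewrite /GRing.add /= /add_pair /= addr0 add0r.
Qed.

Section Comparison.
Variable R : pzRingType.

Definition complex (P : chain R) : Prop :=
  forall n x, ch_d P n (ch_d P n.+1 x) = 0.

Lemma resolution_complex (P : chain R) (M : lmodType R) (eps : {linear P 0 -> M}) :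
  proj_resolution eps -> complex P.
Proof. by move=> [_ _ _ ex] n x; apply/(ex n); exists x. Qed.

Lemma resolution_aug (P : chain R) (M : lmodType R) (eps : {linear P 0 -> M}) :
  proj_resolution eps -> forall x, eps (ch_d P 0 x) = 0.
Proof. by move=> [_ _ ex _] x; apply/ex; exists x. Qed.

Variables (P T : chain R) (N : lmodType R) (eps : {linear T 0 -> N}).
Hypothesis P_proj : forall n, projective (P n).
Hypothesis P_cplx : complex P.
Hypothesis T_aug : exact_at (ch_d T 0) eps.
Hypothesis T_ex : forall n, exact_at (ch_d T n.+1) (ch_d T n).

(** The invariant [Q] says that the map built so far sends boundaries to cycles, so exactness of T
    provides the next lift. The source is any complex of projectives, which includes [shift_chain]
    below. *)
Lemma lift_chain_map (u : {linear P 0 -> N}) : (forall y, exists x, eps x = u y) ->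
  (forall x, u (ch_d P 0 x) = 0) ->
  exists phi : forall n, {linear P n -> T n},
    (forall x, eps (phi 0 x) = u x) /\
    (forall n x, ch_d T n (phi n.+1 x) = phi n (ch_d P n x)).
Proof.
move=> ueps ud; have [phi0 E0] := projective_lift (g := eps) (f := u) (@P_proj 0) ueps.
pose Q n : {linear P n -> T n} -> Prop :=
  match n with
  | 0 => fun phi => forall x, eps (phi (ch_d P 0 x)) = 0
  | m.+1 => fun phi => forall x, ch_d T m (phi (ch_d P m.+1 x)) = 0
  end.
have [||phi [E H]] := @dependent_choice_nat (fun n => {linear P n -> T n}) Q
  (fun n f g => forall x, ch_d T n (g x) = f (ch_d P n x)) phi0.
- by move=> x; rewrite E0 ud.
- move=> n f Qf.
  have [x|g gE] := projective_lift (g := ch_d T n) (f := f \o ch_d P n) (@P_proj n.+1).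
    by case: n f Qf x => [|n] f Qf x; [apply/T_aug|apply/T_ex]; apply: Qf.
  exists g => x; last exact: gE.
  by rewrite gE /= P_cplx linear0.
exists phi; split=> [x|]; last exact: H.
by rewrite E E0.
Qed.

Lemma null_homotopy (phi : forall n, {linear P n -> T n}) :
  (forall x, eps (phi 0 x) = 0) ->
  (forall n x, ch_d T n (phi n.+1 x) = phi n (ch_d P n x)) ->
  exists s : forall n, {linear P n -> T n.+1},
    (forall x, phi 0 x = ch_d T 0 (s 0 x)) /\
    (forall n x, phi n.+1 x = ch_d T n.+1 (s n.+1 x) + s n (ch_d P n x)).
Proof.
move=> e0 phid.
have [x|s0 s0E] := projective_lift (g := ch_d T 0) (f := phi 0) (@P_proj 0).
  exact/T_aug.
(* This makes [phi n.+1 - s d] take values in cycles, so that it lifts through the differential of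
   T. *)
pose Q n : {linear P n -> T n.+1} -> Prop :=
  fun s => forall x, ch_d T n (s (ch_d P n x)) = phi n (ch_d P n x).
have [||s [E H]] := @dependent_choice_nat (fun n => {linear P n -> T n.+1}) Q
  (fun n s s' => forall x, phi n.+1 x = ch_d T n.+1 (s' x) + s (ch_d P n x)) s0.
- by move=> x; rewrite s0E.
- move=> n s Qs.
  have L : linear (fun x => phi n.+1 x - s (ch_d P n x)).
    by move=> a x y; rewrite !linearP scalerDr addrACA.
  have [x|s' s'E] := projective_lift (g := ch_d T n.+1) (f := linear_pack L) (@P_proj n.+1).
    by apply/T_ex; rewrite /= linearB phid Qs subrr.
  exists s' => x; rewrite s'E /=; first by rewrite P_cplx linear0 subr0.
  by rewrite subrK.
by exists s; split=> // x; rewrite E s0E.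
Qed.

Lemma chain_homotopy (phi psi : forall n, {linear P n -> T n}) :
  (forall x, eps (phi 0 x) = eps (psi 0 x)) ->
  (forall n x, ch_d T n (phi n.+1 x) = phi n (ch_d P n x)) ->
  (forall n x, ch_d T n (psi n.+1 x) = psi n (ch_d P n x)) ->
  exists s : forall n, {linear P n -> T n.+1},
    (forall x, phi 0 x = psi 0 x + ch_d T 0 (s 0 x)) /\
    (forall n x, phi n.+1 x = psi n.+1 x + (ch_d T n.+1 (s n.+1 x) + s n (ch_d P n x))).
Proof.
move=> e phid psid.
have L n : linear (fun x => phi n x - psi n x).
  by move=> a x y; rewrite !linearP scalerDr addrACA.
have [x|n x|s [s0 sS]] := @null_homotopy (fun n => linear_pack (L n)).
- by rewrite /= linearB e subrr.
- by rewrite /= linearB phid psid.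
exists s; split=> [x|n x].
  by rewrite -s0 /= addrC subrK.
by rewrite -sS /= addrC subrK.
Qed.
End Comparison.

Section CohomologyClasses.
Variables (K : comPzRingType) (X : cochain K).

(** In degree 0 the incoming map [cch_din] is zero, so 0 is the only boundary there. *)
Definition boundary n (z : X n) : Prop := exists w, cch_din X n w = z.

Lemma boundary0 n : boundary (0 : X n).
Proof. by exists 0; rewrite linear0. Qed.

Lemma boundaryP n a (z z' : X n) : boundary z -> boundary z' -> boundary (a *: z + z').
Proof. by move=> [w <-] [w' <-]; exists (a *: w + w'); rewrite linearP. Qed.

Lemma coh_class_cocycle n (z : X n) x : coh_class z x -> cch_d X n z = 0.
Proof. by case=> c [<- _]; have /eqP := valP c. Qed.

Lemma coh_class_exists n (z : X n) : cch_d X n z = 0 -> exists x, coh_class z x.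
Proof.
move=> /eqP dz.
by exists (\pi_(homology (cch_din X n) (cch_d X n)) (exist _ z dz)), (exist _ z dz).
Qed.

Lemma coh_class_surj n (x : coh X n) : exists z, coh_class z x.
Proof. by have [c ->] := pi_surj x; exists (val c), c. Qed.

Lemma coh_classP n (z z' : X n) x x' : coh_class z x -> coh_class z' x' ->
  x = x' <-> boundary (z - z').
Proof.
move=> [c [<- <-]] [c' [<- <-]]; split=> [/pi_eqP|[w wE]].
  by rewrite inE => -[w wE]; exists w; apply: wE.
by apply/pi_eqP; rewrite inE; exists w; apply: wE.
Qed.

Lemma coh_class_linear n a (z z' : X n) x x' : coh_class z x -> coh_class z' x' ->
  coh_class (a *: z + z') (a *: x + x').
Proof.
move=> [c [<- <-]] [c' [<- <-]]; exists (cycZ a c + c'); split=> //.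
by rewrite Quotient.pi_add /=; congr (_ + _); rewrite -hscale_pi.
Qed.

Lemma coh_class0 n (x : coh X n) : coh_class 0 x <-> x = 0.
Proof.
have h : coh_class (0 : X n) (0 : coh X n).
  have [y cy] := coh_class_exists (linear0 (cch_d X n)).
  by have := coh_class_linear (-1) cy cy; rewrite scaler0 addr0 scaleN1r addNr.
split=> [c|->] //; apply/(coh_classP c h); rewrite subr0.
exact: boundary0.
Qed.

Lemma coh_class_eq n (z z' : X n) x x' : coh_class z x -> coh_class z' x' ->
  boundary (z - z') -> x = x'.
Proof. by move=> c c' b; apply/(coh_classP c c'). Qed.

Lemma coh_class_zero n (z : X n) : coh_class z (0 : coh X n) -> boundary z.
Proof.
have c0 : coh_class (X := X) 0 (0 : coh X n) by apply/coh_class0.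
by move=> c; rewrite -[z]subr0; apply/(coh_classP c c0).
Qed.

Lemma coh_class_zero' n (z : X n) x : coh_class z x -> boundary z -> x = 0.
Proof.
have c0 : coh_class (X := X) 0 (0 : coh X n) by apply/coh_class0.
by move=> c b; apply/(coh_classP c c0); rewrite subr0.
Qed.

Lemma coh_class_boundary n (z z' : X n) x : coh_class z x -> boundary (z' - z) ->
  cch_d X n z' = 0 -> coh_class z' x.
Proof.
move=> c b /coh_class_exists [y c'].
by rewrite -(coh_class_eq c' c b).
Qed.
End CohomologyClasses.

Section CohomologyMap.
Variables (K : comPzRingType) (X Y : cochain K) (m n : nat) (phi : {linear X m -> Y n}).
Hypothesis phiZ : forall z, cch_d X m z = 0 -> cch_d Y n (phi z) = 0.
Hypothesis phiB : forall z, boundary z -> boundary (phi z).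

(** The value on a class is picked by choice; independence of the representative then forces
    linearity. The degrees m and n are unrelated so that connecting maps are covered too. *)
Lemma coh_map_exists : exists F : {linear coh X m -> coh Y n},
  forall z x, coh_class z x -> coh_class (phi z) (F x).
Proof.
have H x : {y : coh Y n | forall z, coh_class z x -> coh_class (phi z) y}.
  apply: cid; have [z cz] := coh_class_surj x.
  have [y cy] := coh_class_exists (phiZ (coh_class_cocycle cz)).
  exists y => z' cz'; apply: (coh_class_boundary cy).
    rewrite -linearB; apply: phiB.
    exact/(coh_classP cz' cz).
  exact/phiZ/(coh_class_cocycle cz').
pose F x := sval (H x).
have FP z x : coh_class z x -> coh_class (phi z) (F x) by apply: (svalP (H x)).
suff L : linear F by exists (linear_pack L).
move=> a x y; have [z cz] := coh_class_surj x; have [w cw] := coh_class_surj y.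
have c1 := FP _ _ (coh_class_linear a cz cw).
have c2 := coh_class_linear a (FP _ _ cz) (FP _ _ cw).
by apply: (coh_class_eq c1 c2); rewrite linearP subrr; apply: boundary0.
Qed.
End CohomologyMap.

Section CochainMap.
Variables (K : comPzRingType) (X Y : cochain K) (phi : forall n, {linear X n -> Y n}).
Hypothesis phid : forall n z, phi n.+1 (cch_d X n z) = cch_d Y n (phi n z).

Lemma cochain_boundary n (z : X n) : boundary z -> boundary (phi n z).
Proof.
case: n z => [|n] z [w <-]; first by rewrite /= linear0; apply: boundary0.
by exists (phi n w); rewrite /= phid.
Qed.

Lemma cochain_map_exists : exists F : forall n, {linear coh X n -> coh Y n},
  forall n z x, coh_class z x -> coh_class (phi n z) (F n x).
Proof.
have H n : {F : {linear coh X n -> coh Y n} |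
    forall z x, coh_class z x -> coh_class (phi n z) (F x)}.
  apply: cid; apply: coh_map_exists => [z dz|z]; last exact: cochain_boundary.
  by rewrite -phid dz linear0.
by exists (fun n => sval (H n)) => n; apply: (svalP (H n)).
Qed.
End CochainMap.

Lemma inj_surj_bijective (T U : Type) (f : T -> U) :
  injective f -> (forall y, exists x, f x = y) -> bijective f.
Proof.
move=> inj surj; have H y : {x | f x = y} by apply: cid.
exists (fun y => sval (H y)) => [x|y]; last exact: (svalP (H y)).
by apply: inj; apply: (svalP (H (f x))).
Qed.

(** * The long exact sequence *)

Section Horseshoe.
Variables (R : pzRingType) (P W : chain R) (M' M M'' : lmodType R).
Variables (i : {linear M' -> M}) (q : {linear M -> M''}) (iq : short_exact i q).
Variables (eW : {linear W 0 -> M'}) (eP : {linear P 0 -> M''}).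
Hypothesis W_res : proj_resolution eW.
Hypothesis P_res : proj_resolution eP.

Lemma linear_oppfun (A B : lmodType R) (f : {linear A -> B}) : linear (fun x => - f x).
Proof. by move=> a x y; rewrite linearP opprD scalerN. Qed.

(** The twisting map has to anticommute with the differentials. The sign here turns it into an
    ordinary chain map from the shifted complex to W. *)
Definition shift_chain : chain R :=
  @Chain R (fun n => P n.+1) (fun n => linear_pack (linear_oppfun (ch_d P n.+1))).

(** [sigma] lifts the augmentation of P through q. Since [q (sigma d) = eP d = 0], the map
    [- sigma d] factors through i, and [theta] is a chain map lifting that factorization. *)
Lemma horseshoe_twist : exists (sigma : {linear P 0 -> M})
    (theta : forall n, {linear P n.+1 -> W n}),
  [/\ forall x, q (sigma x) = eP x,
      forall x, i (eW (theta 0 x)) = - sigma (ch_d P 0 x) &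
      forall n x, ch_d W n (theta n.+1 x) = - theta n (ch_d P n.+1 x)].
Proof.
have [W_proj W_surj W_aug W_ex] := W_res; have [P_proj P_surj P_aug P_ex] := P_res.
have [i_inj i_ex q_surj] := iq.
have dd := resolution_complex P_res.
have [sigma sigmaE] := projective_lift (g := q) (f := eP) (P_proj 0) (fun x => q_surj _).
have [x|u uE] := projective_lift (g := i)
    (f := linear_pack (linear_oppfun (sigma \o ch_d P 0))) (P_proj 1%N).
  by apply/i_ex; rewrite /= linN sigmaE (resolution_aug P_res) oppr0.
have [n|n x|y|x|theta [t0 tS]] :=
    @lift_chain_map R shift_chain W M' eW _ _ W_aug W_ex u.
- exact: P_proj.
- by rewrite /= linN dd !oppr0.
- exact: W_surj.
- by apply: i_inj; rewrite uE /= !linN dd !linear0.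
exists sigma, theta; split=> [//|x|n x]; first by rewrite t0 uE.
by rewrite tS /= linN.
Qed.

Variables (sigma : {linear P 0 -> M}) (theta : forall n, {linear P n.+1 -> W n}).
Hypothesis sigmaE : forall x, q (sigma x) = eP x.
Hypothesis theta0 : forall x, i (eW (theta 0 x)) = - sigma (ch_d P 0 x).
Hypothesis thetaS : forall n x, ch_d W n (theta n.+1 x) = - theta n (ch_d P n.+1 x).

(** The mapping cone of [theta], regarded as a chain map from the shifted P to W. *)
Definition twist_d n (x : (W n.+1 * P n.+1)%type) : (W n * P n)%type :=
  (ch_d W n x.1 + theta n x.2, ch_d P n x.2).
Fact twist_d_linear n : linear (@twist_d n).
Proof.
move=> a x y; rewrite /twist_d !linearP; congr (_, _).
by rewrite /= scalerDr addrACA.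
Qed.
HB.instance Definition _ n := GRing.isLinear.Build R (W n.+1 * P n.+1)%type
  (W n * P n)%type _ (@twist_d n) (@twist_d_linear n).

Definition twist : chain R := @Chain R (fun n => (W n * P n)%type) twist_d.

Definition twist_aug (x : twist 0) : M := i (eW x.1) + sigma x.2.
Fact twist_aug_linear : linear twist_aug.
Proof. by move=> a x y; rewrite /twist_aug !linearP scalerDr addrACA. Qed.
HB.instance Definition _ := GRing.isLinear.Build R (twist 0) M _ twist_aug twist_aug_linear.

Definition twist_in n (x : W n) : twist n := (x, 0).
Fact twist_in_linear n : linear (@twist_in n).
Proof. by move=> a x y; congr (_, _); rewrite /= scaler0 addr0. Qed.
HB.instance Definition _ n :=
  GRing.isLinear.Build R (W n) (twist n) _ (@twist_in n) (@twist_in_linear n).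

Definition twist_out n (x : twist n) : P n := x.2.
Fact twist_out_linear n : linear (@twist_out n).
Proof. by []. Qed.
HB.instance Definition _ n :=
  GRing.isLinear.Build R (twist n) (P n) _ (@twist_out n) (@twist_out_linear n).

(** For a cycle, exactness of P first corrects the P-component; after subtracting [theta] of the
    preimage, what remains in W is a cycle, and exactness of W finishes. *)
Lemma twist_resolution : proj_resolution (twist_aug : {linear twist 0 -> M}).
Proof.
have [W_proj W_surj W_aug W_ex] := W_res; have [P_proj P_surj P_aug P_ex] := P_res.
have [i_inj i_ex q_surj] := iq.
have i0 x : q (i x) = 0 by apply/i_ex; exists x.
have [Wdd Pdd] := (resolution_complex W_res, resolution_complex P_res).
split=> [n|m|x|n x].
- exact: projective_prod.
- have [p pE] := P_surj (q m).
  have /i_ex [w' w'E] : q (m - sigma p) = 0 by rewrite linearB sigmaE pE subrr.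
  have [w wE] := W_surj w'.
  by exists (w, p); rewrite /= /twist_aug /= wE w'E subrK.
- split=> [/= h|[y <-]]; last first.
    rewrite /= /twist_aug /= linearD (resolution_aug W_res) add0r theta0.
    by rewrite addNr.
  have /P_aug [p pE] : eP x.2 = 0.
    by rewrite -sigmaE -[RHS](linear0 q) -h /twist_aug linearD i0 add0r.
  have /W_aug [w wE] : eW (x.1 - theta 0 p) = 0.
    by apply: i_inj; rewrite linear0 !linearB theta0 opprK pE.
  by exists (w, p); rewrite /= /twist_d /= wE subrK pE; case: x {h pE wE}.
- split=> [/= |[y <-]]; last first.
    by rewrite /= /twist_d /= linearD Wdd add0r thetaS addNr Pdd.
  case: x => [x1 x2] [h1 /P_ex [p pE]]; rewrite /= in h1 pE.
  have /W_ex [w wE] : ch_d W n (x1 - theta n.+1 p) = 0.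
    by rewrite linearB thetaS opprK pE.
  by exists (w, p); rewrite /= /twist_d /= wE subrK pE.
Qed.
End Horseshoe.

Section ExtLong.
Variables (K : comPzRingType) (R : kAlgType K) (P W : chain R) (N : lmodType R).

Lemma Ext_map_exists (T S : chain R) (phi : forall n, {linear T n -> S n}) :
  (forall n x, ch_d S n (phi n.+1 x) = phi n (ch_d T n x)) ->
  exists F : forall n, {linear Ext S N n -> Ext T N n},
    forall n (f : {linear S n -> N}) x,
      Ext_class f x -> Ext_class (f \o phi n : {linear T n -> N}) (F n x).
Proof.
move=> phid; apply: (cochain_map_exists (X := hom_cochain S N) (Y := hom_cochain T N)
  (phi := fun n => precomp (N := N) (phi n) : {linear _ -> _})) => n z.
by apply: linear_eq => x; rewrite /= phid.
Qed.

Lemma Ext_boundaryS (S : chain R) n (f : {linear S n.+1 -> N}) :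
  boundary (X := hom_cochain S N) (f : Defs.Hom (S n.+1) N) <->
  exists g : {linear S n -> N}, forall x, f x = g (ch_d S n x).
Proof.
split=> [[g <-]|[g gE]]; first by exists g.
by exists g; apply: linear_eq => x; rewrite gE.
Qed.

Lemma Ext_boundary0 (S : chain R) (f : {linear S 0 -> N}) :
  boundary (X := hom_cochain S N) (f : Defs.Hom (S 0%N) N) <-> forall x, f x = 0.
Proof.
split=> [[g <-]|f0]; first by [].
by exists 0; apply: linear_eq => x; rewrite f0.
Qed.

Lemma Ext_cocycle (S : chain R) n (f : {linear S n -> N}) :
  cch_d (hom_cochain S N) n f = 0 <-> forall x, f (ch_d S n x) = 0.
Proof.
split=> [h x|h]; last by apply: linear_eq => x; apply: h.
by have := congr1 (fun g : Defs.Hom _ _ => (g : {linear _ -> _}) x) h.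
Qed.

Lemma Ext_class_ext (S : chain R) n (f g : {linear S n -> N}) (x : Ext S N n) :
  f =1 g -> Ext_class f x -> Ext_class g x.
Proof. by move/linear_eq => ->. Qed.
End ExtLong.

Section ExtComparison.
Variables (K : comPzRingType) (R : kAlgType K) (N : lmodType R).

(** A cocycle f kills the term [d s] of a homotopy s, and the remaining [f s d] is a coboundary.
    Only the exactness of T enters, so that T may be the complex e P e. *)
Lemma comparison_boundary (P T : chain R) (M : lmodType R) (eps : {linear T 0 -> M})
    (phi psi : forall n, {linear P n -> T n}) :
  (forall n, projective (P n)) -> complex P ->
  exact_at (ch_d T 0) eps -> (forall n, exact_at (ch_d T n.+1) (ch_d T n)) ->
  (forall x, eps (phi 0 x) = eps (psi 0 x)) ->
  (forall n x, ch_d T n (phi n.+1 x) = phi n (ch_d P n x)) ->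
  (forall n x, ch_d T n (psi n.+1 x) = psi n (ch_d P n x)) ->
  forall n (f : {linear T n -> N}), (forall x, f (ch_d T n x) = 0) ->
  boundary (X := hom_cochain P N)
    (precomp (N := N) (phi n) f - precomp (N := N) (psi n) f).
Proof.
move=> P_proj P_cplx T_aug T_ex e phid psid n f fd.
have [s [s0 sS]] := chain_homotopy P_proj P_cplx T_aug T_ex e phid psid.
case: n f fd => [|n] f fd.
  exists 0; apply: linear_eq => x; rewrite /= s0 linearD fd addr0.
  exact/esym/subrr.
exists (f \o s n : {linear _ -> _}); apply: linear_eq => x /=.
rewrite sS !linearD fd add0r; apply/esym; rewrite addrC.
exact: addKr.
Qed.

Lemma Ext_comparison (P T : chain R) (M M' : lmodType R) (eP : {linear P 0 -> M})
    (eT : {linear T 0 -> M'}) (u : {linear M -> M'}) :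
  proj_resolution eP -> proj_resolution eT ->
  exists phi : forall n, {linear P n -> T n}, chain_map eP eT u phi.
Proof.
move=> P_res T_res; have [P_proj P_surj P_aug P_ex] := P_res.
have [T_proj T_surj T_aug T_ex] := T_res.
have [||phi [E H]] :=
    lift_chain_map P_proj (resolution_complex P_res) T_aug T_ex (u := u \o eP).
- by move=> y; apply: T_surj.
- by move=> x; rewrite /= (resolution_aug P_res) linear0.
by exists phi.
Qed.

(** The composite of [phi] and [psi] on T lifts the identity of M, hence is homotopic to the
    identity. *)
Lemma Ext_inverse (P T : chain R) (M : lmodType R) (eP : {linear P 0 -> M})
    (eT : {linear T 0 -> M}) (phi : forall n, {linear P n -> T n})
    (psi : forall n, {linear T n -> P n})
    (F : forall n, {linear Ext T N n -> Ext P N n})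
    (G : forall n, {linear Ext P N n -> Ext T N n}) :
  proj_resolution eP -> proj_resolution eT ->
  chain_map eP eT idfun phi -> chain_map eT eP idfun psi ->
  (forall n (f : {linear T n -> N}) x, Ext_class f x ->
     Ext_class (f \o phi n : {linear P n -> N}) (F n x)) ->
  (forall n (f : {linear P n -> N}) x, Ext_class f x ->
     Ext_class (f \o psi n : {linear T n -> N}) (G n x)) ->
  forall n, cancel (F n) (G n).
Proof.
move=> P_res T_res [phi0 phid] [psi0 psid] FE GE n x.
have [T_proj T_surj T_aug T_ex] := T_res.
have [f cf] := coh_class_surj x.
have cGF := GE _ _ _ (FE _ _ _ cf).
apply: (coh_class_eq cGF cf).
have := @comparison_boundary _ _ _ eT (fun n => phi n \o psi n : {linear T n -> T n})
  (fun n => idfun : {linear T n -> T n}) T_proj (resolution_complex T_res) T_aug T_ex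
  _ _ _ n f.
rewrite (_ : precomp _ _ = (f \o phi n \o psi n : {linear T n -> N})); last exact: linear_eq.
rewrite (_ : precomp idfun f = f); last exact: linear_eq.
apply=> [y|m y|//|].
- by rewrite /= phi0 psi0.
- by rewrite /= phid psid.
- exact/Ext_cocycle/(coh_class_cocycle cf).
Qed.
End ExtComparison.

Section LongExact.
Variables (K : comPzRingType) (R : kAlgType K) (N : lmodType R).
Variables (P W S : chain R) (M' M M'' : lmodType R).
Variables (i : {linear M' -> M}) (q : {linear M -> M''}).
Variables (eW : {linear W 0 -> M'}) (eS : {linear S 0 -> M}) (eP : {linear P 0 -> M''}).

Section Twist.
Variable theta : forall n, {linear P n.+1 -> W n}.
Local Notation H := (twist theta).
Hypothesis thetaS : forall n x, ch_d W n (theta n.+1 x) = - theta n (ch_d P n.+1 x).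
Variables (O : forall n, {linear Ext P N n -> Ext H N n})
  (J : forall n, {linear Ext H N n -> Ext W N n})
  (D : forall n, {linear Ext W N n -> Ext P N n.+1}).
Arguments twist_out {R P W theta} n x.
Arguments twist_in {R P W theta} n x.
Hypothesis OE : forall n (f : {linear P n -> N}) x, Ext_class f x ->
  Ext_class (f \o twist_out n : {linear H n -> N}) (O n x).
Hypothesis JE : forall n (f : {linear H n -> N}) x, Ext_class f x ->
  Ext_class (f \o twist_in n : {linear W n -> N}) (J n x).
Hypothesis DE : forall n (f : {linear W n -> N}) x, Ext_class f x ->
  Ext_class (f \o theta n : {linear P n.+1 -> N}) (D n x).

Lemma twist_ind n x : twist_in n (ch_d W n x) = ch_d H n (twist_in n.+1 x).
Proof. by rewrite /= /twist_d /twist_in /= !linear0 addr0. Qed.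

Lemma twist_homE n (h : {linear H n -> N}) x : h x = h (twist_in n x.1) + h (0, x.2).
Proof.
rewrite -linearD; congr (h _); case: x => x1 x2.
by congr (_, _); rewrite /= ?addr0 ?add0r.
Qed.

Lemma twist_hom_right n (h : {linear H n -> N}) : linear (fun x : P n => h (0, x)).
Proof.
by move=> a x y; rewrite -linearP; congr (h (_, _)); rewrite /= scaler0 addr0.
Qed.

Lemma pair_linear (A B C : lmodType R) (f : {linear A -> C}) (g : {linear B -> C}) :
  linear (fun x : (A * B)%type => f x.1 + g x.2).
Proof. by move=> a x y; rewrite !linearP scalerDr addrACA. Qed.

(** Write h = (a, b) on W n + P n. If a = g d, then subtracting from h the coboundary of (g, 0)
    leaves (0, b - g theta), which comes from P. In degree 0 the hypothesis is a = 0. *)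
Lemma twist_descend n (h : {linear H n -> N}) :
  boundary (X := hom_cochain W N) (h \o twist_in n : {linear W n -> N}) ->
  (forall z, h (ch_d H n z) = 0) ->
  exists f' : {linear P n -> N}, (forall x, f' (ch_d P n x) = 0) /\
    boundary (X := hom_cochain H N)
      (precomp (N := N) (twist_out n : {linear H n -> P n}) f' - (h : Defs.Hom (H n) N)).
Proof.
case: n h => [|n] h bJ hd.
  exists (linear_pack (twist_hom_right h)).
  have hin x : h (twist_in _ x) = 0 by move/Ext_boundary0: bJ; apply.
  split=> [x|].
    have := hd (0, x); rewrite twist_homE /= => <-.
    by rewrite hin add0r.
  apply/Ext_boundary0 => x; change (h (0, x.2) - h x = 0).
  by rewrite (twist_homE h x) hin add0r subrr.
move/Ext_boundaryS: bJ => [g gE].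
have hin x : h (twist_in _ x) = g (ch_d W n x) by apply: gE.
have L : linear (fun x : P n.+1 => h (0, x) - g (theta n x)).
  move=> a x y; have := twist_hom_right h a x y => /= ->.
  by rewrite !linearP scalerDr addrACA.
exists (linear_pack L); split=> [x|].
  have := hd (0, x); rewrite twist_homE => E.
  change (h (0, ch_d P n.+1 x) - g (theta n (ch_d P n.+1 x)) = 0).
  rewrite -[RHS]E addrC /= hin; congr (_ + _).
  by rewrite linearD thetaS !linear0 add0r linN.
apply/Ext_boundaryS.
(* The difference is f' minus h rather than h minus f', whence the sign. *)
exists (linear_pack (linear_oppfun (g \o (fst : {linear H n -> W n})))) => x.
change (h (0, x.2) - g (theta n x.2) - h x = - g (ch_d W n x.1 + theta n x.2)).
rewrite (twist_homE h x) hin (linearD g); set A := h (0, _).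
by rewrite (addrC _ A) (opprD A) addrA (addrC A) addrK -opprD addrC.
Qed.

Lemma twist_exact_OJ n : exact_at (O n) (J n).
Proof.
move=> y; split=> [Jy|[x <-]]; last first.
  have [f cf] := coh_class_surj x; have := JE (OE cf).
  rewrite (_ : (_ \o _ : {linear _ -> _}) = \0); first by move/coh_class0.
  by apply: linear_eq => z; rewrite /= linear0.
have [h ch] := coh_class_surj y; have cJ := JE ch; rewrite Jy in cJ.
have [f' [f'd bd]] := twist_descend (coh_class_zero cJ)
  ((Ext_cocycle _).1 (coh_class_cocycle ch)).
have [x cx] := coh_class_exists ((Ext_cocycle f').2 f'd).
exists x; exact: (coh_class_eq (OE cx) ch bd).
Qed.

(** A cocycle (a, b) on the twisted complex is a cocycle a on W together with b satisfying a theta =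
    - b d. So a extends to a cocycle precisely when a theta is a coboundary. *)
Lemma twist_exact_JD n : exact_at (J n) (D n).
Proof.
move=> x; split=> [Dx|[y <-]]; last first.
  have [h ch] := coh_class_surj y; have hd := (Ext_cocycle _).1 (coh_class_cocycle ch).
  apply/(coh_class_zero' (DE (JE ch))) => //.
  apply/Ext_boundaryS; exists (linear_pack (linear_oppfun (linear_pack (twist_hom_right h)))).
  move=> z; have := hd (0, z); rewrite twist_homE /= linear0 add0r => /eqP.
  by rewrite addr_eq0 => /eqP.
have [f cf] := coh_class_surj x; have cD := DE cf; rewrite Dx in cD.
have /Ext_boundaryS [g gE] := coh_class_zero cD.
have L := pair_linear f (linear_pack (linear_oppfun g)).
have hd z : linear_pack L (ch_d H n z) = 0.
  rewrite /= linearD ((Ext_cocycle _).1 (coh_class_cocycle cf)) add0r.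
  by apply/eqP; rewrite subr_eq0 -gE.
have [y cy] := coh_class_exists ((Ext_cocycle (linear_pack L : {linear H n -> N})).2 hd).
exists y; apply: (coh_class_eq (JE cy) cf).
exists 0; rewrite linear0; apply: linear_eq => z /=.
by rewrite linear0 oppr0 addr0; apply/esym/subrr.
Qed.

(** Seen on the twisted complex, f theta is the coboundary of (f, 0) when f is a cocycle.
    Conversely, if a cocycle on P becomes the coboundary of (a, b), it equals a theta + b d, and a
    is a cocycle on W. *)
Lemma twist_exact_DO n : exact_at (D n) (O n.+1).
Proof.
move=> x; split=> [Ox|[y <-]]; last first.
  have [f cf] := coh_class_surj y; have fd := (Ext_cocycle _).1 (coh_class_cocycle cf).
  apply/(coh_class_zero' (OE (DE cf))) => //.
  apply/Ext_boundaryS; exists (f \o (fst : {linear H n -> W n})) => z /=.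
  by rewrite linearD fd add0r.
have [f cf] := coh_class_surj x; have cO := OE cf; rewrite Ox in cO.
have /Ext_boundaryS [h hE] := coh_class_zero cO.
have hd z : (h \o twist_in n) (ch_d W n z) = 0.
  by rewrite /= twist_ind -hE /= linear0.
have [y cy] := coh_class_exists ((Ext_cocycle (h \o twist_in n : {linear _ -> _})).2 hd).
exists y; apply: (coh_class_eq (DE cy) cf); apply/Ext_boundaryS.
exists (linear_pack (linear_oppfun (linear_pack (twist_hom_right h)))) => z.
have /= := hE (0, z); rewrite /= (twist_homE h) /= linear0 add0r => E.
rewrite -/(precomp _ _) /=.
change (h (theta n z, 0) - f z = - h (0, ch_d P n z)).
by rewrite E opprD addrA subrr add0r.
Qed.

Lemma twist_inj_O : injective (O 0).
Proof.
move=> x y Oxy; apply/eqP; rewrite -subr_eq0; apply/eqP.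
have : O 0 (x - y) = 0 by rewrite linearB Oxy subrr.
have [f cf] := coh_class_surj (x - y).
have cO := OE cf => Oz; rewrite Oz in cO.
have /Ext_boundary0 f0 := coh_class_zero cO.
apply: (coh_class_zero' cf).
by apply/Ext_boundary0 => z; apply: (f0 (0, z)).
Qed.
End Twist.

Lemma theta_map_exists (theta : forall n, {linear P n.+1 -> W n}) :
  (forall n x, ch_d W n (theta n.+1 x) = - theta n (ch_d P n.+1 x)) ->
  exists D : forall n, {linear Ext W N n -> Ext P N n.+1},
  forall n (f : {linear W n -> N}) x, Ext_class f x ->
    Ext_class (f \o theta n : {linear P n.+1 -> N}) (D n x).
Proof.
move=> thetaS.
have H n : {D : {linear Ext W N n -> Ext P N n.+1} |
    forall (f : {linear W n -> N}) x, Ext_class f x ->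
      Ext_class (f \o theta n : {linear P n.+1 -> N}) (D x)}.
  apply: cid; apply: (coh_map_exists (X := hom_cochain W N) (Y := hom_cochain P N)
    (phi := precomp (N := N) (theta n) : {linear _ -> _})) => f.
    move=> /Ext_cocycle fd; apply/Ext_cocycle => x.
    have := thetaS n x => /(congr1 -%R); rewrite opprK => E.
    by rewrite /= -E linN fd oppr0.
  case: n f => [|n] f.
    move=> /Ext_boundary0 f0; apply/Ext_boundaryS; exists \0 => x.
    exact: f0.
  move=> /Ext_boundaryS [g gE]; apply/Ext_boundaryS.
  exists (linear_pack (linear_oppfun (g \o theta n))) => x.
  by rewrite /= gE thetaS linN.
by exists (fun n => sval (H n)) => n; apply: (svalP (H n)).
Qed.

(** Exactness is known for the twisted resolution of M, and the mutually inverse comparison maps [A]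
    and [C] move it to S. The connecting map involves P and W alone, and the twisted resolution is
    the middle term that [Ext_connecting] asks for. *)
Lemma Ext_long_exact : short_exact i q -> proj_resolution eW -> proj_resolution eS ->
    proj_resolution eP ->
  exists (u : forall n, {linear Ext P N n -> Ext S N n})
    (v : forall n, {linear Ext S N n -> Ext W N n})
    (D : forall n, {linear Ext W N n -> Ext P N n.+1}),
  [/\ Ext_induced eS eP q u, Ext_induced eW eS i v & Ext_connecting i q eW eP D] /\
  [/\ injective (u 0), forall n, exact_at (u n) (v n),
      forall n, exact_at (v n) (D n) & forall n, exact_at (D n) (u n.+1)].
Proof.
move=> iq W_res S_res P_res.
have [sigma [theta [sigmaE theta0 thetaS]]] := horseshoe_twist iq W_res P_res.
have H_res := twist_resolution iq W_res P_res sigmaE theta0 thetaS.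
move: H_res; set eH := (X in proj_resolution X) => H_res.
pose H := twist theta.
have [a [a0 ad]] := Ext_comparison idfun H_res S_res.
have [c [c0 cd]] := Ext_comparison idfun S_res H_res.
have i0 x : q (i x) = 0 by case: iq => _ ex _; apply/ex; exists x.
pose o n : {linear H n -> P n} := @twist_out R P W theta n.
pose j n : {linear W n -> H n} := @twist_in R P W theta n.
have [A AE] := Ext_map_exists N ad.
have [C CE] := Ext_map_exists N cd.
have [O OE] := Ext_map_exists N (phi := o) (fun n x => erefl).
have [J JE] := Ext_map_exists N (phi := j) (fun n x => esym (twist_ind theta x)).
have [D DE] := theta_map_exists thetaS.
have CA := Ext_inverse H_res S_res (conj a0 ad) (conj c0 cd) AE CE.
have AC := Ext_inverse S_res H_res (conj c0 cd) (conj a0 ad) CE AE.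
have exOJ := twist_exact_OJ thetaS OE JE.
have exJD := twist_exact_JD JE DE.
have exDO := twist_exact_DO OE DE.
exists (fun n => C n \o O n), (fun n => J n \o A n), D; split; split.
- exists (fun n => o n \o c n).
    split=> [x|n x]; last by rewrite /= -cd.
    rewrite -[RHS](congr1 q (c0 x)) /= /twist_aug linearD i0 add0r sigmaE.
    by [].
  by move=> n f x cf; apply: Ext_class_ext (CE n _ _ (OE n _ _ cf)).
- exists (fun n => a n \o j n).
    split=> [x|n x]; last by rewrite /= ad /j /= -twist_ind.
    by rewrite /= a0 /= /twist_aug /= linear0 addr0.
  by move=> n f x cf; apply: Ext_class_ext (JE n _ _ (AE n _ _ cf)).
- exists H, eH, j, o; split=> //.
  + split; split=> [x|n x] //.
    * by rewrite /= /twist_aug /= linear0 addr0.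
    * by rewrite /j /= -twist_ind.
    * by rewrite /= /twist_aug linearD i0 add0r sigmaE.
  + move=> n; split=> [x y [] //|y|z]; last by exists (0, z).
    split=> [yE|[x <-] //]; exists y.1; rewrite /j /= /twist_in.
    by case: y yE => y1 y2 /= ->.
  move=> n f h g x cf hf gE.
  (* An arbitrary extension h of f is of the form (f, b), so its coboundary descends to f theta + b
     d, which differs from f theta by a coboundary. *)
  apply: (coh_class_boundary (DE _ _ _ cf)).
    apply/Ext_boundaryS; exists (linear_pack (twist_hom_right h)) => z.
    have /= E := gE (0, z); rewrite /twist_d /= linear0 add0r in E.
    change (g z - f (theta n z) = h (0, ch_d P n z)).
    have E' : g z = h (theta n z, ch_d P n z) by apply: E.
    by rewrite E' (twist_homE h) /= hf addrAC subrr add0r.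
  apply/Ext_cocycle => z.
  have E : g (ch_d P n.+1 (o n.+2 (0, z))) = g (o n.+1 (ch_d H n.+1 (0, z))) by [].
  have E' := resolution_complex H_res.
  by rewrite -[z]/(o n.+2 (0, z)) E gE E' linear0.
- move=> x y; change (C 0%N (O 0%N x) = C 0%N (O 0%N y) -> x = y).
  move=> /(congr1 (A 0%N)); rewrite (AC 0%N (O 0%N x)) (AC 0%N (O 0%N y)).
  exact: (twist_inj_O OE).
- move=> n y; split=> [/exOJ [x xE]|[x xE]].
    by exists x; apply: etrans (CA n y); apply: congr1 xE.
  by apply/exOJ; exists x; rewrite -xE; apply/esym/AC.
- move=> n y; split=> [/exJD [x xE]|[x xE]].
    by exists (C n x); apply: etrans xE; apply: congr1 (AC n x).
  by apply/exJD; exists (A n x).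
- move=> n x; split=> [Cx|[y <-]].
    apply/exDO; apply: etrans (esym (AC n.+1 _)) _.
    by apply: etrans (congr1 (A n.+1) Cx) _; apply: linear0.
  have O0 : O n.+1 (D n y) = 0 by apply/exDO; exists y.
  by apply: etrans (congr1 (C n.+1) O0) _; apply: linear0.
Qed.
End LongExact.

(** * The bar resolution *)

Section Sequences.
Variable T : Type.

Definition scons (x : T) (a : nat -> T) : nat -> T := fun j => if j is i.+1 then a i else x.
Definition stail (a : nat -> T) : nat -> T := fun j => a j.+1.
Definition supd (a : nat -> T) (i : nat) (x : T) : nat -> T :=
  fun j => if j == i then x else a j.

Lemma scons_stail a : scons (a 0%N) (stail a) = a.
Proof. by apply/funext => -[|j]. Qed.
Lemma supd_scons0 x a y : supd (scons x a) 0 y = scons y a.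
Proof. by apply/funext => -[|j]. Qed.
Lemma supd_sconsS x a i y : supd (scons x a) i.+1 y = scons x (supd a i y).
Proof. by apply/funext => -[|j]. Qed.
Lemma stail_supd0 a x : stail (supd a 0 x) = stail a.
Proof. by apply/funext => -[|j]. Qed.
Lemma stail_supdS a i x : stail (supd a i.+1 x) = supd (stail a) i x.
Proof. by []. Qed.
End Sequences.

Section MultilinearSequences.
Variables (K : comPzRingType) (L : kAlgType K).

(* Multilinear maps L^n -> V as functions of infinite sequences that only see the
   first n entries: no reindexing of 'I_n is needed to insert or merge arguments. *)
Definition mlin (n : nat) (V : lmodType K) (F : (nat -> L) -> V) : Prop :=
  (forall a b, (forall j, (j < n)%N -> a j = b j) -> F a = F b) /\
  (forall a i, (i < n)%N -> forall k x y,
     F (supd a i (kin L k * x + y)) = k *: F (supd a i x) + F (supd a i y)).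

Definition seqfun n (V : Type) (f : ('I_n -> L) -> V) : (nat -> L) -> V :=
  fun a => f (fun j => a j).

Lemma seqfun_pad n (V : Type) (f : ('I_n -> L) -> V) a : seqfun f (pad a) = f a.
Proof. by congr f; apply/funext => j; apply: pad_ord. Qed.

Lemma mlin_multilinear n (V : lmodType K) (F : (nat -> L) -> V) :
  mlin n F -> multilinear (fun a : 'I_n -> L => F (pad a)).
Proof.
move=> [_ FL] a i k x y.
have E z : pad (upd a i z) = supd (pad a) i z.
  by apply/funext => j; rewrite pad_upd.
by rewrite !E FL.
Qed.

Lemma multilinear_mlin n (V : lmodType K) (f : ('I_n -> L) -> V) :
  multilinear f -> mlin n (seqfun f).
Proof.
move=> fL; split=> [a b ab|a i ilt k x y].
  by congr f; apply/funext => j; apply: ab.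
have E z : (fun j : 'I_n => supd a i z j) = upd (fun j => a j) (Ordinal ilt) z.
  by apply/funext => j; rewrite /upd -val_eqE.
by rewrite /seqfun !E fL.
Qed.

Lemma mlin_pad n (V : lmodType K) (F : (nat -> L) -> V) (a : nat -> L) :
  mlin n F -> F (pad (fun j : 'I_n => a j)) = F a.
Proof.
move=> [Fdep _]; apply: Fdep => j jn.
by rewrite (pad_ord (fun j : 'I_n => a j) (Ordinal jn)).
Qed.

Lemma mlin_scons n (V : lmodType K) (F : (nat -> L) -> V) x :
  mlin n.+1 F -> mlin n (fun a => F (scons x a)).
Proof.
move=> [Fdep FL]; split=> [a b ab|a i ilt k y z].
  by apply: Fdep => -[|j] //= /ab.
by rewrite -!supd_sconsS FL.
Qed.

Lemma mlin_head n (V : lmodType K) (F : (nat -> L) -> V) a k x y : mlin n.+1 F ->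
  F (scons (kin L k * x + y) a) = k *: F (scons x a) + F (scons y a).
Proof. by move=> [_ FL]; have := FL (scons 0 a) 0 isT k x y; rewrite !supd_scons0. Qed.

Section Space.
Variables (n : nat) (V : lmodType K).
Definition mlin_pred : {pred (nat -> L) -> V} := [pred F | `[< mlin n F >]].
Fact mlin_submod_closed : submod_closed mlin_pred.
Proof.
split=> [|c f g]; rewrite !inE.
  by split=> // a i _ k x y; rewrite /= scaler0 addr0.
move=> [fd fL] [gd gL]; have E b : (c *: f + g) b = c *: f b + g b by [].
split=> [a b ab|a i ilt k x y]; rewrite !E; first by rewrite (fd _ _ ab) (gd _ _ ab).
by rewrite fL // gL // !scalerDr !scalerA addrACA [c * k]mulrC.
Qed.
HB.instance Definition _ := GRing.isSubmodClosed.Build K ((nat -> L) -> V) mlin_pred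
  mlin_submod_closed.
Definition mspace : Type := {f : (nat -> L) -> V | f \in mlin_pred}.
HB.instance Definition _ := SubType.copy mspace {f : (nat -> L) -> V | f \in mlin_pred}.
HB.instance Definition _ := [Choice of mspace by <:].
HB.instance Definition _ := [SubChoice_isSubLmodule of mspace by <:].

Lemma mspaceP (f : mspace) : mlin n (val f).
Proof. by have := valP f; rewrite inE. Qed.
Definition mspace_mk F (h : mlin n F) : mspace := exist _ F (introT (asboolP _) h).
End Space.

(* Currying makes a multilinear map of n + 1 arguments a linear map from L. *)
Lemma mlin_lift (V W : lmodType K) (p : {linear V -> W}) n (f : (nat -> L) -> W) :
  projective (kmod L) -> (forall w, exists v, p v = w) -> mlin n f ->
  exists2 g : (nat -> L) -> V, mlin n g & forall a, p (g a) = f a.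
Proof.
move=> prL p_surj; elim: n f => [|n IHn] f fL.
  have [v vE] := p_surj (f (fun _ => 0)); exists (fun _ => v); first by [].
  by move=> a; rewrite vE; apply: fL.1.
have curryL : linear (fun x : kmod L => mspace_mk (mlin_scons x fL)).
  move=> k x y; apply: val_inj; apply/funext => a.
  exact: (mlin_head a k x y fL).
have compL (g : mspace n V) : mlin n (fun a => p (val g a)).
  have [gd gL] := mspaceP g; split=> [a b ab|a i ilt k x y].
    by congr (p _); apply: gd.
  by rewrite gL // linearP.
have postL : linear (fun g : mspace n V => mspace_mk (compL g)).
  by move=> k g h; apply: val_inj; apply/funext => a; apply: linearP.
(* By induction, composition with p maps the n-linear maps into V onto those into W, so projectivity
   of L lifts the curried map. *)
have [h|F FE] := prL _ _ (linear_pack postL) (linear_pack curryL).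
  have [g gL gE] := IHn _ (mspaceP h).
  by exists (mspace_mk gL); apply: val_inj; apply/funext => a; apply: gE.
exists (fun a => val (F (a 0%N)) (stail a)).
  split=> [a b ab|a [|i] ilt k x y].
  - by rewrite (ab 0%N) //; apply: (mspaceP _).1 => j jn; apply: ab.
  - rewrite !stail_supd0.
    have /(congr1 (fun g => val g (stail a))) := linearP F k x y.
    exact.
  - rewrite !stail_supdS; exact: (mspaceP _).2.
move=> a; have /(congr1 (fun g => val g (stail a))) /= := FE (a 0%N).
by rewrite scons_stail.
Qed.
End MultilinearSequences.

Section EnvelopingModules.
Variables (K : comPzRingType) (L : kAlgType K).

Lemma evp_act (V : lmodType (ev L)) x y (v : V) : evp x y *: v = lact x (ract v y).
Proof. by rewrite /lact /ract scalerA evpM !mulr1. Qed.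

Lemma lact_linear (V W : lmodType (ev L)) (f : {linear V -> W}) x v :
  f (lact x v) = lact x (f v).
Proof. exact: linearZ. Qed.

Lemma ract_linear (V W : lmodType (ev L)) (f : {linear V -> W}) x v :
  f (ract v x) = ract (f v) x.
Proof. exact: linearZ. Qed.

Lemma evreg_lact x (y : evreg L) : lact x y = x * y :> L.
Proof. by rewrite /lact evregE mulr1. Qed.

Lemma evreg_ract x (y : evreg L) : ract y x = (y : L) * x :> L.
Proof. by rewrite /ract evregE mul1r. Qed.

Lemma ev_linear (V W : lmodType (ev L)) (f : V -> W) :
  {morph f : x y / x + y} -> (forall x v, f (lact x v) = lact x (f v)) ->
  (forall x v, f (ract v x) = ract (f v) x) -> linear f.
Proof.
move=> fD fl fr t u v; rewrite fD; congr (_ + _).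
move: t; apply: tens_ext => [s t|s t|x y].
- by rewrite scalerDl fD.
- by rewrite scalerDl.
- by rewrite !evp_act fl fr.
Qed.
End EnvelopingModules.

Section BarModule.
Variables (K : comPzRingType) (L : kAlgType K).

Section Object.
Variable M : lmodType (ev L).
Let la (k : K) (m : M) : M := lact (kin L k) m.
Let ra (x : L) (k : K) : L := x * kin L k.

Fact barten_bimodule : bimodule (tlact (ra := ra) (la := la) (@GRing.mul L))
                               (tract (ra := ra) (la := la) (@ract _ _ M)).
Proof.
have H := ev_bimodule M.
apply: (@tens_bimodule K L) => [???|???|?|???|x m k|m x y|b ??|?|???|b k m|k].
- exact: mulrDl.
- exact: mulrDr.
- exact: mul1r.
- exact: mulrA.
- exact: mulrA.
- exact: (bim_raDr H).
- exact: (bim_raDl H).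
- exact: (bim_ra1 H).
- exact: (bim_raA H).
- exact/esym/(bim_lara H).
- exists k; split=> m; first exact: kinC.
  exact/esym/(bim_kin H).
Qed.

(* L (x)_K M, L^ev acting on the left through L and on the right through M *)
Definition barten : lmodType (ev L) := evmod barten_bimodule.
Definition bpure (x : L) (m : M) : barten := tpure ra la x m.

Lemma bpureDl x y m : bpure (x + y) m = bpure x m + bpure y m.
Proof. by have [h _ _] := tpure_balanced ra la; apply: h. Qed.
Lemma bpureDr x m n : bpure x (m + n) = bpure x m + bpure x n.
Proof. by have [_ h _] := tpure_balanced ra la; apply: h. Qed.
Lemma bpureK x k m : bpure (x * kin L k) m = bpure x (lact (kin L k) m).
Proof. by have [_ _ h] := tpure_balanced ra la; apply: h. Qed.

Lemma barten_lact b x m : lact b (bpure x m) = bpure (b * x) m.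
Proof.
have H := ev_bimodule M.
rewrite /lact; apply: etrans (evactE barten_bimodule _ _ _) _.
rewrite (bim_ra1 barten_bimodule); apply: tlactE => [y u v|y u s].
  exact: mulrDr.
exact: mulrA.
Qed.

Lemma barten_ract b x m : ract (bpure x m) b = bpure x (ract m b).
Proof.
have H := ev_bimodule M.
rewrite {1}/ract; apply: etrans (evactE barten_bimodule _ _ _) _.
rewrite (bim_la1 barten_bimodule); apply: tractE => [y u v|y u s].
  exact: (bim_raDl H).
exact/esym/(bim_lara H).
Qed.

Lemma barten_ext (A : zmodType) (f g : barten -> A) :
  {morph f : x y / x + y} -> {morph g : x y / x + y} ->
  (forall x m, f (bpure x m) = g (bpure x m)) -> f =1 g.
Proof. exact: tens_ext. Qed.

Lemma barten_lift (A : zmodType) (f : L -> M -> A) :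
  (forall x y m, f (x + y) m = f x m + f y m) ->
  (forall x m n, f x (m + n) = f x m + f x n) ->
  (forall x k m, f (x * kin L k) m = f x (lact (kin L k) m)) ->
  exists2 F : barten -> A, {morph F : x y / x + y} & forall x m, F (bpure x m) = f x m.
Proof.
move=> h1 h2 h3; have bf : balanced ra la f by [].
by exists (tlift f) => [|x m]; [apply: tliftD|apply: tlift_pure].
Qed.

(** A left linear extension is forced by its values on the 1 (x) m. Balance over K follows from
    right linearity of f, because the left and right actions of K on a bimodule agree. *)
Lemma barten_lift_linear (V : lmodType (ev L)) (f : M -> V) :
  {morph f : x y / x + y} -> (forall x m, f (ract m x) = ract (f m) x) ->
  exists F : {linear barten -> V}, forall x m, F (bpure x m) = lact x (f m).
Proof.
move=> fD fr; have H := ev_bimodule V.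
have [x y m|x m n|x k m|F FD FE] := barten_lift (f := fun x m => lact x (f m)).
- exact: (bim_laDl H).
- by rewrite fD (bim_laDr H).
- by rewrite (bim_kin (ev_bimodule M)) fr -(bim_kin H) (bim_laA H).
suff FL : linear F by exists (linear_pack FL).
apply: ev_linear => // [b|b].
- apply: barten_ext => [s t|s t|x m].
  + by rewrite /lact scalerDr FD.
  + by rewrite FD /lact scalerDr.
  + by rewrite barten_lact !FE (bim_laA H).
- apply: barten_ext => [s t|s t|x m].
  + by rewrite /ract scalerDr FD.
  + by rewrite FD /ract scalerDr.
  + by rewrite barten_ract !FE fr (bim_lara H).
Qed.
End Object.

Section Maps.
Variables (M N : lmodType (ev L)).

Lemma barten_act_exists : exists F : {linear barten M -> M},
  forall x m, F (bpure x m) = lact x m.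
Proof. by apply: barten_lift_linear. Qed.

Lemma barten_map_exists (f : {linear M -> N}) : exists F : {linear barten M -> barten N},
  forall x m, F (bpure x m) = bpure x (f m).
Proof.
have [||F FE] := barten_lift_linear (f := fun m => bpure 1 (f m)).
- by move=> m n; rewrite linearD bpureDr.
- by move=> x m; rewrite barten_ract ract_linear.
by exists F => x m; rewrite FE barten_lact mulr1.
Qed.
End Maps.

Definition barten_act M : {linear barten M -> M} := sval (cid (barten_act_exists M)).
Lemma barten_actE M x m : barten_act M (bpure x m) = lact x m.
Proof. exact: (svalP (cid (barten_act_exists M))). Qed.

Definition barten_map (M N : lmodType (ev L)) (f : {linear M -> N}) : {linear barten M -> barten N} :=
  sval (cid (barten_map_exists f)).
Lemma barten_mapE (M N : lmodType (ev L)) (f : {linear M -> N}) x m :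
  barten_map f (bpure x m) = bpure x (f m).
Proof. exact: (svalP (cid (barten_map_exists f))). Qed.
End BarModule.

Section BarComplex.
Variables (K : comPzRingType) (L : kAlgType K).

(* The bar resolution with its augmentation: L (x) L^(x)(n-1) (x) L in degree n - 1. *)
Fixpoint bar (n : nat) : lmodType (ev L) := if n is m.+1 then barten (bar m) else evreg L.

(** The recursion d (x (x) m) = x m - x (x) d m unfolds to the usual alternating sum of adjacent
    products, see [bar_d_barw]. In this form, prefixing 1 is visibly a contracting homotopy. *)
Fixpoint bar_d (n : nat) : {linear bar n.+1 -> bar n} :=
  if n is m.+1 return {linear bar n.+1 -> bar n}
  then (barten_act (bar m.+1) \- barten_map (bar_d m)) else barten_act (evreg L).

Lemma bar_d0E x (y : bar 0) : bar_d 0 (bpure x y) = lact x y.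
Proof. exact: barten_actE. Qed.

Lemma bar_dSE n x (m : bar n.+1) :
  bar_d n.+1 (bpure x m) = lact x m - bpure x (bar_d n m).
Proof. by rewrite /= barten_actE barten_mapE. Qed.

(* [barten_ext], with [bar] kept folded *)
Lemma bar_tens_ext n (A : zmodType) (f g : bar n.+1 -> A) :
  {morph f : x y / x + y} -> {morph g : x y / x + y} ->
  (forall x (m : bar n), f (bpure x m) = g (bpure x m)) -> f =1 g.
Proof. exact: barten_ext. Qed.

Lemma bpure0 (M : lmodType (ev L)) x : bpure x (0 : M) = 0.
Proof. by apply: (addrI (bpure x 0)); rewrite -bpureDr !addr0. Qed.

Lemma bar_dd n z : bar_d n (bar_d n.+1 z) = 0.
Proof.
have D (n' : nat) : {morph (fun z => bar_d n' (bar_d n'.+1 z)) : s t / s + t}.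
  by move=> s t; rewrite !linearD.
elim: n z => [|n IHn]; apply: bar_tens_ext => [|s t|x m].
- exact: D.
- by rewrite addr0.
- by rewrite bar_dSE linearB bar_d0E lact_linear subrr.
- exact: D.
- by rewrite addr0.
- by rewrite bar_dSE linearB bar_dSE lact_linear IHn bpure0 subr0 subrr.
Qed.

Lemma bar_contract0 (y : bar 0) : bar_d 0 (bpure 1 y) = y.
Proof. by rewrite bar_d0E /lact scale1r. Qed.

Lemma bar_contractS n (m : bar n.+1) :
  bar_d n.+1 (bpure 1 m) = m - bpure 1 (bar_d n m).
Proof. by rewrite bar_dSE /lact scale1r. Qed.

Lemma bar_exact n : exact_at (bar_d n.+1) (bar_d n).
Proof.
move=> z; split=> [dz|[y <-]]; last exact: bar_dd.
by exists (bpure 1 z); rewrite bar_contractS dz bpure0 subr0.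
Qed.

Definition bar_chain : chain (ev L) := @Chain _ (fun n => bar n.+1) (fun n => bar_d n.+1).
Definition bar_aug : {linear bar_chain 0 -> evreg L} := bar_d 0.

(* a_0 (x) ... (x) a_(n-1) (x) y *)
Fixpoint barw (n : nat) (a : nat -> L) (y : L) : bar n :=
  if n is m.+1 then bpure (a 0%N) (barw m (stail a) y) else y.

Definition barg n (a : nat -> L) : bar n.+1 := bpure 1 (barw n a 1).

Lemma barw_ract n a y x : ract (barw n a y) x = barw n a (y * x).
Proof. by elim: n a => [|n IHn] a /=; [exact: evreg_ract|rewrite barten_ract IHn]. Qed.

Lemma barw_add n a y z : barw n a (y + z) = barw n a y + barw n a z.
Proof. by elim: n a => [|n IHn] a //=; rewrite IHn bpureDr. Qed.

Lemma barg_act n a x y : lact x (ract (barg n a) y) = bpure x (barw n a y).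
Proof. by rewrite barten_ract barten_lact mulr1 barw_ract mul1r. Qed.

Lemma barw_ext n (A : zmodType) (f g : bar n -> A) :
  {morph f : x y / x + y} -> {morph g : x y / x + y} ->
  (forall a y, f (barw n a y) = g (barw n a y)) -> f =1 g.
Proof.
elim: n f g => [|n IHn] f g fD gD fg; first by move=> y; apply: (fg (fun _ => 0)).
apply: bar_tens_ext => // x; apply: IHn => [m m'|m m'|a y].
- by rewrite bpureDr fD.
- by rewrite bpureDr gD.
- exact: (fg (scons x a)).
Qed.

Lemma bar_ext n (V : lmodType (ev L)) (f g : {linear bar n.+1 -> V}) :
  (forall a, f (barg n a) = g (barg n a)) -> f =1 g.
Proof.
move=> fg; apply: (@barw_ext n.+1) => [||a y]; [exact: linearD|exact: linearD|].
by rewrite /= -barg_act !lact_linear !ract_linear fg.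
Qed.

(** Fixing the first argument x, the induction hypothesis extends the rest to a map F x. Agreement
    on the words [barw] determines such maps, which makes F x additive and K-linear in x, so that it
    factors through the tensor product. *)
Lemma barw_lift n (V : lmodType (ev L)) (f : (nat -> L) -> V) :
  mlin (L := L) (V := kres V) n f ->
  exists F : bar n -> V, [/\ {morph F : x y / x + y},
    forall x m, F (ract m x) = ract (F m) x &
    forall a y, F (barw n a y) = ract (f a) y].
Proof.
have H := ev_bimodule V.
elim: n f => [|n IHn] f fL.
  exists (fun y => ract (f (fun _ => 0)) y); split=> [y z|x m|a y].
  - exact: (bim_raDr H).
  - by rewrite (bim_raA H) -evreg_ract.
  - by congr (ract _ _); apply: fL.1.
have ex x := cid (IHn _ (mlin_scons x fL)).
pose F x := sval (ex x).
have FD x : {morph F x : m n / m + n} by rewrite /F; case: (svalP (ex x)).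
have Fr x y m : F x (ract m y) = ract (F x m) y.
  by rewrite /F; case: (svalP (ex x)).
have FE x a y : F x (barw n a y) = ract (f (scons x a)) y.
  by rewrite /F; case: (svalP (ex x)).
have Fcomb k x y m : F (kin L k * x + y) m = lact (kin L k) (F x m) + F y m.
  move: m; apply: barw_ext => [|s t|a z]; first exact: FD.
    by rewrite !FD (bim_laDr H) addrACA.
  rewrite !FE (mlin_head a k x y fL) (bim_raDl H); congr (_ + _).
  exact/esym/(bim_lara H).
have Fadd x y m : F (x + y) m = F x m + F y m.
  have := Fcomb 1 x y m; rewrite rmorph1 mul1r => ->.
  by rewrite (bim_la1 H).
have F0 m : F 0 m = 0 by apply: (addrI (F 0 m)); rewrite -Fadd !addr0.
(* A central scalar acts equally from both sides, and F x is right linear, so the scalar can be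
   carried from x to m. *)
have FK x k m : F (x * kin L k) m = F x (lact (kin L k) m).
  rewrite -kinC -[_ * x]addr0 Fcomb F0 addr0.
  by rewrite (bim_kin (ev_bimodule (bar n))) Fr -(bim_kin H).
have [G GD GE] := barten_lift Fadd FD FK.
exists G; split=> // [x|a y].
  apply: bar_tens_ext => [s t|s t|y m].
  - by rewrite (bim_raDl (ev_bimodule _)) GD.
  - by rewrite GD (bim_raDl H).
  - by rewrite barten_ract !GE Fr.
by rewrite /= GE FE scons_stail.
Qed.

(** This is the universal property of L (x) L^(x)n (x) L: bimodule maps out of it are multilinear
    maps of n arguments, and uniqueness is [bar_ext]. *)
Lemma bar_lift n (V : lmodType (ev L)) (f : (nat -> L) -> V) :
  mlin (L := L) (V := kres V) n f ->
  exists F : {linear bar n.+1 -> V}, forall a, F (barg n a) = f a.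
Proof.
have H := ev_bimodule V.
move=> /barw_lift [F [FD Fr FE]].
have [G GE] := barten_lift_linear FD Fr.
by exists G => a; rewrite GE FE (bim_la1 H) (bim_ra1 H).
Qed.

Lemma barw_supd n a i k x y z : (i < n)%N ->
  barw n (supd a i (kin L k * x + y)) z =
  lact (kin L k) (barw n (supd a i x) z) + barw n (supd a i y) z.
Proof.
elim: n a i => [//|n IHn] a [|i] ilt /=; first by rewrite !stail_supd0 bpureDl barten_lact.
by rewrite !stail_supdS IHn // bpureDr barten_lact /supd /= kinC bpureK.
Qed.

Lemma barw_dep n a b z : (forall j, (j < n)%N -> a j = b j) -> barw n a z = barw n b z.
Proof.
elim: n a b => [//|n IHn] a b ab /=; rewrite ab //.
by rewrite (IHn (stail a) (stail b)) // => j jn; apply: ab.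
Qed.

Lemma mlin_barg n : mlin (L := L) (V := kres (bar n.+1)) n (barg n).
Proof.
split=> [a b ab|a i ilt k x y]; first by rewrite /barg (barw_dep _ ab).
rewrite /barg barw_supd // bpureDr -bpureK -kinC.
by rewrite [k *: _]barten_lact.
Qed.

Lemma mlin_hom n (V W : lmodType (ev L)) (f : (nat -> L) -> V) (g : {linear V -> W}) :
  mlin (L := L) (V := kres V) n f -> mlin (L := L) (V := kres W) n (fun a => g (f a)).
Proof.
move=> [fd fL]; split=> [a b ab|a i ilt k x y]; first by rewrite (fd a b).
by rewrite fL // linearD [g (_ *: _)]lact_linear.
Qed.

Lemma kres_linear (V W : lmodType (ev L)) (f : {linear V -> W}) :
  linear (f : kres V -> kres W).
Proof. by move=> k x y; rewrite linearD [f (_ *: _)]lact_linear. Qed.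

(** Bimodule maps correspond to multilinear maps, and these lift along surjections by
    [mlin_lift]. *)
Lemma bar_projective n : projective (kmod L) -> projective (bar n.+1).
Proof.
move=> prL V W p f p_surj.
have [g gL gE] := mlin_lift (p := linear_pack (kres_linear p)) prL p_surj
  (mlin_hom f (mlin_barg n)).
have [F FE] := bar_lift gL.
exists F; apply: (bar_ext (f := p \o F)) => a.
by rewrite /= FE; apply: gE.
Qed.

Lemma bar_resolution : projective (kmod L) -> proj_resolution bar_aug.
Proof.
move=> prL; split=> [n|y||n].
- exact: bar_projective.
- by exists (bpure 1 y); apply: bar_contract0.
- exact: bar_exact.
- exact: bar_exact.
Qed.
End BarComplex.

(** * Hochschild cochains as functions of sequences *)

Section BarBoundary.
Variables (K : comPzRingType) (L : kAlgType K).

Definition smerge (i : nat) (a : nat -> L) : nat -> L := fun j =>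
  if (j < i)%N then a j else if j == i then a i * a i.+1 else a j.+1.

Lemma smerge0 a : smerge 0 a = scons (a 0%N * a 1%N) (stail (stail a)).
Proof. by apply/funext => -[|j]. Qed.

Lemma smergeS i a : smerge i.+1 a = scons (a 0%N) (smerge i (stail a)).
Proof. by apply/funext => -[|j]. Qed.

Lemma bpureN (M : lmodType (ev L)) x (m : M) : bpure x (- m) = - bpure x m.
Proof. by apply: (addrI (bpure x m)); rewrite -bpureDr !subrr bpure0. Qed.

Lemma bpure_sum (M : lmodType (ev L)) x (I : Type) (r : seq I) (F : I -> M) :
  bpure x (\sum_(i <- r) F i) = \sum_(i <- r) bpure x (F i).
Proof.
elim: r => [|i r IHr]; first by rewrite !big_nil bpure0.
by rewrite !big_cons bpureDr IHr.
Qed.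

Lemma signZ (V : lmodType (ev L)) s (v : V) : (-1) ^+ s *: v = if odd s then - v else v.
Proof. by rewrite -signr_odd; case: odd; rewrite ?expr1 ?scaleN1r ?expr0 ?scale1r. Qed.

Lemma bpure_sign (M : lmodType (ev L)) x s (m : M) :
  bpure x ((-1) ^+ s *: m) = (-1) ^+ s *: bpure x m.
Proof. by rewrite !signZ; case: odd; rewrite // bpureN. Qed.

Lemma bar_d_barw n a y : bar_d L n (barw n.+1 a y) =
  \sum_(i < n) (-1) ^+ i *: barw n (smerge i a) y + (-1) ^+ n *: barw n a (a n * y).
Proof.
elim: n a => [|n IHn] a.
  by rewrite big_ord0 add0r expr0 scale1r [LHS]bar_d0E evreg_lact.
rewrite [LHS]bar_dSE [X in _ - bpure _ X]IHn bpureDr bpure_sum bpure_sign big_ord_recl opprD addrA.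
congr (_ + _ + _).
- by rewrite expr0 scale1r barten_lact smerge0.
- rewrite -sumrN; apply: eq_bigr => i _.
  rewrite bpure_sign smergeS exprS mulN1r scaleNr; congr (- _).
- by rewrite exprS mulN1r scaleNr.
Qed.

Lemma bar_d_barg n a : bar_d L n.+1 (barg n.+1 a) =
  lact (a 0%N) (barg n (stail a)) + \sum_(i < n) (-1) ^+ i.+1 *: barg n (smerge i a)
  + (-1) ^+ n.+1 *: ract (barg n a) (a n).
Proof.
rewrite /barg bar_dSE bar_d_barw bpureDr bpure_sum bpure_sign opprD addrA.
congr (_ + _ + _).
- by rewrite /= barten_lact barten_lact mul1r mulr1.
- rewrite -sumrN; apply: eq_bigr => i _.
  by rewrite bpure_sign exprS mulN1r scaleNr.
- by rewrite exprS mulN1r scaleNr barten_ract barw_ract mulr1 mul1r.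
Qed.

(* [n] is the arity of [F]: only the first n entries of its argument are meant to matter. *)
Definition sdiff (n : nat) (F : (nat -> L) -> L) (a : nat -> L) : L :=
  a 0%N * F (stail a) + \sum_(i < n) (-1) ^+ i.+1 * F (smerge i a)
  + (-1) ^+ n.+1 * (F a * a n).

Definition kmlin n (F : (nat -> L) -> L) : Prop := mlin (L := L) (V := kmod L) n F.

Lemma sdiff_dep n F : kmlin n F ->
  forall a b, (forall j, (j < n.+1)%N -> a j = b j) -> sdiff n F a = sdiff n F b.
Proof.
move=> [Fd _] a b ab; rewrite /sdiff ab // (ab n) //; congr (_ * _ + _ + _ * (_ * _)).
- by apply: Fd => j jn; apply: ab.
- apply: eq_bigr => i _; congr (_ * _); apply: Fd => j jn; rewrite /smerge.
  rewrite !ab //; last exact: ltnW.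
  + exact: (leq_ltn_trans (ltn_ord i)).
  + by apply: (leq_trans (ltn_ord i)).
- by apply: Fd => j jn; apply: ab; apply: ltnW.
Qed.

Definition hcoch_of n F (h : kmlin n F) : hcoch L n := hcoch_mk (mlin_multilinear h).

Lemma seqfun_hcoch n F (h : kmlin n F) : seqfun (val (hcoch_of h)) = F.
Proof. by apply/funext => a; apply: (mlin_pad a h). Qed.

Lemma hcoch_mlin n (c : hcoch L n) : kmlin n (seqfun (val c)).
Proof. exact: (multilinear_mlin (hcochP c)). Qed.

Lemma hcoch_eq n (c d : hcoch L n) : seqfun (val c) = seqfun (val d) -> c = d.
Proof.
move=> E; apply: val_inj; apply/funext => a.
by rewrite -(seqfun_pad (val c)) E seqfun_pad.
Qed.

Lemma seqfun_hdiff n (c : hcoch L n) :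
  seqfun (val (hdiff c)) = sdiff n (seqfun (val c)).
Proof.
apply/funext => a; apply: (sdiff_dep (hcoch_mlin c)) => j jn.
exact: (pad_ord (fun j : 'I_n.+1 => a j) (Ordinal jn)).
Qed.

Lemma kmlin_sdiff n F : kmlin n F -> kmlin n.+1 (sdiff n F).
Proof.
move=> FL; rewrite -[F](seqfun_hcoch FL) -seqfun_hdiff.
exact: hcoch_mlin.
Qed.

Definition sbnd n (F : (nat -> L) -> L) : Prop :=
  if n is m.+1 then exists2 G, kmlin m G & F = sdiff m G else F = fun _ => 0.

Lemma boundary_sbnd n (c : hcoch L n) :
  boundary (X := hochschild L) c <-> sbnd n (seqfun (val c)).
Proof.
case: n c => [|n] c; split.
- by move=> [w <-].
- move=> c0; exists 0; apply/esym/hcoch_eq.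
  by rewrite c0.
- move=> [w wE]; exists (seqfun (val (w : hcoch L n))); first exact: hcoch_mlin.
  by rewrite -wE; apply: seqfun_hdiff.
- move=> [G GL cE]; exists (hcoch_of GL); apply: hcoch_eq.
  by rewrite [LHS]seqfun_hdiff seqfun_hcoch.
Qed.

Lemma sbnd_kmlin n F : sbnd n F -> kmlin n F.
Proof.
case: n => [->|n [G GL ->]]; last exact: kmlin_sdiff.
by split=> // a i _ k x y; rewrite scaler0 addr0.
Qed.

Lemma sbnd_linear n k F G : sbnd n F -> sbnd n G -> sbnd n (fun a => kin L k * F a + G a).
Proof.
move=> bF bG; have [FL GL] := (sbnd_kmlin bF, sbnd_kmlin bG).
have -> : (fun a => kin L k * F a + G a) = seqfun (val (k *: hcoch_of FL + hcoch_of GL)).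
  by rewrite -[in LHS](seqfun_hcoch FL) -[in LHS](seqfun_hcoch GL).
by apply/boundary_sbnd/(boundaryP (X := hochschild L)); apply/boundary_sbnd; rewrite seqfun_hcoch.
Qed.

Lemma sbndD n F G : sbnd n F -> sbnd n G -> sbnd n (fun a => F a + G a).
Proof.
move=> bF bG; have := sbnd_linear 1 bF bG; congr sbnd.
by apply/funext => a; rewrite rmorph1 mul1r.
Qed.

Lemma sbnd0 n : sbnd n (fun _ => 0).
Proof.
case: n => [//|n]; exists (fun _ => 0).
  by split=> // a i _ k x y; rewrite scaler0 addr0.
apply/funext => a; rewrite /sdiff big1 => [|i _]; by rewrite ?mul0r ?mulr0 ?addr0.
Qed.

Lemma sbndN n F : sbnd n F -> sbnd n (fun a => - F a).
Proof.
move=> bF; have := sbnd_linear (-1) bF (sbnd0 n); congr sbnd.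
by apply/funext => a; rewrite rmorphN1 mulN1r addr0.
Qed.

Lemma sbnd_sign n s F : sbnd n F -> sbnd n (fun a => (-1) ^+ s * F a).
Proof.
move=> bF; rewrite -signr_odd; case: odd; last first.
  by have := bF; congr sbnd; apply/funext => a; rewrite expr0 mul1r.
by have := sbndN bF; congr sbnd; apply/funext => a; rewrite expr1 mulN1r.
Qed.

Definition sclass n (F : (nat -> L) -> L) (x : HHn L n) : Prop :=
  exists2 c : hcoch L n, seqfun (val c) = F & coh_class (X := hochschild L) c x.

Lemma sclass_kmlin n F (x : HHn L n) : sclass F x -> kmlin n F.
Proof. by move=> [c <- _]; apply: hcoch_mlin. Qed.

Lemma sclass_cocycle n F (x : HHn L n) : sclass F x -> forall a, sdiff n F a = 0.
Proof.
move=> [c <- /coh_class_cocycle dc] a; rewrite -seqfun_hdiff.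
by have -> : hdiff c = 0 by exact: dc.
Qed.

Lemma sclass_exists n F : kmlin n F -> (forall a, sdiff n F a = 0) ->
  exists x : HHn L n, sclass F x.
Proof.
move=> FL dF; have [|x cx] := @coh_class_exists K (hochschild L) n (hcoch_of FL).
  apply: hcoch_eq; rewrite [LHS]seqfun_hdiff seqfun_hcoch.
  by apply/funext => a; rewrite dF.
by exists x, (hcoch_of FL); first exact: seqfun_hcoch.
Qed.

Lemma sclass_surj n (x : HHn L n) : exists F, sclass F x.
Proof. by have [c cx] := coh_class_surj x; exists (seqfun (val c)), c. Qed.

Lemma sclass_eq n F G (x y : HHn L n) : sclass F x -> sclass G y ->
  x = y <-> sbnd n (fun a => F a - G a).
Proof.
move=> [c <- cx] [d <- dy].
have -> : (fun a => seqfun (val c) a - seqfun (val d) a) = seqfun (val (c - d)) by [].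
by rewrite (coh_classP cx dy); apply: boundary_sbnd.
Qed.

Lemma sclass_boundary n F G (x : HHn L n) : sclass F x -> kmlin n G ->
  (forall a, sdiff n G a = 0) -> sbnd n (fun a => F a - G a) -> sclass G x.
Proof.
move=> cF GL dG bFG; have [y cG] := sclass_exists GL dG.
by rewrite (_ : x = y) //; apply/(sclass_eq cF cG).
Qed.

Lemma sclass_coh n (c : hcoch L n) (x : HHn L n) :
  sclass (seqfun (val c)) x <-> coh_class (X := hochschild L) c x.
Proof. by split=> [[d /hcoch_eq -> //]|cx]; exists c. Qed.

(* [bar_map] as a condition on functions of sequences *)
Definition sbar_map (T : chain (ev L)) (eps : {linear T 0 -> evreg L})
    (beta : forall n, (nat -> L) -> T n) : Prop :=
  [/\ forall n, mlin (L := L) (V := kres (T n)) n (beta n),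
      forall a, eps (beta 0%N a) = (1 : L) &
      forall n (a : nat -> L), ch_d T n (beta n.+1 a) =
        lact (a 0%N) (beta n (stail a))
        + \sum_(i < n) (-1) ^+ i.+1 *: beta n (smerge i a)
        + (-1) ^+ n.+1 *: ract (beta n a) (a n)].

Section BarMaps.
Variables (T : chain (ev L)) (eps : {linear T 0 -> evreg L}).

Lemma chain_map_bar_d n (V W : lmodType (ev L)) (f : {linear bar L n.+1 -> V})
    (g : {linear V -> W}) a :
  g (f (bar_d L n.+1 (barg n.+1 a)) : V) =
  lact (a 0%N) (g (f (barg n (stail a))))
        + \sum_(i < n) (-1) ^+ i.+1 *: g (f (barg n (smerge i a)))
        + (-1) ^+ n.+1 *: ract (g (f (barg n a))) (a n).
Proof.
rewrite bar_d_barg !linearD !lact_linear; congr (_ + _ + _).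
  by rewrite !linear_sum; apply: eq_bigr => i _; rewrite !linZ.
by rewrite (linZ f) (linZ g) !ract_linear.
Qed.

Lemma chain_map_sbar_map (phi : forall n, {linear bar_chain L n -> T n}) :
  chain_map (bar_aug L) eps idfun phi -> sbar_map eps (fun n a => phi n (barg n a)).
Proof.
move=> [phi0 phid]; split=> [n|a|n a].
- have h := @mlin_hom K L n (bar L n.+1) (T n) (barg n) (phi n) (@mlin_barg K L n). exact: h.
- exact: (etrans (phi0 (barg 0 a)) (bar_contract0 (1 : bar L 0))).
- rewrite phid; exact: (@chain_map_bar_d n (T n) (T n) (phi n) idfun a).
Qed.

(** The values on the generators 1 (x) a (x) 1 carry the whole chain map, so equalities of chain
    maps are tested on [barg]. Together with the preceding lemma this passes freely between the two
    descriptions. *)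
Lemma sbar_map_chain_map beta : sbar_map eps beta ->
  exists2 phi : forall n, {linear bar_chain L n -> T n},
    chain_map (bar_aug L) eps idfun phi & forall n a, phi n (barg n a) = beta n a.
Proof.
move=> [bL b0 bd].
have ex n := cid (bar_lift (bL n)).
pose phi n : {linear bar_chain L n -> T n} := sval (ex n).
have phiE n a : phi n (barg n a) = beta n a by apply: (svalP (ex n)).
exists phi => //; split=> [|n].
- move=> x; apply: (@bar_ext K L 0 (evreg L) (eps \o phi 0%N) (bar_aug L) _ x) => a.
  apply: etrans (congr1 eps (phiE 0%N a)) _; apply: etrans (b0 a) _.
  exact: (esym (bar_contract0 (1 : bar L 0))).
- move=> x; apply: (@bar_ext K L n.+1 (T n) (ch_d T n \o phi n.+1)
    (phi n \o bar_d L n.+1) _ x) => a.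
  apply: etrans (congr1 (ch_d T n) (phiE n.+1 a)) _; rewrite bd.
  apply/esym; apply: etrans (@chain_map_bar_d n (T n) (T n) (phi n) idfun a) _.
  rewrite /= !phiE; congr (_ + _ + _); apply: eq_bigr => i _.
  by rewrite phiE.
Qed.

Lemma sbar_map_bar_map beta : sbar_map eps beta ->
  bar_map eps (fun n a => beta n (pad a)).
Proof.
move=> [bL b0 bd]; split=> [n|a|n a]; [exact: mlin_multilinear|exact: b0|].
have dep m (b c : nat -> L) : (forall j, (j < m)%N -> b j = c j) -> beta m b = beta m c.
  exact: (bL m).1.
rewrite bd; congr (lact _ _ + _ + _ *: ract _ _).
- by apply: dep => j jn; rewrite (pad_ord _ (Ordinal jn)).
- by apply: eq_bigr => i _; congr (_ *: _); apply: dep => j jn;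
    rewrite (pad_ord _ (Ordinal jn)).
- by apply: dep => j jn; rewrite (pad_ord _ (Ordinal jn)).
Qed.

Lemma sdiff_linear n (f : {linear bar L n.+1 -> evreg L}) a :
  sdiff n (fun b => f (barg n b)) a = f (bar_d L n.+1 (barg n.+1 a)).
Proof.
rewrite [RHS](@chain_map_bar_d n _ _ f idfun a) /sdiff; congr (_ + _ + _).
- by rewrite [RHS]evreg_lact.
- by apply: eq_bigr => i _; rewrite signZ -signr_odd; case: odd; rewrite /= ?expr1 ?mulN1r ?mul1r.
- rewrite signZ -signr_odd evreg_ract; case: odd; rewrite /= ?expr1 ?mulN1r ?mul1r //.
Qed.
End BarMaps.

End BarBoundary.

Section HochschildExt.
Variables (K : comPzRingType) (L : kAlgType K).
Hypothesis L_proj : projective (kmod L).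

Lemma hom_kmlin (V : lmodType (ev L)) n (f : {linear V -> evreg L}) (b : (nat -> L) -> V) :
  mlin (L := L) (V := kres V) n b -> kmlin n (fun a => f (b a) : L).
Proof.
move=> /(mlin_hom f) [fd fL]; split=> // a i ilt k x y.
apply: etrans (fL a i ilt k x y) _; congr (_ + _).
exact: evreg_lact.
Qed.

Lemma kmlin_hom n (F : (nat -> L) -> L) :
  kmlin n F -> mlin (L := L) (V := kres (evreg L)) n F.
Proof.
move=> [Fd FL]; split=> // a i ilt k x y.
apply: etrans (FL a i ilt k x y) _; congr (_ + _).
exact/esym/evreg_lact.
Qed.

Lemma hom_boundary_sbnd n (g : {linear bar L n.+1 -> evreg L}) :
  boundary (X := hom_cochain (bar_chain L) (evreg L)) (n := n) g <->
  sbnd n (fun a => g (barg n a)).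
Proof.
case: n g => [|n] g; split.
- by move/(Ext_boundary0 (S := bar_chain L)) => g0; apply/funext => a; apply: g0.
- move=> g0; apply/(Ext_boundary0 (S := bar_chain L)) => x.
  apply: (@bar_ext K L 0 (evreg L) g \0 _ x) => a.
  exact: (congr1 (fun F => F a) g0).
- move/(Ext_boundaryS (S := bar_chain L)) => [h hE].
  exists (fun a => h (barg n a)); first exact/hom_kmlin/mlin_barg.
  by apply/funext => a; rewrite sdiff_linear; apply: hE.
- move=> [G /kmlin_hom/bar_lift [h hE] gE].
  apply/(Ext_boundaryS (S := bar_chain L)); exists h => x.
  apply: (@bar_ext K L n.+1 (evreg L) g (h \o bar_d L n.+1) _ x) => a.
  apply: etrans (congr1 (fun F => F a) gE) _.
  have <- : (fun b => h (barg n b)) = G by apply/funext => b; apply: hE.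
  exact: sdiff_linear.
Qed.

Lemma hom_cocycle_sdiff n (g : {linear bar L n.+1 -> evreg L}) :
  (forall x, g (bar_d L n.+1 x) = 0) <-> (forall a, sdiff n (fun b => g (barg n b)) a = 0).
Proof.
split=> [gd a|gd x]; first by rewrite sdiff_linear gd.
apply: (@bar_ext K L n.+1 (evreg L) (g \o bar_d L n.+1) \0 _ x) => a.
exact: (etrans (esym (sdiff_linear g a)) (gd a)).
Qed.

Lemma sbar_map_cocycle (T : chain (ev L)) (eps : {linear T 0 -> evreg L}) beta :
  sbar_map eps beta -> forall n (f : {linear T n -> evreg L}),
  (forall x, f (ch_d T n x) = 0) -> forall a, sdiff n (fun b => f (beta n b)) a = 0.
Proof.
move=> /sbar_map_chain_map [phi [_ phid] phiE] n f fd a.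
have -> : (fun b => f (beta n b)) = (fun b => (f \o phi n) (barg n b)).
  by apply/funext => b; rewrite -phiE.
apply: (iffLR (@hom_cocycle_sdiff n (f \o phi n : {linear bar L n.+1 -> evreg L}))) => x.
exact: (etrans (congr1 f (esym (phid n x))) (fd _)).
Qed.

(* The bar resolution being projective, T need not be. *)
Lemma sbar_map_homotopy (T : chain (ev L)) (eps : {linear T 0 -> evreg L}) beta beta' :
  exact_at (ch_d T 0) eps -> (forall n, exact_at (ch_d T n.+1) (ch_d T n)) ->
  sbar_map eps beta -> sbar_map eps beta' ->
  forall n (f : {linear T n -> evreg L}), (forall x, f (ch_d T n x) = 0) ->
  sbnd n (fun a => f (beta n a) - f (beta' n a) : L).
Proof.
move=> T_aug T_ex /sbar_map_chain_map [phi [phi0 phid] phiE].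
move=> /sbar_map_chain_map [psi [psi0 psid] psiE] n f fd.
have B_res := bar_resolution L_proj; have [B_proj _ _ _] := B_res.
have := comparison_boundary B_proj (resolution_complex B_res) T_aug T_ex
  (fun x => etrans (phi0 x) (esym (psi0 x))) phid psid fd.
move=> /(hom_boundary_sbnd (n := n)).
congr sbnd; apply/funext => a.
change (f (phi n (barg n a)) - f (psi n (barg n a)) = f (beta n a) - f (beta' n a)).
by rewrite phiE psiE.
Qed.

(** The last clause lets the identification be computed with any bar map [beta]: two of them are
    homotopic, so the resulting cocycles are cohomologous. It is what allows unrelated bar maps to
    be compared later. *)
Lemma HH_identification (T : chain (ev L)) (eps : {linear T 0 -> evreg L}) :
  proj_resolution eps ->
  exists k : forall n, {linear Ext T (evreg L) n -> HH L n},
  [/\ Ext_HH eps k, forall n, bijective (k n) &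
      forall beta, sbar_map eps beta ->
      forall n (f : {linear T n -> evreg L}) (x : Ext T (evreg L) n),
        Ext_class f x -> sclass (fun a => f (beta n a) : L) (k n x)].
Proof.
move=> T_res; have [T_proj T_surj T_aug T_ex] := T_res.
have B_res := bar_resolution L_proj.
have [phi phic] := Ext_comparison idfun B_res T_res; have [phi0 phid] := phic.
have [psi psic] := Ext_comparison idfun T_res B_res; have [psi0 psid] := psic.
have [F FE] := Ext_map_exists (evreg L) phid.
have [G GE] := Ext_map_exists (evreg L) psid.
have FG := Ext_inverse B_res T_res phic psic FE GE.
have GF := Ext_inverse T_res B_res psic phic GE FE.
(* Evaluation on generators identifies the complex of homomorphisms out of the bar resolution with
   the Hochschild complex. *)
pose th n (f : {linear bar L n.+1 -> evreg L}) :=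
  hcoch_of (hom_kmlin f (@mlin_barg K L n)).
have thE n (f : {linear bar L n.+1 -> evreg L}) :
    seqfun (val (th n f)) = (fun a => f (barg n a)) by apply: seqfun_hcoch.
have thL n : linear (th n : Defs.Hom (bar_chain L n) (evreg L) -> hcoch L n).
  move=> k f g; apply: hcoch_eq; rewrite thE.
  have -> : seqfun (val (k *: th n f + th n g)) =
    (fun a => kin L k * seqfun (val (th n f)) a + seqfun (val (th n g)) a) by [].
  rewrite !thE; apply/funext => a.
  change (lact (kin L k) (f (barg n a)) + g (barg n a) =
    kin L k * f (barg n a) + g (barg n a) :> L).
  by congr (_ + _); apply: evreg_lact.
have [n f|H HE] := cochain_map_exists (X := hom_cochain (bar_chain L) (evreg L))
  (Y := hochschild L) (phi := fun n => linear_pack (thL n)).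
  apply: hcoch_eq; rewrite [RHS]seqfun_hdiff thE [seqfun _]thE.
  by apply/funext => a; rewrite sdiff_linear.
have HsE n (f : {linear bar L n.+1 -> evreg L}) (x : Ext (bar_chain L) (evreg L) n) :
    Ext_class (P := bar_chain L) f x -> sclass (fun a => f (barg n a)) (H n x).
  by move=> cf; rewrite -thE; apply/sclass_coh/HE.
have H_bij n : bijective (H n).
  apply: inj_surj_bijective => [x y Hxy|y].
    have [f cf] := coh_class_surj x; have [g cg] := coh_class_surj y.
    apply/(coh_classP cf cg)/(hom_boundary_sbnd (n := n)).
    by apply/(sclass_eq (HsE _ _ _ cf) (HsE _ _ _ cg)).
  have [c cy] := sclass_surj y.
  have [f fE] := bar_lift (kmlin_hom (sclass_kmlin cy)).
  have [|x cx] := @coh_class_exists K (hom_cochain (bar_chain L) (evreg L)) n f.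
    apply/(Ext_cocycle (S := bar_chain L))/hom_cocycle_sdiff => a.
    by rewrite (funext fE) (sclass_cocycle cy).
  exists x; apply/(sclass_eq (HsE _ _ _ cx) cy).
  have -> : (fun a => f (barg n a) - c a : L) = fun _ => 0.
    by apply/funext => a; rewrite fE subrr.
  exact: sbnd0.
have kE n (f : {linear T n -> evreg L}) (x : Ext T (evreg L) n) : Ext_class f x ->
    sclass (fun a => f (phi n (barg n a)) : L) (H n (F n x)).
  by move=> cf; apply: HsE (FE _ _ _ cf).
have phiB := chain_map_sbar_map phic.
exists (fun n => H n \o F n); split.
- exists (fun n a => phi n (barg n (pad a))); first exact: sbar_map_bar_map phiB.
  move=> n f x /kE [c cE cx]; exists c => // a.
  by rewrite -(seqfun_pad (val c)) cE.
- move=> n; apply: bij_comp; first exact: H_bij.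
  exact: (Bijective (FG n) (GF n)).
- move=> beta bB n f x cf.
  have fd := (Ext_cocycle _).1 (coh_class_cocycle cf).
  have [bL _ _] := bB; apply: (sclass_boundary (kE n f x cf)).
  + exact: (hom_kmlin f (bL n)).
  + exact: (sbar_map_cocycle bB).
  + exact: (sbar_map_homotopy T_aug T_ex phiB bB).
Qed.
End HochschildExt.

Ltac seq_cases :=
  repeat (case: ltnP => ?); repeat (case: eqP => ?); try by [|exfalso; lia].

Ltac parity := rewrite /= ?(oddD, oddM) /= ?(oddD, oddM) /= ?(oddD, oddM) /=;
  repeat match goal with |- context [odd ?k] => case: (odd k) end; by [].

(** * Faces of one cochain inserted into another *)

Section Composition.
Variables (K : comPzRingType) (L : kAlgType K).
Implicit Types (F G : (nat -> L) -> L) (a : nat -> L).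

Definition sins (i n : nat) G a : nat -> L := fun j =>
  if (j < i)%N then a j else if j == i then G (fun k => a (i + k)%N) else a (j + n).-1.

Definition scirc (m n : nat) F G a : L :=
  \sum_(i < m) (-1) ^+ (i * n.+1) * F (sins i n G a).

Definition scup (m : nat) F G a : L := F a * G (fun j => a (m + j)%N).

(** The terms of the Hochschild differential indexed uniformly: r = 0 and r = m + 1 are the two
    outer multiplications, and the others merge adjacent entries. Sums over r can then be cut and
    reindexed at will. *)
Definition face (m r : nat) F a : L :=
  if r == 0%N then a 0%N * F (stail a)
  else if r == m.+1 then F a * a m else F (smerge r.-1 a).

Lemma sdiff_face m F a : sdiff m F a = \sum_(r < m.+2) (-1) ^+ r * face m r F a.
Proof.
rewrite /sdiff big_ord_recl big_ord_recr /= expr0 mul1r addrA; congr (_ + _ + _).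
- apply: eq_bigr => i _; rewrite /face /bump /= add1n /=.
  by case: eqP => // -[E]; have := ltn_ord i; rewrite E ltnn.
- by rewrite /face /bump /= add1n eqxx.
Qed.

Lemma signr_parity s t : odd s = odd t -> (-1) ^+ s = (-1) ^+ t :> L.
Proof. by move=> E; rewrite -signr_odd E signr_odd. Qed.

Lemma signr_comm s (x y : L) : x * ((-1) ^+ s * y) = (-1) ^+ s * (x * y).
Proof. by rewrite -signr_odd; case: odd; rewrite ?expr0 ?mul1r // expr1 !mulN1r mulrN. Qed.

Lemma face_sum m r (I : Type) (s : seq I) (c : I -> nat) (E : I -> (nat -> L) -> L) a :
  face m r (fun b => \sum_(i <- s) (-1) ^+ c i * E i b) a =
  \sum_(i <- s) (-1) ^+ c i * face m r (E i) a.
Proof.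
rewrite /face; case: eqP => _; last case: eqP => _ //.
- by rewrite mulr_sumr; apply: eq_bigr => i _; rewrite signr_comm.
- by rewrite mulr_suml; apply: eq_bigr => i _; rewrite mulrA.
Qed.

Section FaceOfInsertion.
Variables (m n : nat) (F G : (nat -> L) -> L).
Hypotheses (FL : kmlin m F) (GL : kmlin n G).
Variables (i : nat) (a : nat -> L).
Hypothesis im : (i < m)%N.
Let FG (b : nat -> L) := F (sins i n G b).
Let X r j := face m r F (sins j n G a).

Lemma face_ins_left t : (t <= i)%N -> face (m + n).-1 t FG a = X t i.+1.
Proof.
move=> ti; rewrite /X /face; case: t ti => [|t] ti /=.
  rewrite /FG /sins /=; congr (_ * F _); apply/funext => j.
  rewrite /stail /=; seq_cases; try by congr a; lia.
have -> : (t.+1 == (m + n).-1.+1) = false by lia.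
have -> : (t.+1 == m.+1) = false by lia.
congr F; apply/funext => j; rewrite /sins /smerge /=.
seq_cases; try by congr a; lia.
congr G; apply/funext => k; seq_cases; congr a; lia.
Qed.

Lemma face_ins_mid s : (0 < s <= n)%N ->
  face (m + n).-1 (i + s) FG a = F (sins i n.+1 (face n s G) a).
Proof.
move=> /andP [s0 sn]; rewrite /face.
have -> : (i + s == 0)%N = false by lia.
have -> : (s == 0)%N = false by lia.
have -> : (i + s == (m + n).-1.+1) = false by lia.
have -> : (s == n.+1) = false by lia.
congr F; apply/funext => j; rewrite /sins /smerge.
seq_cases; try by congr a; lia.
congr G; apply/funext => k; seq_cases; try by congr a; lia.
congr (_ * _); congr a; lia.
Qed.

Lemma face_ins_right r : (i.+1 < r <= m.+1)%N ->
  face (m + n).-1 (r + n).-1 FG a = X r i.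
Proof.
move=> /andP [ir rm]; rewrite /X /face.
have -> : ((r + n).-1 == 0)%N = false by lia.
have -> : (r == 0)%N = false by lia.
have -> : ((r + n).-1 == (m + n).-1.+1) = (r == m.+1) by apply/eqP/eqP; lia.
case: eqP => [rE|rE].
  by rewrite /FG /sins; congr (_ * _); seq_cases.
congr F; apply/funext => j; rewrite /sins /smerge.
have GE : G (fun k => if (i + k < (r + n).-1.-1)%N then a (i + k)%N
    else if (i + k)%N == (r + n).-1.-1 then a (r + n).-1.-1 * a (r + n).-1.-1.+1
    else a (i + k).+1) = G (fun k => a (i + k)%N).
  by apply: GL.1 => k kn; seq_cases.
rewrite GE; seq_cases; try by congr a; lia.
congr (_ * _); congr a; lia.
Qed.

(** An outer face of G multiplies its value by a neighbouring entry, and so does the face of F that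
    merges the inserted value with that entry. Such terms occur in F . dG and in dF . G but not in
    d(F . G). *)
Lemma face_ins_first : F (sins i n.+1 (face n 0 G) a) = X i.+1 i.+1.
Proof.
rewrite /X /face /= eqSS (_ : (i == m) = false); last by lia.
congr F; apply/funext => j; rewrite /sins /smerge.
seq_cases; try by congr a; lia.
congr (_ * _); first by congr a; lia.
by congr G; apply/funext => k; rewrite /stail; congr a; lia.
Qed.

Lemma face_ins_last : F (sins i n.+1 (face n n.+1 G) a) = X i.+1 i.
Proof.
rewrite /X /face /= eqxx eqSS (_ : (i == m) = false); last by lia.
congr F; apply/funext => j; rewrite /sins /smerge.
seq_cases; try by congr a; lia.
Qed.
End FaceOfInsertion.
End Composition.

(** * The Gerstenhaber operations *)

Section PreLie.
Variables (K : comPzRingType) (L : kAlgType K).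
Implicit Types (F G : (nat -> L) -> L) (a : nat -> L).

Lemma sum_nat_split (V : zmodType) (E : nat -> V) p q :
  \sum_(i < p + q) E i = \sum_(i < p) E i + \sum_(i < q) E (p + i)%N.
Proof. by rewrite big_split_ord. Qed.

(* Here F has arity k - 1, so that a bracket of arity (m + n).-1 can be differentiated
   also when m = n = 0, where it vanishes. *)
Definition sdiffp (k : nat) F a : L := if k is k'.+1 then sdiff k' F a else 0.

Lemma kmlin_sum m F (I : Type) (s : seq I) (c : I -> nat) (g : I -> L) a i :
  kmlin m F -> (i < m)%N ->
  F (supd a i (\sum_(j <- s) (-1) ^+ c j * g j)) =
  \sum_(j <- s) (-1) ^+ c j * F (supd a i (g j)).
Proof.
move=> [_ FL] im.
have F0 : F (supd a i 0) = 0.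
  have := FL a i im 1 0 0; rewrite mulr0 addr0 scale1r => E.
  by apply: (addrI (F (supd a i 0))); rewrite addr0 -E.
have FD x y : F (supd a i (x + y)) = F (supd a i x) + F (supd a i y).
  by have := FL a i im 1 x y; rewrite scale1r rmorph1 mul1r.
have FN x : F (supd a i (- x)) = - F (supd a i x).
  by apply: (addrI (F (supd a i x))); rewrite -FD !subrr.
elim: s => [|j s IHs]; first by rewrite !big_nil.
rewrite !big_cons FD IHs; congr (_ + _).
by rewrite -signr_odd; case: odd; rewrite ?expr0 ?mul1r // expr1 !mulN1r FN.
Qed.

Lemma scirc_sdiff m n F G a : kmlin m F ->
  scirc m n.+1 F (sdiff n G) a = \sum_(i < m) (-1) ^+ (i * n.+2) *
     \sum_(s < n.+2) (-1) ^+ s * F (sins i n.+1 (face n s G) a).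
Proof.
move=> FL; apply: eq_bigr => i _; congr (_ * _).
have E H : F (sins i n.+1 H a) = F (supd (sins i n.+1 H a) i (H (fun k => a (i + k)%N))).
  by congr F; apply/funext => j; rewrite /supd /sins; case: eqP => [->|//]; rewrite ltnn.
have E' H H' : supd (sins i n.+1 H a) i (H' (fun k => a (i + k)%N)) = sins i n.+1 H' a.
  by apply/funext => j; rewrite /supd /sins; case: eqP => [->|//]; rewrite ltnn.
rewrite E sdiff_face (kmlin_sum _ _ _ _ FL (ltn_ord i)).
by apply: eq_bigr => s _; rewrite E'.
Qed.

Lemma sgn_eq p q (x : L) : odd p = odd q -> (-1) ^+ p * x = (-1) ^+ q * x.
Proof. by move/signr_parity => ->. Qed.

Lemma sgn_opp p q (x : L) : odd p = ~~ odd q -> - ((-1) ^+ p * x) = (-1) ^+ q * x.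
Proof. by move=> pq; rewrite -mulN1r mulrA -exprS; apply: sgn_eq; rewrite /= pq negbK. Qed.

(** Gerstenhaber's identity: up to signs, the circle product is a homotopy between the two orders of
    the cup product. The cup products arise from the faces of dF . G for which G occupies the first
    or the last slot and its value is multiplied outside F. *)
Lemma sdiff_scirc m n F G a : kmlin m F -> kmlin n G ->
  sdiffp (m + n) (scirc m n F G) a =
  scirc m n.+1 F (sdiff n G) a + (-1) ^+ n.+1 * scirc m.+1 n (sdiff m F) G a
  - (-1) ^+ (m + n) * ((-1) ^+ (n.+1 * m) * scup m F G a + (-1) ^+ m.+1 * scup n G F a).
Proof.
move=> FL GL.
pose X r j : L := face m r F (sins j n G a).
pose Y r j : L := (-1) ^+ (j * n.+1 + r) * X r j.
(* [A j] gathers the faces of F up to the left of slot j, where G is inserted, and [B j] those to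
   its right. The last term of [A j] and the first of [B j] are the ones involving the value of
   G. *)
pose A j : L := \sum_(r < j.+1) Y r j.
pose B j : L := \sum_(r < m.+1 - j) Y (j.+1 + r)%N j.
pose D i : L := \sum_(s < n.+2) (-1) ^+ s * F (sins i n.+1 (face n s G) a).
have lhs : sdiffp (m + n) (scirc m n F G) a =
    \sum_(i < m) (-1) ^+ (i * n.+2) * D i + (-1) ^+ n.+1 * \sum_(i < m) (A i.+1 + B i).
  case: (posnP m) => [m0|m_gt0].
    rewrite m0 !big_ord0 mulr0 addr0 /sdiffp; case: (0 + n)%N => // k.
    rewrite sdiff_face big1 // => r _; rewrite [face _ _ _ _](_ : _ = 0) ?mulr0 //.
    have c0 b : scirc 0 n F G b = 0 by rewrite /scirc big_ord0.
    by rewrite /face !c0 mulr0 mul0r; case: eqP => // _; case: eqP.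
  have -> : sdiffp (m + n) (scirc m n F G) a = sdiff (m + n).-1 (scirc m n F G) a.
    by rewrite /sdiffp; case: (m + n)%N (addn_gt0 m n) => //; rewrite m_gt0.
  rewrite sdiff_face.
  have -> : ((m + n).-1.+2 = (m + n).+1)%N by lia.
  under eq_bigr => t _.
    rewrite [face _ _ _ _](face_sum _ _ _ _ (fun i b => F (sins (i : 'I_m) n G b))).
    rewrite mulr_sumr; over.
  rewrite exchange_big /= mulr_sumr -big_split /=; apply: eq_bigr => i _.
  have im := ltn_ord i.
  under eq_bigr do rewrite mulrA -exprD addnC exprD -mulrA.
  rewrite -mulr_sumr.
  pose E t : L := (-1) ^+ t * face (m + n).-1 t (fun b => F (sins i n G b)) a.
  rewrite -[X in _ * X = _]/(\sum_(t < (m + n).+1) E t).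
  (* The first i + 1 faces act to the left of the inserted block, the next n inside G, the last m -
     i to its right. *)
  have -> : (m + n).+1 = (i.+1 + n + (m - i))%N by lia.
  rewrite (sum_nat_split E) (sum_nat_split E).
  have -> : D i = X i.+1 i.+1 + \sum_(s < n) (-1) ^+ s.+1 *
        face (m + n).-1 (i.+1 + s) (fun b => F (sins i n G b)) a + (-1) ^+ n.+1 * X i.+1 i.
    rewrite /D big_ord_recl big_ord_recr /= expr0 mul1r addrA; congr (_ + _ + _).
    - exact: face_ins_first.
    - apply: eq_bigr => s _; rewrite /bump /= add1n addSnnS.
      by rewrite face_ins_mid // ltn_ord.
    - by rewrite /bump add1n; congr (_ * _); apply: face_ins_last.
  have -> : A i.+1 = \sum_(t < i.+1) (-1) ^+ (i.+1 * n.+1) * E t + Y i.+1 i.+1.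
    rewrite /A big_ord_recr /=; congr (_ + _); apply: eq_bigr => t _.
    rewrite /Y exprD -mulrA; congr (_ * (_ * _)).
    by rewrite face_ins_left // -ltnS.
  have -> : B i = Y i.+1 i + \sum_(r < m - i) (-1) ^+ (i * n.+1 + n.+1) * E (i.+1 + n + r)%N.
    rewrite /B (_ : (m.+1 - i)%N = (m - i).+1); last by lia.
    rewrite big_ord_recl addn0; congr (_ + _); apply: eq_bigr => r _.
    have rlt := ltn_ord r.
    have -> : (i.+1 + bump 0 r = i.+2 + r)%N by rewrite /bump add1n addnS addSn.
    have e1 : (i.+1 + n + r = (i.+2 + r + n).-1)%N by lia.
    rewrite /Y /E e1 (face_ins_right (m := m) F GL a im); last by lia.
    rewrite mulrA -exprD; congr (_ * _); apply: signr_parity; rewrite -e1 !oddD /=.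
    by rewrite oddM /=; case: (odd i); case: (odd n); case: (odd r).
  rewrite -!mulr_sumr.
  set S1 := \sum_(i1 < i.+1) _; set S3 := \sum_(i1 < m - i) _.
  set S2 := \sum_(i1 < n) _; set S2' := \sum_(s < n) _.
  have -> : S2 = (-1) ^+ i * S2'.
    rewrite /S2' mulr_sumr; apply: eq_bigr => s _.
    by rewrite mulrA -exprD /E addSnnS.
  rewrite /Y !mulrDr !mulrA -!exprD.
  (* Here x and y are the outer faces of G at slot i, absent from d(F . G). They enter through F .
     dG and cancel against the last term of [A i.+1] and the first term of [B i]. *)
  have key (x y s1 s2 s3 : L) : s1 + s2 + s3 = (x + s2 + y) + (s1 - x + (- y + s3)).
    rewrite addrACA [s1 - x]addrC addrA -addrA addNKr [x + s2]addrC addrA addrK.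
    by rewrite [s2 + s1]addrC.
  rewrite [LHS](key ((-1) ^+ (i * n.+2) * X i.+1 i.+1)
    ((-1) ^+ (i * n.+2 + n.+1) * X i.+1 i)).
  congr (_ + _ + _ + (_ + _ + (_ + _))).
  - by apply: sgn_eq; parity.
  - by apply: sgn_eq; parity.
  - by apply: sgn_opp; parity.
  - by apply: sgn_opp; parity.
  - by apply: sgn_eq; parity.
have -> : scirc m.+1 n (sdiff m F) G a = \sum_(j < m.+1) (A j + B j).
  apply: eq_bigr => j _; have jm := ltn_ord j; rewrite sdiff_face mulr_sumr.
  rewrite (_ : m.+2 = j.+1 + (m.+1 - j))%N; last by lia.
  rewrite (sum_nat_split (fun r => (-1) ^+ (j * n.+1) * ((-1) ^+ r * X r j))).
  by congr (_ + _); apply: eq_bigr => r _; rewrite mulrA -exprD.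
have EB : \sum_(j < m.+1) B j = \sum_(j < m) B j + B m by rewrite big_ord_recr.
rewrite big_split /= EB big_ord_recl /=.
have -> : A 0%N = scup n G F a.
  rewrite /A big_ord_recl big_ord0 addr0 /Y mul0n addn0 expr0 mul1r /X /face /scup.
  congr (_ * F _); apply/funext => j.
  by rewrite /stail /sins /=; congr a; lia.
have -> : B m = (-1) ^+ (m * n.+1 + m.+1) * scup m F G a.
  rewrite /B subSnn big_ord_recl big_ord0 addr0 addn0 /Y; congr (_ * _).
  rewrite /X /face /= eqxx /scup; congr (_ * _); last by rewrite /sins ltnn eqxx.
  by apply: FL.1 => j jm; rewrite /sins jm.
rewrite lhs scirc_sdiff // [\sum_(i < m) (A _ + B _)]big_split /= -[RHS]addrA; congr (_ + _).
set SA := \sum_(i < m) A _; set SB := \sum_(i < m) B _.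
move: (scup m F G a) (scup n G F a) => U V.
rewrite !mulrDr !mulrA -!exprD.
have key (u v p q : L) : u + v = (p + u) + (v + q) - (q + p).
  by rewrite [p + u]addrC addrA [in RHS]opprD addrA addrK -addrA addrACA addrA addrK.
rewrite [LHS](key _ _ ((-1) ^+ n.+1 * V) ((-1) ^+ (n.+1 + (m * n.+1 + m.+1)) * U)).
by congr (_ - (_ + _)); apply: sgn_eq; parity.
Qed.

End PreLie.

Section GerstenhaberOperations.
Variables (K : comPzRingType) (L : kAlgType K).
Implicit Types (F G : (nat -> L) -> L) (a : nat -> L).

(** The product [P], with the entry [a m] between the two values, is both the last face of dF and
    the first face of dG. Its two occurrences have opposite signs. *)
Lemma sdiff_scup m n F G a : kmlin m F ->
  sdiff (m + n) (scup m F G) a =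
  scup m.+1 (sdiff m F) G a + (-1) ^+ m * scup m F (sdiff n G) a.
Proof.
move=> FL.
pose P : L := F a * (a m * G (fun j => a (m.+1 + j)%N)).
pose U r : L := (-1) ^+ r * (face m r F a * G (fun j => a (m.+1 + j)%N)).
pose V r : L := (-1) ^+ r * (F a * face n r G (fun j => a (m + j)%N)).
have left r : (r <= m)%N ->
    face (m + n) r (scup m F G) a = face m r F a * G (fun j => a (m.+1 + j)%N).
  move=> rm; rewrite /face; case: r rm => [|r] rm /=.
    by rewrite /scup mulrA; congr (_ * _ * G _).
  have -> : (r.+1 == (m + n).+1) = false by lia.
  have -> : (r.+1 == m.+1) = false by lia.
  rewrite /scup; congr (_ * G _); apply/funext => j; rewrite /smerge /=.
  seq_cases; congr a; lia.
have right r : (0 < r <= n.+1)%N ->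
    face (m + n) (m + r) (scup m F G) a = F a * face n r G (fun j => a (m + j)%N).
  move=> /andP [r0 rn]; rewrite /face.
  have -> : (m + r == 0)%N = false by lia.
  have -> : (r == 0)%N = false by lia.
  have -> : (m + r == (m + n).+1)%N = (r == n.+1) by lia.
  case: eqP => _; first by rewrite /scup mulrA.
  rewrite /scup; congr (_ * G _).
    by apply: FL.1 => j jm; rewrite /smerge; seq_cases.
  apply/funext => j; rewrite /smerge; seq_cases; try by congr a; lia.
  by congr (_ * _); congr a; lia.
have -> : sdiff (m + n) (scup m F G) a =
    \sum_(r < m.+1) U r + \sum_(r < n.+1) (-1) ^+ m * V r.+1.
  rewrite sdiff_face (_ : (m + n).+2 = m.+1 + n.+1)%N; last by lia.
  rewrite (sum_nat_split (fun r => (-1) ^+ r * face (m + n) r (scup m F G) a)).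
  congr (_ + _); apply: eq_bigr => r _; first by rewrite left // -ltnS.
  by rewrite /V addSnnS right ?ltn_ord // exprD -mulrA.
have -> : scup m.+1 (sdiff m F) G a = \sum_(r < m.+1) U r + (-1) ^+ m.+1 * P.
  rewrite /scup sdiff_face mulr_suml big_ord_recr /=; congr (_ + _).
    by apply: eq_bigr => r _; rewrite -mulrA.
  by rewrite /face /= eqxx -!mulrA.
have -> : scup m F (sdiff n G) a = P + \sum_(r < n.+1) V r.+1.
  rewrite /scup sdiff_face mulr_sumr big_ord_recl /= expr0 mul1r; congr (_ + _).
    rewrite /face /= addn0 /P; congr (_ * (_ * G _)); apply/funext => j.
    by rewrite /stail addSnnS.
  by apply: eq_bigr => r _; rewrite /bump /= add1n signr_comm.
rewrite -mulr_sumr mulrDr addrA exprS mulN1r mulNr; congr (_ + _).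
by rewrite addrNK.
Qed.

Lemma scup_dep m n F G : kmlin m F -> kmlin n G ->
  forall a b, (forall j, (j < m + n)%N -> a j = b j) -> scup m F G a = scup m F G b.
Proof.
move=> FL GL a b ab; rewrite /scup; congr (_ * _).
- by apply: FL.1 => j jm; apply: ab; rewrite ltn_addr.
- by apply: GL.1 => j jn; apply: ab; rewrite ltn_add2l.
Qed.

Lemma scirc_dep m n F G : kmlin m F -> kmlin n G ->
  forall a b, (forall j, (j < (m + n).-1)%N -> a j = b j) ->
  scirc m n F G a = scirc m n F G b.
Proof.
move=> FL GL a b ab; apply: eq_bigr => i _; congr (_ * _); have im := ltn_ord i.
apply: FL.1 => j jm; rewrite /sins; seq_cases; try by apply: ab; lia.
by apply: GL.1 => k kn; apply: ab; lia.
Qed.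

Lemma seqfun_dep p (E : (nat -> L) -> L) :
  (forall a b, (forall j, (j < p)%N -> a j = b j) -> E a = E b) ->
  seqfun (fun a : 'I_p -> L => E (pad a)) = E.
Proof.
move=> Ed; apply/funext => a; apply: Ed => j jp.
exact: (pad_ord (fun j : 'I_p => a j) (Ordinal jp)).
Qed.

Lemma seqfun_hcup m n (c : hcoch L m) (d : hcoch L n) :
  seqfun (val (hcup c d)) = scup m (seqfun (val c)) (seqfun (val d)).
Proof. exact: (seqfun_dep (scup_dep (hcoch_mlin c) (hcoch_mlin d))). Qed.

Lemma seqfun_hcirc m n (c : hcoch L m) (d : hcoch L n) :
  seqfun (val (hcirc c d)) = scirc m n (seqfun (val c)) (seqfun (val d)).
Proof. exact: (seqfun_dep (scirc_dep (hcoch_mlin c) (hcoch_mlin d))). Qed.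

Definition sbrk (m n : nat) F G a : L :=
  scirc m n F G a - (-1) ^+ (m.+1 * n.+1) * scirc n m G F a.

Lemma seqfun_hbrk m n (c : hcoch L m) (d : hcoch L n) :
  seqfun (val (hbrk c d)) = sbrk m n (seqfun (val c)) (seqfun (val d)).
Proof.
apply: (@seqfun_dep (m + n).-1 (sbrk m n (seqfun (val c)) (seqfun (val d)))) => a b ab.
rewrite /sbrk (scirc_dep (hcoch_mlin c) (hcoch_mlin d) ab).
by rewrite (scirc_dep (hcoch_mlin d) (hcoch_mlin c) (a := a) (b := b)) // addnC.
Qed.

Lemma kmlin_scup m n F G : kmlin m F -> kmlin n G -> kmlin (m + n) (scup m F G).
Proof.
move=> FL GL; have := hcoch_mlin (hcup (hcoch_of FL) (hcoch_of GL)).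
by rewrite seqfun_hcup !seqfun_hcoch.
Qed.

Lemma kmlin_scirc m n F G : kmlin m F -> kmlin n G -> kmlin (m + n).-1 (scirc m n F G).
Proof.
move=> FL GL; have := hcoch_mlin (hcirc (hcoch_of FL) (hcoch_of GL)).
by rewrite seqfun_hcirc !seqfun_hcoch.
Qed.

Lemma kmlin_sbrk m n F G : kmlin m F -> kmlin n G -> kmlin (m + n).-1 (sbrk m n F G).
Proof.
move=> FL GL; have := hcoch_mlin (hbrk (hcoch_of FL) (hcoch_of GL)).
by rewrite seqfun_hbrk !seqfun_hcoch.
Qed.

Lemma sbnd_sdiffp k F : kmlin k.-1 F -> sbnd k (sdiffp k F).
Proof. by case: k => [|k] FL; [by []|exists F]. Qed.

Lemma sbnd_ext n F G : F =1 G -> sbnd n F -> sbnd n G.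
Proof. by move/funext => ->. Qed.

Lemma sdiffB n F G a : sdiff n (fun b => F b - G b) a = sdiff n F a - sdiff n G a.
Proof.
rewrite !sdiff_face -sumrB; apply: eq_bigr => r _; rewrite -mulrBr; congr (_ * _).
rewrite /face; case: eqP => _; first by rewrite mulrBr.
by case: eqP => _ //; rewrite mulrBl.
Qed.

Lemma scircBl m n F F' G a :
  scirc m n (fun b => F b - F' b) G a = scirc m n F G a - scirc m n F' G a.
Proof. by rewrite /scirc -sumrB; apply: eq_bigr => i _; rewrite mulrBr. Qed.

Lemma scircBr m n F G G' a : kmlin m F ->
  scirc m n F (fun b => G b - G' b) a = scirc m n F G a - scirc m n F G' a.
Proof.
move=> [_ FL]; rewrite /scirc -sumrB; apply: eq_bigr => i _; rewrite -mulrBr; congr (_ * _).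
have [s E] : exists s, forall H, sins i n H a = supd s i (H (fun k => a (i + k)%N)).
  exists (sins i n G a) => H; apply/funext => j; rewrite /supd /sins.
  by case: eqP => [->|//]; rewrite ltnn.
rewrite !E; set x := G _; set y := G' _.
have := FL s i (ltn_ord i) (-1) y x.
by rewrite rmorphN1 mulN1r scaleN1r addrC => ->; rewrite addrC.
Qed.

Lemma scirc0r m n F a : kmlin m F -> scirc m n F (fun _ => 0) a = 0.
Proof.
move=> FL; have E : (fun _ : nat -> L => 0 : L) = (fun _ => 0 - 0).
  by apply/funext => b; rewrite subrr.
rewrite [X in scirc m n F X a]E.
by rewrite (scircBr n (fun _ => 0) (fun _ => 0) a FL) subrr.
Qed.

Lemma scirc0l m n G a : scirc m n (fun _ => 0) G a = 0.
Proof. by rewrite /scirc big1 // => i _; rewrite mulr0. Qed.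

Lemma sdiffpB k F G a : sdiffp k (fun b => F b - G b) a = sdiffp k F a - sdiffp k G a.
Proof. by case: k => [|k] /=; [rewrite subrr|rewrite sdiffB]. Qed.

Lemma sdiffp_sign k s F a : sdiffp k (fun b => (-1) ^+ s * F b) a = (-1) ^+ s * sdiffp k F a.
Proof.
case: k => [|k] /=; first by rewrite mulr0.
rewrite !sdiff_face mulr_sumr; apply: eq_bigr => r _; rewrite -signr_comm; congr (_ * _).
rewrite /face; case: eqP => _; first by rewrite signr_comm.
by case: eqP => _ //; rewrite mulrA.
Qed.

Section Leibniz.
Variables (m n : nat) (F G : (nat -> L) -> L).
Hypotheses (FL : kmlin m F) (GL : kmlin n G).

(* The cup product terms of [sdiff_scirc] cancel in the bracket. *)
Lemma sdiff_sbrk a : sdiffp (m + n) (sbrk m n F G) a =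
  sbrk m n.+1 F (sdiff n G) a + (-1) ^+ n.+1 * sbrk m.+1 n (sdiff m F) G a.
Proof.
rewrite /sbrk (sdiffpB _ (scirc m n F G) (fun b => _ * scirc n m G F b)) sdiffp_sign.
rewrite (sdiff_scirc a FL GL) [in sdiffp (m + n)]addnC (sdiff_scirc a GL FL).
move: (scup m F G a) (scup n G F a) => U V.
move: (scirc m n.+1 F _ a) (scirc m.+1 n _ G a) => A B.
move: (scirc n m.+1 G _ a) (scirc n.+1 m _ F a) => C D.
rewrite !(mulrDr, mulrBr) !mulrA -!exprD.
rewrite mulrN [X in A - _ + (_ + X)]mulrN !mulrDr !mulrA -!exprD.
have key (x y u v c d : L) : x + y - (u + v) - (c + d - (v + u)) = x - d + (y - c).
  by rewrite [v + u]addrC opprB addrA addrNK [c + d]addrC opprD addrACA.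
apply: etrans _ (etrans (key A ((-1) ^+ n.+1 * B) ((-1) ^+ (m + n + n.+1 * m) * U)
  ((-1) ^+ (m + n + m.+1) * V) ((-1) ^+ (m.+1 * n.+1) * C) ((-1) ^+ (m.+1 * n.+1 + m.+1) * D)) _).
  by congr (_ - (_ + _ - (_ + _))); apply: sgn_eq; parity.
by congr (_ - _ + (_ - _)); apply: sgn_eq; parity.
Qed.

Lemma sbrkC a : sbrk m n F G a = - ((-1) ^+ (m.+1 * n.+1) * sbrk n m G F a).
Proof.
rewrite /sbrk mulrBr opprB; congr (_ - _).
by rewrite mulrA -exprD [(n.+1 * _)%N]mulnC -signr_odd oddD addbb expr0 mul1r.
Qed.
End Leibniz.

Lemma sbrkBl m n F F' G a : kmlin n G ->
  sbrk m n (fun b => F b - F' b) G a = sbrk m n F G a - sbrk m n F' G a.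
Proof.
move=> GL; rewrite /sbrk scircBl (scircBr m F F' a GL) mulrBr !opprD !opprK.
by rewrite addrACA.
Qed.

Lemma sbrkBr m n F G G' a : kmlin m F ->
  sbrk m n F (fun b => G b - G' b) a = sbrk m n F G a - sbrk m n F G' a.
Proof.
move=> FL; rewrite (sbrkC m n F (fun b => G b - G' b) a) sbrkBl // mulrBr opprB.
by rewrite (sbrkC m n F G a) (sbrkC m n F G' a) opprK addrC.
Qed.

Lemma sbrk0 m n F a : kmlin m F -> sbrk m n F (fun _ => 0) a = 0.
Proof. by move=> FL; rewrite /sbrk scirc0r // scirc0l mulr0 subrr. Qed.

Lemma sbnd_sbrk_left m n F G : sbnd m F -> kmlin n G -> (forall a, sdiff n G a = 0) ->
  sbnd (m + n).-1 (sbrk m n F G).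
Proof.
case: m => [|m] bF GL dG.
  rewrite bF; apply: (sbnd_ext _ (sbnd0 L _)) => a.
  by rewrite sbrkC sbrk0 // mulr0 oppr0.
have [H HL ->] := bF.
have := sbnd_sign n.+1 (sbnd_sdiffp (kmlin_sbrk HL GL)).
apply: sbnd_ext => a; rewrite (sdiff_sbrk HL GL) (_ : sdiff n G = fun _ => 0) ?sbrk0 //.
  by rewrite add0r mulrA -exprD -signr_odd oddD addbb expr0 mul1r.
exact/funext.
Qed.

Lemma sbnd_sbrk_right m n F G : kmlin m F -> (forall a, sdiff m F a = 0) -> sbnd n G ->
  sbnd (m + n).-1 (sbrk m n F G).
Proof.
move=> FL dF bG; have := sbndN (sbnd_sign (m.+1 * n.+1) (sbnd_sbrk_left bG FL dF)).
by rewrite addnC; apply: sbnd_ext => a; rewrite -sbrkC.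
Qed.

(** Here k is m + n. When k is 0 the truncated arity [k.-1] is 0 as well and [sdiffp] says nothing;
    in that case F has to vanish by itself. *)
Lemma sdiff_sdiffp k F : (k = 0 -> F = fun _ => 0) -> (forall a, sdiffp k F a = 0) ->
  forall a, sdiff k.-1 F a = 0.
Proof.
case: k => [|k] // F0 _ a; rewrite F0 // sdiff_face big1 // => r _.
by rewrite /face; case: eqP => _; [|case: eqP => _]; rewrite ?mul0r ?mulr0.
Qed.

Lemma scirc_arity0 n F G : scirc 0 n F G = fun _ => 0.
Proof. by apply/funext => a; rewrite /scirc big_ord0. Qed.

Lemma sbrk_cocycle m n F G : kmlin m F -> kmlin n G ->
  (forall a, sdiff m F a = 0) -> (forall a, sdiff n G a = 0) ->
  forall a, sdiff (m + n).-1 (sbrk m n F G) a = 0.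
Proof.
move=> FL GL dF dG; apply: sdiff_sdiffp => [/eqP|a].
  rewrite addn_eq0 => /andP [/eqP -> /eqP ->]; apply/funext => a.
  by rewrite /sbrk !scirc_arity0 mulr0 subrr.
rewrite (sdiff_sbrk FL GL) (_ : sdiff n G = fun _ => 0); last exact/funext.
rewrite (_ : sdiff m F = fun _ => 0); last exact/funext.
by rewrite sbrk0 // sbrkC sbrk0 // !mulr0 oppr0 mulr0 addr0.
Qed.

Lemma scup_cocycle m n F G : kmlin m F ->
  (forall a, sdiff m F a = 0) -> (forall a, sdiff n G a = 0) ->
  forall a, sdiff (m + n) (scup m F G) a = 0.
Proof.
move=> FL dF dG a; rewrite sdiff_scup // (_ : sdiff m F = fun _ => 0); last exact/funext.
rewrite (_ : sdiff n G = fun _ => 0); last exact/funext.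
by rewrite /scup mul0r !mulr0 addr0.
Qed.

Lemma sbnd_scup_left m n F G : sbnd m F -> kmlin n G -> (forall a, sdiff n G a = 0) ->
  sbnd (m + n) (scup m F G).
Proof.
case: m => [|m] bF GL dG.
  by rewrite bF; apply: (sbnd_ext _ (sbnd0 L _)) => a; rewrite /scup mul0r.
have [H HL ->] := bF; exists (scup m H G); first exact: kmlin_scup.
apply/funext => a; rewrite sdiff_scup // (_ : sdiff n G = fun _ => 0) ?/scup ?mulr0 ?addr0 //.
exact/funext.
Qed.

Lemma sbnd_scup_right m n F G : kmlin m F -> (forall a, sdiff m F a = 0) -> sbnd n G ->
  sbnd (m + n) (scup m F G).
Proof.
case: n => [|n] FL dF bG.
  by rewrite bG; apply: (sbnd_ext _ (sbnd0 L _)) => a; rewrite /scup mulr0.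
have [H HL ->] := bG; rewrite addnS.
have := sbnd_sign m (sbnd_sdiffp (k := (m + n).+1) (kmlin_scup FL HL)).
apply: sbnd_ext => a; rewrite /= sdiff_scup // (_ : sdiff m F = fun _ => 0); last exact/funext.
by rewrite {1}/scup mul0r add0r mulrA -exprD -signr_odd oddD addbb expr0 mul1r.
Qed.

(** For F = G of even degree, the two cup products F u F in [sdiff_scirc] carry opposite signs. *)
Lemma ssq_cocycle n F : kmlin n.*2 F -> (forall a, sdiff n.*2 F a = 0) ->
  forall a, sdiff (n.*2 + n.*2).-1 (scirc n.*2 n.*2 F F) a = 0.
Proof.
set m := n.*2 => FL dF; have om : odd m = false by rewrite odd_double.
apply: sdiff_sdiffp => [/eqP|a].
  by rewrite addn_eq0 => /andP [/eqP -> _]; apply: scirc_arity0.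
rewrite (sdiff_scirc a FL FL) (_ : sdiff m F = fun _ => 0); last exact/funext.
rewrite scirc0r // scirc0l mulr0 addr0 add0r.
rewrite -(sgn_opp (p := m.+1 * m) (q := m.+1)) ?subrr ?mulr0 ?oppr0 //.
by rewrite oddM /= om.
Qed.

(* For D = dH of even degree, d(H . D) and d(H u H) differ by D . D up to sign. *)
Lemma sbnd_scirc_square m D : sbnd m D -> ~~ odd m -> (forall a, sdiff m D a = 0) ->
  sbnd (m + m).-1 (scirc m m D D).
Proof.
case: m => [|k] bD; first by move=> _ _; rewrite scirc_arity0; apply: sbnd0.
move=> /=; rewrite negbK => ok dD; have DL := sbnd_kmlin bD.
have [H HL DE] := bD; rewrite addnS.
have b1 : sbnd (k + k.+1) (sdiffp (k + k.+1) (scirc k k.+1 H D)).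
  by apply/sbnd_sdiffp/kmlin_scirc.
have b2 : sbnd (k + k).+1 (sdiff (k + k) (scup k H H)).
  by exists (scup k H H); first exact: kmlin_scup.
rewrite addnS in b1; apply: sbnd_ext (sbndD b2 (sbndN b1)) => a.
have E := sdiff_scirc a HL DL; rewrite addnS in E.
rewrite E (sdiff_scup _ H a HL) -DE.
rewrite (_ : sdiff k.+1 D = fun _ => 0); last exact/funext.
rewrite scirc0r // add0r.
move: (scup k.+1 D H a) (scup k H D a) (scirc k.+1 k.+1 D D a) => U V W.
rewrite (@sgn_eq _ _ k.+2 1) /= ?ok // (@sgn_eq _ _ (k + k).+1 1) /= ?oddD ?ok //.
rewrite (@sgn_eq _ _ (k.+2 * k) 1) ?oddM /= ?ok // (@sgn_eq _ _ k.+1 0) /= ?ok //.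
rewrite (@sgn_eq _ _ k 1) ?ok // expr0 expr1 !mulN1r mul1r opprK opprD opprK.
by rewrite [- V + U]addrC [LHS]addrC addrNK.
Qed.

(** With D = F - F' of even degree, F . F - F' . F' = [F, D] - D . D. The bracket of a cocycle with
    a boundary is a boundary, and D . D is one by the preceding lemma. *)
Lemma sbnd_ssq n F F' : kmlin n.*2 F -> kmlin n.*2 F' ->
  (forall a, sdiff n.*2 F a = 0) -> (forall a, sdiff n.*2 F' a = 0) ->
  sbnd n.*2 (fun a => F a - F' a) ->
  sbnd (n.*2 + n.*2).-1 (fun a => scirc n.*2 n.*2 F F a - scirc n.*2 n.*2 F' F' a).
Proof.
set m := n.*2 => FL FL' dF dF' bD; have om : odd m = false by rewrite odd_double.
have dD a : sdiff m (fun b => F b - F' b) a = 0 by rewrite sdiffB dF dF' subrr.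
have b1 := sbnd_sbrk_right FL dF bD.
have b2 := sbnd_scirc_square bD (negbT om) dD.
apply: sbnd_ext (sbndD b1 (sbndN b2)) => a.
rewrite /sbrk (@sgn_opp _ _ _ 0) ?expr0 ?mul1r; last by rewrite oddM /= om.
rewrite !scircBl !(scircBr _ _ _ _ FL) !(scircBr _ _ _ _ FL').
move: (scirc _ _ F F a) (scirc _ _ F F' a) (scirc _ _ F' F a) (scirc _ _ F' F' a).
move=> p q r s.
by rewrite opprB [p - q + _]addrC -[LHS]addrA [r - s - _]addrC addNKr addrA addrNK.
Qed.

Section Classes.

(** [HHop] selects with [xget] a class valid for all pairs of representatives. Independence of the
    representatives shows that such a class exists, so the default value 0 is never taken. *)
Lemma HHop_class m n p (op : hcoch L m -> hcoch L n -> hcoch L p)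
    (sop : ((nat -> L) -> L) -> ((nat -> L) -> L) -> (nat -> L) -> L) :
  (forall c d, seqfun (val (op c d)) = sop (seqfun (val c)) (seqfun (val d))) ->
  (forall F G, kmlin m F -> kmlin n G -> (forall a, sdiff m F a = 0) ->
     (forall a, sdiff n G a = 0) -> forall a, sdiff p (sop F G) a = 0) ->
  (forall F F' G G', kmlin m F -> kmlin m F' -> kmlin n G -> kmlin n G' ->
     (forall a, sdiff m F a = 0) -> (forall a, sdiff m F' a = 0) ->
     (forall a, sdiff n G a = 0) -> (forall a, sdiff n G' a = 0) ->
     sbnd m (fun a => F a - F' a) -> sbnd n (fun a => G a - G' a) ->
     sbnd p (fun a => sop F G a - sop F' G' a)) ->
  forall F G x y, sclass (n := m) F x -> sclass (n := n) G y -> sclass (n := p) (sop F G) (HHop op x y).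
Proof.
move=> opE opZ opB F G x y [c <- cx] [d <- dy]; rewrite -opE; apply/sclass_coh.
rewrite /HHop; case: xgetP => [z _ /= h|/= h]; first exact: h.
have [z cz] : exists z : HHn L p, sclass (n := p) (seqfun (val (op c d))) z.
  apply: sclass_exists; first exact: hcoch_mlin.
  rewrite opE; apply: opZ; try exact: hcoch_mlin.
    exact/sclass_cocycle/sclass_coh/cx.
  exact/sclass_cocycle/sclass_coh/dy.
exfalso; apply: (h z) => c' d' /sclass_coh cx' /sclass_coh dy'; apply/sclass_coh.
move/sclass_coh: cx => cx; move/sclass_coh: dy => dy.
apply: (sclass_boundary cz); first exact: hcoch_mlin.
  by rewrite opE; apply: opZ; try exact: hcoch_mlin; apply: sclass_cocycle; eassumption.
rewrite !opE; apply: opB; try exact: hcoch_mlin; try by apply: sclass_cocycle; eassumption.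
  exact/(sclass_eq cx cx').
exact/(sclass_eq dy dy').
Qed.

Lemma gcup_class m n F G x y : sclass (n := m) F x -> sclass (n := n) G y ->
  sclass (n := (m + n)) (scup m F G) (gcup (g := HH L) x y).
Proof.
apply: HHop_class => [c d|F' G' FL GL|F1 F2 G1 G2 F1L F2L G1L G2L dF1 dF2 dG1 dG2 bF bG].
- exact: seqfun_hcup.
- exact: scup_cocycle.
- have b1 := sbnd_scup_left bF G1L dG1; have b2 := sbnd_scup_right F2L dF2 bG.
  apply: sbnd_ext (sbndD b1 b2) => a.
  by rewrite /scup mulrBl mulrBr addrA addrNK.
Qed.

Lemma gbrk_class m n F G x y : sclass (n := m) F x -> sclass (n := n) G y ->
  sclass (n := (m + n).-1) (sbrk m n F G) (gbrk (g := HH L) x y).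
Proof.
apply: HHop_class => [c d|F' G' FL GL|F1 F2 G1 G2 F1L F2L G1L G2L dF1 dF2 dG1 dG2 bF bG].
- exact: seqfun_hbrk.
- exact: sbrk_cocycle.
- have b1 := sbnd_sbrk_left bF G1L dG1; have b2 := sbnd_sbrk_right F2L dF2 bG.
  apply: sbnd_ext (sbndD b1 b2) => a.
  by rewrite sbrkBl // sbrkBr // addrA addrNK.
Qed.

Lemma gsq_class n F (x : HH L n.*2) : sclass (n := n.*2) F x ->
  sclass (n := (n.*2 + n.*2).-1) (scirc n.*2 n.*2 F F) (gsq (g := HH L) x).
Proof.
move=> [c <- cx]; rewrite -seqfun_hcirc; apply/sclass_coh; move/sclass_coh: cx => cx.
rewrite /= /HHsq; case: xgetP => [z _ /= h|/= h]; first exact/h/sclass_coh.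
have [z cz] : exists z : HHn L (n.*2 + n.*2).-1,
    sclass (n := (n.*2 + n.*2).-1) (seqfun (val (hcirc c c))) z.
  apply: sclass_exists; first exact: hcoch_mlin.
  by rewrite seqfun_hcirc; apply: ssq_cocycle; [exact: hcoch_mlin|exact: sclass_cocycle cx].
exfalso; apply: (h z) => c' /sclass_coh cx'; apply/sclass_coh.
apply: (sclass_boundary cz); first exact: hcoch_mlin.
  by rewrite seqfun_hcirc; apply: ssq_cocycle; [exact: hcoch_mlin|exact: sclass_cocycle cx'].
rewrite !seqfun_hcirc; apply: sbnd_ssq; try exact: hcoch_mlin.
- exact: sclass_cocycle cx.
- exact: sclass_cocycle cx'.
- exact/(sclass_eq cx cx').
Qed.

Lemma gone_class : sclass (n := 0) (fun _ => 1) (gone (HH L)).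
Proof.
have E : seqfun (val (hone L)) = fun _ => 1 by [].
have [|a|z cz] := @sclass_exists K L 0 (fun _ => 1).
- by rewrite -E; apply: hcoch_mlin.
- by rewrite /sdiff big_ord0 addr0 expr1 mulN1r mul1r mulr1 subrr.
rewrite -E; apply/sclass_coh; rewrite /= /HHone; case: xgetP => [w _ //|/= h].
by exfalso; apply: (h z); apply/sclass_coh; rewrite E.
Qed.
End Classes.
End GerstenhaberOperations.

(** * Induction from a corner *)

Section CornerModule.
Variables (K : comPzRingType) (B : kAlgType K) (e : idem B).
Local Notation C := (corner e).

Lemma corner_l (c : C) : (e : B) * val c = val c.
Proof. exact: peircel. Qed.
Lemma corner_r (c : C) : val c * (e : B) = val c.
Proof. exact: peircer. Qed.

Section Object.
Variable M : lmodType (ev B).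

Definition cmod_pred : {pred M} := [pred m | evp (e : B) (e : B) *: m == m].
Fact cmod_zmod_closed : zmod_closed cmod_pred.
Proof.
split=> [|x y]; rewrite !inE ?scaler0 // => /eqP hx /eqP hy.
by rewrite scalerBr hx hy.
Qed.
HB.instance Definition _ := GRing.isZmodClosed.Build M cmod_pred cmod_zmod_closed.
Definition cmod_carrier : Type := {m : M | m \in cmod_pred}.
HB.instance Definition _ := SubType.copy cmod_carrier {m : M | m \in cmod_pred}.
HB.instance Definition _ := [Choice of cmod_carrier by <:].
HB.instance Definition _ := [SubChoice_isSubZmodule of cmod_carrier by <:].

Lemma cmodP (m : cmod_carrier) : evp (e : B) (e : B) *: val m = val m.
Proof. exact/eqP/(valP m). Qed.

Lemma cmod_mem x (m : M) y : (e : B) * x = x -> y * (e : B) = y ->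
  evp x y *: m \in cmod_pred.
Proof. by move=> ex ye; rewrite inE scalerA evpM ex ye. Qed.

Definition cut (m : M) : cmod_carrier := exist _ (evp (e : B) (e : B) *: m) (cmod_mem m (idvK e) (idvK e)).

Lemma cmod_lact_mem (c : C) (m : cmod_carrier) : lact (val c) (val m) \in cmod_pred.
Proof.
rewrite -(cmodP m) /lact scalerA evpM mulr1; apply: cmod_mem; last exact: idvK.
by rewrite mulrA corner_l.
Qed.
Definition clact (c : C) (m : cmod_carrier) : cmod_carrier := exist _ (lact (val c) (val m)) (cmod_lact_mem c m).

Lemma cmod_ract_mem (c : C) (m : cmod_carrier) : ract (val m) (val c) \in cmod_pred.
Proof.
rewrite -(cmodP m) /ract scalerA evpM mul1r; apply: cmod_mem; first exact: idvK.
by rewrite -mulrA corner_r.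
Qed.
Definition cract (m : cmod_carrier) (c : C) : cmod_carrier := exist _ (ract (val m) (val c)) (cmod_ract_mem c m).

Lemma cmod_e_l (m : cmod_carrier) : lact (e : B) (val m) = val m.
Proof. by rewrite -[in LHS](cmodP m) /lact scalerA evpM mulr1 idvK cmodP. Qed.
Lemma cmod_e_r (m : cmod_carrier) : ract (val m) (e : B) = val m.
Proof. by rewrite -[in LHS](cmodP m) /ract scalerA evpM mul1r idvK cmodP. Qed.

Fact cmod_bimodule : bimodule clact cract.
Proof.
have H := ev_bimodule M.
split=> *; apply: val_inj => /=.
- exact: (bim_laDl H).
- exact: (bim_laDr H).
- exact: (bim_raDl H).
- exact: (bim_raDr H).
- exact: cmod_e_l.
- exact: cmod_e_r.
- exact: (bim_laA H).
- exact: (bim_raA H).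
- exact: (bim_lara H).
- rewrite -(bim_laA H) cmod_e_l (bim_kin H) -[RHS]/(ract _ (kin B _ * (e : B))).
  by rewrite kinC -(bim_raA H) cmod_e_r.
Qed.

(* The C^ev-module e M e. *)
Definition cmod : lmodType (ev C) := evmod cmod_bimodule.
Definition cval (m : cmod) : M := val (m : cmod_carrier).

Lemma cval_inj : injective cval.
Proof. exact: val_inj. Qed.
Lemma cvalD m n : cval (m + n) = cval m + cval n.
Proof. by []. Qed.
Lemma cval_lact c (m : cmod) : cval (lact c m) = lact (val c) (cval m).
Proof.
apply: etrans (congr1 cval (evactE cmod_bimodule _ _ _)) _.
by rewrite (bim_ra1 cmod_bimodule).
Qed.
Lemma cval_ract c (m : cmod) : cval (ract m c) = ract (cval m) (val c).
Proof.
apply: etrans (congr1 cval (evactE cmod_bimodule _ _ _)) _.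
by rewrite (bim_la1 cmod_bimodule).
Qed.
Lemma cval_cut m : cval (cut m) = evp (e : B) (e : B) *: m.
Proof. by []. Qed.
Lemma cvalP (m : cmod) : evp (e : B) (e : B) *: cval m = cval m.
Proof. exact: cmodP. Qed.
End Object.

Lemma cmod_linear (P : lmodType (ev C)) (M : lmodType (ev B)) (f : P -> cmod M) :
  {morph (fun p => cval (f p)) : x y / x + y} ->
  (forall c p, cval (f (lact c p)) = lact (val c) (cval (f p))) ->
  (forall c p, cval (f (ract p c)) = ract (cval (f p)) (val c)) -> linear f.
Proof.
move=> fD fl fr; apply: ev_linear => [p q|c p|c p]; apply: cval_inj.
- exact: fD.
- by rewrite cval_lact fl.
- by rewrite cval_ract fr.
Qed.

Section Map.
Variables (M N : lmodType (ev B)) (f : {linear M -> N}).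
Lemma cmap_mem (m : cmod M) : f (cval m) \in @cmod_pred N.
Proof. by rewrite inE -linZ cvalP. Qed.
Definition cmap (m : cmod M) : cmod N := exist _ (f (cval m)) (cmap_mem m).
Fact cmap_linear : linear cmap.
Proof.
apply: cmod_linear => [m n|c m|c m]; first exact: linearD.
- by rewrite /= /cval /= -/(cval _) cval_lact lact_linear.
- by rewrite /= /cval /= -/(cval _) cval_ract ract_linear.
Qed.
HB.instance Definition _ := GRing.isLinear.Build (ev C) (cmod M) (cmod N) _ cmap cmap_linear.
Lemma cval_cmap m : cval (cmap m) = f (cval m).
Proof. by []. Qed.
End Map.

(** A preimage of an element of e N e becomes one inside e M e after multiplication by e (x) e. *)
Lemma cmap_exact (M N V : lmodType (ev B)) (g : {linear M -> N}) (f : {linear N -> V}) :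
  exact_at g f -> exact_at (cmap g) (cmap f).
Proof.
move=> gf n; split=> [/(congr1 (@cval V)) /= fn|[m <-]].
  have /gf [m mE] : f (cval n) = 0 by [].
  exists (cut m); apply: cval_inj.
  by rewrite cval_cmap cval_cut linZ mE cvalP.
apply: cval_inj; apply/gf; by exists (cval m).
Qed.

Lemma cmap_surj (M N : lmodType (ev B)) (g : {linear M -> N}) :
  (forall n, exists m, g m = n) -> forall n, exists m, cmap g m = n.
Proof.
move=> g_surj n; have [m mE] := g_surj (cval n).
by exists (cut m); apply: cval_inj; rewrite cval_cmap cval_cut linZ mE cvalP.
Qed.

Section EvReg.
Lemma cmod_evreg_mem (m : cmod (evreg B)) : (cval m : B) \in peirce_pred e e.
Proof.
have := cvalP m; rewrite evregE => E.
by rewrite inE -mulrA; apply/eqP; exact: E.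
Qed.
Definition to_corner (m : cmod (evreg B)) : evreg C := exist _ (cval m : B) (cmod_evreg_mem m) : C.
Fact to_corner_linear : linear to_corner.
Proof.
apply: ev_linear => [m n|c m|c m]; apply: val_inj => //=.
- rewrite [cval _]cval_lact evreg_lact.
  by have -> : val (lact c (to_corner m)) = val c * cval m by rewrite evreg_lact.
- rewrite [cval _]cval_ract evreg_ract.
  by have -> : val (ract (to_corner m) c) = (cval m : B) * val c by rewrite evreg_ract.
Qed.
HB.instance Definition _ := GRing.isLinear.Build (ev C) (cmod (evreg B)) (evreg C) _
  to_corner to_corner_linear.

Lemma of_corner_mem (c : C) : (val c : evreg B) \in @cmod_pred (evreg B).
Proof. by rewrite inE; apply/eqP; rewrite evregE corner_r corner_l. Qed.
Definition of_corner (c : evreg C) : cmod (evreg B) := exist _ (val (c : C) : evreg B) (of_corner_mem c).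
Fact of_corner_linear : linear of_corner.
Proof.
apply: cmod_linear => [//|c m|c m]; rewrite /cval /=.
- exact: (etrans (congr1 val (evreg_lact c m)) (esym (evreg_lact (val c) (val (m : C) : evreg B)))).
- exact: (etrans (congr1 val (evreg_ract c m)) (esym (evreg_ract (val c) (val (m : C) : evreg B)))).
Qed.
HB.instance Definition _ := GRing.isLinear.Build (ev C) (evreg C) (cmod (evreg B)) _
  of_corner of_corner_linear.

Lemma to_cornerK : cancel to_corner of_corner.
Proof. by move=> m; apply: val_inj. Qed.
End EvReg.
End CornerModule.

Section Adjunction.
Variables (K : comPzRingType) (B : kAlgType K) (e : idem B).
Local Notation C := (corner e).
Variable P : lmodType (ev C).

Definition indg (p : P) : ind P := indp (pe e) p (ep e).

Lemma indp_lact b x (p : P) y : lact b (indp x p y) = indp (plmul b x) p y.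
Proof.
apply: etrans (evactE (ind_bimodule P) _ _ _) _.
by rewrite (bim_ra1 (ind_bimodule P)) ind_lactE BePlE.
Qed.
Lemma indp_ract b x (p : P) y : ract (indp x p y) b = indp x p (prmul y b).
Proof.
apply: etrans (evactE (ind_bimodule P) _ _ _) _.
by rewrite (bim_la1 (ind_bimodule P)) ind_ractE.
Qed.

Lemma indp_indg x (p : P) y : indp x p y = evp (val x) (val y) *: indg p.
Proof.
rewrite evp_act indp_ract indp_lact; congr indp; apply: val_inj => /=.
  by rewrite peircer.
by rewrite peircel.
Qed.

Lemma bep_DD x : {morph (fun p : P => bep x p) : p q / p + q}.
Proof. by have [_ h _] := bep_balanced (e := e) P; move=> p q; apply: h. Qed.

Lemma indgD : {morph indg : p q / p + q}.
Proof.
move=> p q; rewrite /indg /indp bep_DD.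
by have [h _ _] := tpure_balanced (@BePr _ _ e P) (@Blact _ _ e); apply: h.
Qed.

Lemma indg_zero : indg 0 = 0.
Proof. by apply: (addrI (indg 0)); rewrite -indgD !addr0. Qed.

Lemma pmul_lact (c : C) (p : P) y :
  indp (pe e) (lact c p) y = indp (Bract (pe e) c) p y.
Proof.
by have [_ _ h] := bep_balanced (e := e) P; rewrite /indp h.
Qed.
Lemma pmul_ract (c : C) x (p : P) : indp x (ract p c) (ep e) = indp x p (Blact c (ep e)).
Proof.
have [_ _ h] := tpure_balanced (@BePr _ _ e P) (@Blact _ _ e).
by rewrite /indp -h BePrE.
Qed.

Lemma indg_lact (c : C) (p : P) : indg (lact c p) = lact (val c) (indg p).
Proof.
rewrite /indg pmul_lact indp_lact; congr indp; apply: val_inj => /=.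
by rewrite corner_l corner_r.
Qed.
Lemma indg_ract (c : C) (p : P) : indg (ract p c) = ract (indg p) (val c).
Proof.
rewrite /indg pmul_ract indp_ract; congr indp; apply: val_inj => /=.
by rewrite corner_r corner_l.
Qed.

Lemma indg_mem (p : P) : indg p \in @cmod_pred _ _ e (ind P).
Proof. by rewrite inE; apply/eqP; exact: (esym (indp_indg (pe e) p (ep e))). Qed.
Definition indc (p : P) : cmod e (ind P) := exist _ (indg p) (indg_mem p).
Fact indc_linear : linear indc.
Proof.
apply: cmod_linear => [|c p|c p]; first exact: indgD.
- exact: indg_lact.
- exact: indg_ract.
Qed.
HB.instance Definition _ := GRing.isLinear.Build (ev C) P (cmod e (ind P)) _ indc indc_linear.

Lemma ind_tens_ext (A : zmodType) (f g : ind P -> A) :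
  {morph f : s t / s + t} -> {morph g : s t / s + t} ->
  (forall x p y, f (indp x p y) = g (indp x p y)) -> f =1 g.
Proof.
move=> fD gD fg; apply: tens_ext => // t y; move: t.
have [h _ _] := tpure_balanced (@BePr _ _ e P) (@Blact _ _ e).
apply: tens_ext => [s t|s t|x p].
- by rewrite -fD -h.
- by rewrite -gD -h.
- exact: fg.
Qed.

Section Target.
Variable M : lmodType (ev B).

Lemma ind_ext (f g : {linear ind P -> M}) : (forall p, f (indg p) = g (indg p)) -> f =1 g.
Proof.
move=> fg; apply: ind_tens_ext => [||x p y]; [exact: linearD|exact: linearD|].
by rewrite indp_indg !linZ fg.
Qed.

(** The extension x (x) p (x) y |-> x h(p) y is built through the two nested tensor products: left
    linearity of h gives the inner balance over C, right linearity the outer one. With [ind_ext]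
    this is the adjunction. *)
Lemma ind_lift (h : {linear P -> cmod e M}) :
  exists F : {linear ind P -> M}, forall p, F (indg p) = cval (h p).
Proof.
have H := ev_bimodule M.
pose f1 (x : Bidem e) (p : P) : M := lact (val x) (cval (h p)).
have f1b : balanced (@Bract _ _ e) (@lact _ C P) f1.
  split=> [x x' p|x p p'|x c p]; rewrite /f1.
  - exact: (bim_laDl H).
  - by rewrite linearD cvalD (bim_laDr H).
  - by rewrite lact_linear cval_lact (bim_laA H).
pose F1 : BeP P -> M := tlift f1.
have F1D : {morph F1 : s t / s + t} by apply: tliftD.
have F1E x p : F1 (bep x p) = f1 x p by apply: tlift_pure.
have F1r t c : F1 (BePr t c) = ract (F1 t) (val (c : C)).
  move: t; apply: tens_ext => [s t|s t|x p].
  - by rewrite BePrD F1D.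
  - by rewrite F1D (bim_raDl H).
  - by rewrite BePrE !F1E /f1 ract_linear cval_ract (bim_lara H).
pose f2 (t : BeP P) (y : idemB e) : M := ract (F1 t) (val y).
have f2b : balanced (@BePr _ _ e P) (@Blact _ _ e) f2.
  split=> [t t' y|t y y'|t c y]; rewrite /f2.
  - by rewrite F1D (bim_raDl H).
  - exact: (bim_raDr H).
  - by rewrite F1r (bim_raA H).
pose F : ind P -> M := tlift f2.
have FD : {morph F : s t / s + t} by apply: tliftD.
have FE x p y : F (indp x p y) = ract (lact (val x) (cval (h p))) (val y).
  by apply: etrans (tlift_pure f2b _ _) _; rewrite /f2 F1E.
suff FL : linear F.
  exists (linear_pack FL) => p; rewrite /= FE /=.
  by rewrite cmod_e_l cmod_e_r.
apply: ev_linear => // b; apply: ind_tens_ext => [s t|s t|x p y].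
- by rewrite (bim_laDr (ev_bimodule _)) FD.
- by rewrite FD (bim_laDr H).
- by rewrite indp_lact !FE (bim_lara H) (bim_laA H).
- by rewrite (bim_raDl (ev_bimodule _)) FD.
- by rewrite FD (bim_raDl H).
- by rewrite indp_ract !FE (bim_raA H).
Qed.
End Target.

(** [ind] is left adjoint to e (-) e, which preserves surjections. *)
Lemma ind_projective : projective P -> projective (ind P).
Proof.
move=> prP M N g f g_surj.
have [h hE] := prP _ _ (cmap (e := e) g : {linear _ -> _}) (cmap (e := e) f \o indc)
  (cmap_surj (e := e) g_surj).
have [F FE] := ind_lift h; exists F.
apply: (ind_ext (f := g \o F)) => p /=.
by rewrite FE; have /(congr1 (@cval _ _ _ _)) := hE p.
Qed.
End Adjunction.

Section LeftContraction.
Variables (K : comPzRingType) (L : kAlgType K).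

(** Left linearity of t gives the balance over K and is inherited by the new map, so the
    construction iterates. The sign is the one needed for a contracting homotopy of [bar_d]. *)
Lemma barten_map_left (M N : lmodType (ev L)) (t : M -> N) :
  {morph t : x y / x + y} -> (forall x m, t (lact x m) = lact x (t m)) ->
  exists T : barten M -> barten N, [/\ {morph T : x y / x + y},
    forall x z, T (lact x z) = lact x (T z) &
    forall x m, T (bpure x m) = - bpure x (t m)].
Proof.
move=> tD tl.
have [x y m|x m n|x k m|T TD TE] := barten_lift (f := fun x m => - bpure x (t m)).
- by rewrite bpureDl opprD.
- by rewrite tD bpureDr opprD.
- by rewrite tl bpureK.
exists T; split=> // x; apply: barten_ext => [s u|s u|y m].
- by rewrite (bim_laDr (ev_bimodule _)) TD.
- by rewrite TD (bim_laDr (ev_bimodule _)).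
- by rewrite barten_lact !TE /lact scalerN [evp x 1 *: _]barten_lact.
Qed.

(* The homotopy z |-> (+-) z (x) 1 commutes with the left action. *)
Lemma bar_left_contraction : exists t : forall n, bar L n -> bar L n.+1,
  [/\ forall n, {morph t n : x y / x + y},
      forall n x z, t n (lact x z) = lact x (t n z),
      forall y, bar_d L 0 (t 0%N y) = y &
      forall n z, bar_d L n.+1 (t n.+1 z) = z - t n (bar_d L n z)].
Proof.
pose Q n (t : bar L n -> bar L n.+1) := {morph t : x y / x + y} /\
  (forall x z, t (lact x z) = lact x (t z)).
have ex (n : nat) (t : {t : bar L n -> bar L n.+1 | Q n t}) :
    {T : {T : bar L n.+1 -> bar L n.+2 | Q n.+1 T} |
      forall x m, sval T (bpure x m) = - bpure x (sval t m)}.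
  apply: cid; case: t => t [tD tl]; have [T [TD Tl TE]] := barten_map_left tD tl.
  by exists (exist _ T (conj TD Tl)).
have Q0 : Q 0%N (fun y : bar L 0 => bpure (y : L) (1 : bar L 0)).
  split=> [x y|x z]; first exact: bpureDl.
  by rewrite barten_lact evreg_lact.
pose F := fix F n : {t : bar L n -> bar L n.+1 | Q n t} :=
  if n is m.+1 return {t : bar L n -> bar L n.+1 | Q n t}
  then sval (ex m (F m)) else exist _ _ Q0.
pose t n := sval (F n).
have tD n : {morph t n : x y / x + y} by have [h _] := svalP (F n); apply: h.
have tl n x z : t n (lact x z) = lact x (t n z) by have [_ h] := svalP (F n); apply: h.
have tS n x m : t n.+1 (bpure x m) = - bpure x (t n m) by apply: (svalP (ex n (F n))).
have t0 y : bar_d L 0 (t 0%N y) = y.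
  apply: etrans (bar_d0E (y : L) (1 : bar L 0)) _.
  by rewrite evreg_lact; apply: mulr1.
have tN n z : t n (- z) = - t n z.
  have tz : t n 0 = 0 by apply: (addrI (t n 0)); rewrite -tD !addr0.
  by apply: (addrI (t n z)); rewrite -tD !subrr.
exists t; split=> // n z.
have E n' : {morph (fun z => z - t n' (bar_d L n' z)) : x y / x + y}.
  by move=> x y; rewrite linearD tD opprD addrACA.
have E' n' : {morph (fun z => bar_d L n'.+1 (t n'.+1 z)) : x y / x + y}.
  by move=> x y; rewrite tD linearD.
elim: n z => [|n IHn]; (apply: bar_tens_ext => [||x m]; [exact: E'|exact: E|]);
  rewrite tS linN bar_dSE opprB.
- by rewrite t0 bar_d0E tl.
- by rewrite IHn bpureDr bpureN bar_dSE tD tN tS opprK tl opprD addrA addrAC.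
Qed.
End LeftContraction.

(** * Functoriality and right exactness of the tensor product over a ring *)

Section RightTensor.
Variables (R : pzRingType) (N : lmodType R).

Definition rt (M : lmodType R^c) (m : M) (x : N) : rtens N M :=
  tpure (@rtact R M) (fun (c : R) (x : N) => c *: x) m x.

Lemma rt_Dl (M : lmodType R^c) (m m' : M) x : rt (m + m') x = rt m x + rt m' x.
Proof. by have [h _ _] := tpure_balanced (@rtact R M) (fun (c : R) (x : N) => c *: x); apply: h. Qed.
Lemma rt_Dr (M : lmodType R^c) (m : M) x x' : rt m (x + x') = rt m x + rt m x'.
Proof. by have [_ h _] := tpure_balanced (@rtact R M) (fun (c : R) (x : N) => c *: x); apply: h. Qed.
Lemma rt_bal (M : lmodType R^c) (m : M) c x : rt (rtact m c) x = rt m (c *: x).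
Proof. by have [_ _ h] := tpure_balanced (@rtact R M) (fun (c : R) (x : N) => c *: x); apply: h. Qed.

Lemma rtens_ext (M : lmodType R^c) (A : zmodType) (f g : rtens N M -> A) :
  {morph f : s t / s + t} -> {morph g : s t / s + t} ->
  (forall m x, f (rt m x) = g (rt m x)) -> f =1 g.
Proof. exact: tens_ext. Qed.

Lemma rtens_map_rt (M M' : lmodType R^c) (f : {linear M -> M'}) m x :
  rtens_map (N := N) f (rt m x) = rt (f m) x.
Proof. by apply: tmapE => // *; [exact: linearD|exact: linearZ]. Qed.

Lemma rtens_mapD (M M' : lmodType R^c) (f : {linear M -> M'}) :
  {morph rtens_map (N := N) f : s t / s + t}.
Proof. exact: raddfD. Qed.

Lemma rtens_map_comp (M M' M'' : lmodType R^c) (g : {linear M' -> M''})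
    (f : {linear M -> M'}) (h : {linear M -> M''}) : (forall x, g (f x) = h x) ->
  forall z, rtens_map (N := N) g (rtens_map (N := N) f z) = rtens_map (N := N) h z.
Proof.
move=> gf; apply: rtens_ext => [s t|s t|m x]; rewrite ?raddfD //.
by rewrite !rtens_map_rt gf.
Qed.

Lemma rtens_map_homotopic (M M' : lmodType R^c) (f g h : {linear M -> M'}) :
  (forall x, f x = g x + h x) ->
  forall z, rtens_map (N := N) f z = rtens_map (N := N) g z + rtens_map (N := N) h z.
Proof.
move=> fgh; apply: rtens_ext => [s t|s t|m x]; rewrite ?raddfD //.
  by rewrite addrACA.
by rewrite !rtens_map_rt fgh rt_Dl.
Qed.

Lemma rtens_map_idfun (M : lmodType R^c) z : rtens_map (N := N) (idfun : {linear M -> M}) z = z.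
Proof. by move: z; apply: rtens_ext => // [s t|m x]; rewrite ?raddfD // rtens_map_rt. Qed.

Section RightExact.
Variables (M1 M0 M : lmodType R^c) (d : {linear M1 -> M0}) (eps : {linear M0 -> M}).
Hypotheses (d_eps : exact_at d eps) (eps_surj : forall m, exists x, eps x = m).

(* An element killed by eps (x) N vanishes in the cokernel of d (x) N, which receives
   a balanced map from M x N. *)
Lemma rtens_right_exact z : rtens_map (N := N) eps z = 0 -> exists w, rtens_map (N := N) d w = z.
Proof.
(* The cokernel of d (x) N, encoded as homology with zero outgoing map. *)
pose Z := homology (rtens_map (N := N) d) (\0 : {additive rtens N M0 -> rtens N M0}).
have mem (t : rtens N M0) : t \in cyc_pred (\0 : {additive rtens N M0 -> rtens N M0}).
  by rewrite inE.
pose mk t : cyc (\0 : {additive rtens N M0 -> rtens N M0}) := exist _ t (mem t).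
pose cl (t : rtens N M0) : Z := \pi_Z (mk t).
have clD : {morph cl : s t / s + t}.
  by move=> s t; rewrite /cl -[RHS]Quotient.pi_add; congr (\pi_Z _); apply: val_inj.
have clP t : cl t = 0 <-> exists w, rtens_map (N := N) d w = t.
  have -> : 0 = cl 0 :> Z by apply: (addrI (cl 0)); rewrite -clD !addr0.
  have E : mk t - mk 0 = mk t.
    by apply: val_inj; apply: subr0.
  split=> [/eqP|[w wE]].
    by rewrite -Quotient.idealrBE E inE => -[w wE]; exists w.
  by apply/eqP; rewrite -Quotient.idealrBE E inE; exists w.
have lift m : {x | eps x = m} by apply: cid.
pose s m := sval (lift m).
have sE m : eps (s m) = m by apply: (svalP (lift m)).
(* The section [s] of eps is merely a map of sets; passing to the cokernel removes the ambiguity,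
   which makes [f] below balanced. *)
have key (x x' : M0) n : eps x = eps x' -> cl (rt x n) = cl (rt x' n).
  move=> xx'; have /d_eps [y yE] : eps (x - x') = 0 by rewrite linearB xx' subrr.
  have -> : x = d y + x' by rewrite yE subrK.
  rewrite rt_Dl clD (_ : cl (rt (d y) n) = 0) ?add0r //.
  by apply/clP; exists (rt y n); apply: rtens_map_rt.
pose f m n := cl (rt (s m) n).
have fb : balanced (@rtact R M) (fun (c : R) (x : N) => c *: x) f.
  split=> [m m' n|m n n'|m c n]; rewrite /f.
  - rewrite -clD -rt_Dl; apply: key.
    by rewrite linearD !sE.
  - by rewrite -clD -rt_Dr.
  - rewrite -rt_bal; apply: key.
    by rewrite sE /rtact linZ sE.
have fE t : tlift f (rtens_map (N := N) eps t) = cl t.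
  move: t; apply: rtens_ext => [u v|u v|m n]; rewrite ?raddfD.
  - exact: (tliftD fb).
  - exact: clD.
  - rewrite rtens_map_rt; apply: etrans (tlift_pure fb _ _) _.
    by apply: key; rewrite sE.
move=> z0; apply/clP; rewrite -fE z0.
exact: (tlift_zero fb).
Qed.
End RightExact.
End RightTensor.

(** * Projectivity of B e (x)_C P over C^op *)

Section Coinduction.
Variables (K : comPzRingType) (B : kAlgType K) (e : idem B).
Local Notation C := (corner e).
Local Notation Be := (Bidem e).

Section Rtact.
Variable W : lmodType C^c.
Lemma rtactA (m : W) (c d : C) : rtact (rtact m c) d = rtact m (c * d).
Proof. exact: scalerA. Qed.
Lemma rtactDr (m : W) (c d : C) : rtact m (c + d) = rtact m c + rtact m d.
Proof. exact: scalerDl. Qed.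
Lemma rtactDl (m n : W) (c : C) : rtact (m + n) c = rtact m c + rtact n c.
Proof. exact: scalerDr. Qed.
Lemma rtact1 (m : W) : rtact m 1 = m.
Proof. exact: scale1r. Qed.
End Rtact.

Definition kright (W : lmodType C^c) : Type := W.

Section KRight.
Variable W : lmodType C^c.
HB.instance Definition _ := GRing.Zmodule.on (kright W).
Definition kright_scale (k : K) (w : kright W) : kright W := rtact (w : W) (kin C k).
Fact kright_scaleA k l w : kright_scale k (kright_scale l w) = kright_scale (k * l) w.
Proof. by rewrite /kright_scale rtactA -rmorphM mulrC. Qed.
Fact kright_scale1 : left_id 1 kright_scale.
Proof. by move=> w; rewrite /kright_scale rmorph1 rtact1. Qed.
Fact kright_scaleDr : right_distributive kright_scale +%R.
Proof. by move=> k v w; apply: rtactDl. Qed.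
Fact kright_scaleDl w : {morph kright_scale^~ w : k l / k + l}.
Proof. by move=> k l; rewrite /kright_scale rmorphD rtactDr. Qed.
HB.instance Definition _ := GRing.Zmodule_isLmodule.Build K (kright W)
  kright_scaleA kright_scale1 kright_scaleDr kright_scaleDl.

Lemma kright_scaleE (k : K) (w : W) : k *: (w : kright W) = rtact w (kin C k) :> W.
Proof. by []. Qed.
End KRight.

Definition kBe : lmodType K := kright Be.

Lemma kBe_scale (k : K) (x : kBe) : val (k *: x : Be) = kin B k * val (x : Be).
Proof.
by apply: etrans (congr1 val (esym (pkin_left k (x : Be)))) _.
Qed.

Lemma kBe_projective : projective (kmod B) -> projective kBe.
Proof.
have iL : linear (fun x : kBe => val (x : Be) : kmod B).
  by move=> k x y; rewrite -[RHS]/(kin B k * val (x : Be) + val (y : Be)) -kBe_scale.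
have pL : linear (fun b : kmod B => plmul (b : B) (pe e) : kBe).
  move=> k x y; apply: val_inj; apply: etrans (mulrDl (kin B k * (x : B)) _ _) _.
  by congr (_ + _); rewrite -mulrA; apply/esym/kBe_scale.
apply: (projective_retract (i := linear_pack iL) (p := linear_pack pL)) => x.
by apply: val_inj; apply: peircer.
Qed.

Section Object.
Variable W : lmodType C^c.

Definition hmod_pred : {pred Be -> W} := [pred h | `[< linear (h : kBe -> kright W) >]].
Fact hmod_zmod_closed : zmod_closed hmod_pred.
Proof.
split=> [|f g]; rewrite !inE.
  by move=> k x y; rewrite [RHS]addr0 [RHS]scaler0.
move=> fL gL.
move=> k x y.
by apply: etrans (congr2 (fun u v => u - v) (fL k x y) (gL k x y)) _;
  rewrite scalerBr opprD addrACA.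
Qed.
HB.instance Definition _ := GRing.isZmodClosed.Build (Be -> W) hmod_pred hmod_zmod_closed.
Definition hmod_carrier : Type := {h : Be -> W | h \in hmod_pred}.
HB.instance Definition _ := SubType.copy hmod_carrier {h : Be -> W | h \in hmod_pred}.
HB.instance Definition _ := [Choice of hmod_carrier by <:].
HB.instance Definition _ := [SubChoice_isSubZmodule of hmod_carrier by <:].

Lemma hmodP (h : hmod_carrier) : linear (val h : kBe -> kright W).
Proof. by have := valP h; rewrite inE. Qed.
Definition hmod_mk (h : Be -> W) (hL : linear (h : kBe -> kright W)) : hmod_carrier :=
  exist _ h (introT (asboolP _) hL).

Lemma hmodD (h : hmod_carrier) x y : val h (x + y) = val h x + val h y.
Proof. by have := hmodP h 1 x y; rewrite !scale1r. Qed.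
Lemma hmodK (h : hmod_carrier) k x : val h (Bract x (kin C k)) = rtact (val h x) (kin C k).
Proof.
have h0 : val h 0 = 0 by apply: (addrI (val h 0)); rewrite -hmodD !addr0.
rewrite -[Bract x (kin C k)]addr0; apply: etrans (hmodP h k x 0) _.
by rewrite h0; apply: addr0.
Qed.

Fact hla_proof (c : C) (h : hmod_carrier) :
  linear (fun x : kBe => val h (Bract (x : Be) c) : kright W).
Proof.
move=> k x y.
have -> : Bract (k *: x + y : kBe) c = k *: (Bract (x : Be) c : kBe) + Bract (y : Be) c :> kBe.
  apply: val_inj; apply: etrans (mulrDl _ _ _) _; congr (_ + _).
  apply: etrans (congr1 (fun z => z * val c) (kBe_scale k x)) _.
  by rewrite -mulrA; apply/esym/(kBe_scale k (Bract x c : kBe)).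
exact: hmodP.
Qed.
Definition hla (c : C) (h : hmod_carrier) : hmod_carrier := hmod_mk (hla_proof c h).

Fact hra_proof (c : C) (h : hmod_carrier) :
  linear (fun x : kBe => rtact (val h (x : Be)) c : kright W).
Proof.
move=> k x y; rewrite (hmodP h) [LHS]rtactDl; congr (_ + _).
by rewrite ![k *: _]kright_scaleE !rtactA kinC.
Qed.
Definition hra (h : hmod_carrier) (c : C) : hmod_carrier := hmod_mk (hra_proof c h).

Fact hmod_bimodule : bimodule hla hra.
Proof.
split=> *; apply: val_inj; apply/funext => x /=.
- by rewrite /Bract pmulDr hmodD.
- by [].
- exact: rtactDl.
- exact: rtactDr.
- by rewrite /Bract pmul1r.
- exact: scale1r.
- by rewrite /Bract pmulA.
- exact: rtactA.
- by [].
- exact: hmodK.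
Qed.

(* Hom_K (B e, W), with C acting on the left through B e and on the right through W *)
Definition hmod : lmodType (ev C) := evmod hmod_bimodule.
Definition happ (h : hmod) (x : Be) : W := val (h : hmod_carrier) x.

Lemma happ_lact c (h : hmod) x : happ (lact c h) x = happ h (Bract x c).
Proof.
apply: etrans (congr1 (fun g => happ g x) (evactE hmod_bimodule _ _ _)) _.
by rewrite (bim_ra1 hmod_bimodule).
Qed.
Lemma happ_ract c (h : hmod) x : happ (ract h c) x = rtact (happ h x) c.
Proof.
apply: etrans (congr1 (fun g => happ g x) (evactE hmod_bimodule _ _ _)) _.
by rewrite (bim_la1 hmod_bimodule).
Qed.
Lemma hmod_eq (h g : hmod) : happ h =1 happ g -> h = g.
Proof. by move=> hg; apply: val_inj; apply/funext. Qed.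
End Object.

Section RightModule.
Variable P : lmodType (ev C).

Definition BeP_scale (c : C^c) (t : BeP P) : BeP P := BePr t (c : C).
Fact BeP_scaleA c d t : BeP_scale c (BeP_scale d t) = BeP_scale (c * d) t.
Proof.
have H := ev_bimodule P.
rewrite /BeP_scale; move: t; apply: tens_ext => [s t|s t|x p]; rewrite ?BePrD //.
by rewrite !BePrE (bim_raA H).
Qed.
Fact BeP_scale1 : left_id 1 BeP_scale.
Proof.
have H := ev_bimodule P.
apply: tens_ext => // [s t|x p]; first exact: BePrD.
by apply: etrans (BePrE _ _ _) _; rewrite (bim_ra1 H).
Qed.
Fact BeP_scaleDr : right_distributive BeP_scale +%R.
Proof. by move=> c s t; apply: BePrD. Qed.
Fact BeP_scaleDl t : {morph BeP_scale^~ t : c d / c + d}.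
Proof.
have H := ev_bimodule P; have [_ hr _] := bep_balanced (e := e) P.
move=> c d; rewrite /BeP_scale; move: t; apply: tens_ext => [s t|s t|x p].
- exact: BePrD.
- by rewrite !BePrD addrACA.
- by rewrite !BePrE (bim_raDr H) hr.
Qed.
HB.instance Definition _ := GRing.Zmodule_isLmodule.Build C^c (BeP P)
  BeP_scaleA BeP_scale1 BeP_scaleDr BeP_scaleDl.

Lemma BeP_ext (A : zmodType) (f g : BeP P -> A) :
  {morph f : s t / s + t} -> {morph g : s t / s + t} ->
  (forall x p, f (bep x p) = g (bep x p)) -> f =1 g.
Proof. exact: tens_ext. Qed.

(** Maps of right C-modules from B e (x)_C P to W are C^ev-maps from P to Hom_K(B e, W). The functor
    Hom_K(B e, -) preserves surjections as B e is K-projective, and P is projective over C^ev. *)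
Lemma BeP_projective : projective (kmod B) -> projective P -> projective (BeP P : lmodType C^c).
Proof.
move=> prB prP V W p f p_surj.
have [bl br bb] := bep_balanced (e := e) P.
have H := ev_bimodule P.
have fr t c : f (BePr t c) = rtact (f t) c by apply: linZ.
have hL q : linear (fun x : kBe => f (bep (x : Be) q) : kright W).
  move=> k x y; apply: etrans (congr1 f (bl _ _ _)) _; apply: etrans (linearD f _ _) _.
  congr (_ + _); apply: etrans _ (esym (kright_scaleE k (f (bep x q) : kright W))).
  by rewrite -fr BePrE -(bim_kin H) -bb.
pose h q : hmod W := hmod_mk (hL q).
have hlin : linear h.
  apply: ev_linear => [q q'|c q|c q]; apply: hmod_eq => x.
  - by rewrite /happ /= br linearD.
  - by rewrite happ_lact /happ /= -bb.
  - by rewrite happ_ract /happ /= -BePrE fr.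
have postL (g : hmod V) : linear (fun x : kBe => p (happ g (x : Be)) : kright W).
  move=> k x y; rewrite /happ (hmodP g) linearD; congr (_ + _).
  exact: (linZ p (kin C k : C^c) (happ g x)).
pose post (g : hmod V) : hmod W := hmod_mk (postL g).
have post_lin : linear post.
  apply: ev_linear => [g g'|c g|c g]; apply: hmod_eq => x.
  - by apply: etrans (linearD p (happ g x) (happ g' x)) _.
  - by rewrite happ_lact /happ /= happ_lact.
  - by rewrite happ_ract /happ /= happ_ract; apply: linZ.
have pkL : linear (p : kright V -> kright W).
  move=> k x y; rewrite linearD; congr (_ + _).
  exact: (linZ p (kin C k : C^c) (x : V)).
(* The side goal is surjectivity of composition with p on Hom_K(B e, -), the place where
   K-projectivity of B e enters. *)
have [g|h' h'E] := prP _ _ (linear_pack post_lin) (linear_pack hlin).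
  have [g' g'E] := (kBe_projective prB : projective kBe) _ _ (linear_pack pkL) (linear_pack (hmodP g)) p_surj.
  have g'L : linear (g' : kBe -> kright V) by move=> k x y; rewrite linearP.
  by exists (hmod_mk g'L); apply: hmod_eq => x; apply: g'E.
pose F1 (x : Be) (q : P) : V := happ (h' q) x.
have F1b : balanced (@Bract _ _ e) (@lact _ C P) F1.
  split=> [x x' q|x q q'|x c q]; rewrite /F1.
  - exact: hmodD.
  - by rewrite linearD.
  - by rewrite lact_linear happ_lact.
pose F : BeP P -> V := tlift F1.
have FD : {morph F : s t / s + t} by apply: tliftD.
have FE x q : F (bep x q) = happ (h' q) x by apply: tlift_pure.
have FL : linear F.
  move=> c s t; rewrite FD; congr (_ + _); rewrite -[LHS]/(F (BePr s c)).
  move: s; apply: BeP_ext => [s u|s u|x q].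
  - by rewrite BePrD FD.
  - by rewrite FD scalerDr.
  - by rewrite BePrE !FE ract_linear happ_ract.
exists (linear_pack FL); apply: BeP_ext => [s u|s u|x q]; rewrite ?linearD //.
rewrite /= FE; have /(congr1 (fun g => happ g x)) := h'E q.
exact.
Qed.
End RightModule.
End Coinduction.

Section CornerProjective.
Variables (K : comPzRingType) (B : kAlgType K) (e : idem B).

Lemma corner_projective : projective (kmod B) -> projective (kmod (corner e)).
Proof.
have iL : linear (fun x : kmod (corner e) => val (x : corner e) : kmod B).
  move=> k x y; apply: etrans (_ : _ = val (kin (corner e) k * (x : corner e)) + val (y : corner e)) _; first by [].
  congr (_ + _); rewrite /= -mulrA; congr (_ * _); exact: peircel.
have pmem (b : B) : (e : B) * b * (e : B) \in peirce_pred e e.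
  by apply: peirce_mem; rewrite ?mulrA ?idvK // -!mulrA idvK.
pose p (b : B) : corner e := exist _ ((e : B) * b * (e : B)) (pmem b).
have pL : linear (fun b : kmod B => p b : kmod (corner e)).
  move=> k x y; apply: val_inj => /=.
  rewrite mulrDr mulrDl; congr (_ + _).
  rewrite -[k *: x]/(kin B k * (x : B)) /= mulrA -kinC -!mulrA; congr (_ * _).
  by rewrite !mulrA idvK.
apply: (projective_retract (i := linear_pack iL) (p := linear_pack pL)) => x.
by apply: val_inj; apply: peirceP.
Qed.
End CornerProjective.

(** * Resolving B e (x)_C e B *)

Section BeResolution.
Variables (K : comPzRingType) (B : kAlgType K) (e : idem B).
Local Notation C := (corner e).
Local Notation Be := (Bidem e).

Section Functor.
Variables (P Q : lmodType (ev C)) (f : {linear P -> Q}).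
Fact BeP_map_linear : linear (BeP_map f : (BeP P : lmodType C^c) -> BeP Q).
Proof.
move=> c s t; rewrite BeP_mapD; congr (_ + _).
exact: (BeP_map_r f s (c : C)).
Qed.
Definition BeP_hom : {linear (BeP P : lmodType C^c) -> (BeP Q : lmodType C^c)} :=
  linear_pack BeP_map_linear.
End Functor.

Fact BeP_aug_linear (P : lmodType (ev C)) (f : {linear P -> evreg C}) :
  linear (BeP_aug f : (BeP P : lmodType C^c) -> Be).
Proof.
move=> c s t; rewrite BeP_augD; congr (_ + _).
exact: (BeP_aug_r f s (c : C)).
Qed.
Definition BeP_aug_hom (P : lmodType (ev C)) (f : {linear P -> evreg C}) :
  {linear (BeP P : lmodType C^c) -> (Be : lmodType C^c)} := linear_pack (BeP_aug_linear f).

Definition BeP_chain (R : chain (ev C)) : chain C^c :=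
  @Chain C^c (fun n => BeP (R n) : lmodType C^c) (fun n => BeP_hom (ch_d R n)).

Lemma BeP_map_ext (P Q : lmodType (ev C)) (t : P -> Q) :
  {morph t : x y / x + y} -> (forall x z, t (lact x z) = lact x (t z)) ->
  exists T : BeP (e := e) P -> BeP Q, {morph T : x y / x + y} /\
    forall x p, T (bep x p) = bep x (t p).
Proof.
move=> tD tl; exists (tmap _ _ id t); split; first exact: tmapD.
by move=> x p; apply: tmapE.
Qed.

Lemma BeP_bar_resolution : projective (kmod B) ->
  proj_resolution (BeP_aug_hom (bar_aug C) : {linear BeP_chain (bar_chain C) 0 -> Be}).
Proof.
move=> prB; have prC := corner_projective (e := e) prB.
have [t [tD tl t0 tS]] := bar_left_contraction C.
have exT n := cid (BeP_map_ext (tD n) (tl n)).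
pose T n : BeP (e := e) (bar C n) -> BeP (bar C n.+1) := sval (exT n).
have TD n : {morph T n : x y / x + y} by have [h _] := svalP (exT n); apply: h.
have TE n x p : T n (bep x p) = bep x (t n p) by have [_ h] := svalP (exT n); apply: h.
pose D n : BeP (e := e) (bar C n.+1) -> BeP (bar C n) := BeP_map (bar_d C n).
have DD n : {morph D n : x y / x + y} by apply: BeP_mapD.
have DE n x p : D n (bep x p) = bep x (bar_d C n p) by apply: BeP_mapE.
have brD (M : lmodType (ev C)) x : {morph (fun p : M => bep (e := e) (P := M) x p) : p q / p + q}.
  by move=> p q; have [_ h _] := bep_balanced (e := e) M; apply: h.
have brN (M : lmodType (ev C)) x p : bep (e := e) (P := M) x (- p) = - bep x p.
  have b0 : bep (e := e) (P := M) x 0 = 0 by apply: (addrI (bep x 0)); rewrite -brD !addr0.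
  by apply: (addrI (bep x p)); rewrite -brD !subrr.
have DT n z : D n.+1 (T n.+1 z) = z - T n (D n z).
  move: z; apply: BeP_ext => [x y|x y|x p].
  - by rewrite TD DD.
  - by rewrite DD TD opprD addrACA.
  - by rewrite TE DE tS DE TE brD brN.
have D0 n z : D n (D n.+1 z) = 0.
  move: z; apply: BeP_ext => [x y|x y|x p]; rewrite ?DD ?addr0 //.
  by rewrite !DE bar_dd; apply: (addrI (bep x 0)); rewrite -brD !addr0.
have T0 n : T n 0 = 0 by apply: (addrI (T n 0)); rewrite -TD !addr0.
have ex n : exact_at (R := C^c) (BeP_hom (bar_d C n.+2)) (BeP_hom (bar_d C n.+1)).
  move=> z; split=> [dz|[y <-]]; last exact: D0.
  exists (T n.+2 z); apply: etrans (DT n.+1 z) _.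
  have -> : D n.+1 z = 0 by exact: dz.
  by rewrite T0 subr0.
split=> [n|x||n].
- have prn : projective (bar C n.+1) by apply: bar_projective.
  have h := BeP_projective prB prn.
  exact: h.
- exists (bep x (bpure 1 (1 : bar C 0))); apply: etrans (BeP_augE _ _ _) _.
  rewrite (_ : bar_aug C _ = (1 : C)); last exact: (bar_contract0 (1 : bar C 0)).
  exact: pmul1r.
- move=> z; split=> [az|[y <-]].
    (* Since B e (x)_C C is B e, the map [D 0] is the augmentation followed by tensoring with 1. An
       element killed by the augmentation is thus killed by [D 0], and the contraction applies. *)
    have aug0 u : D 0%N u = bep (P := bar C 0) (BeP_aug (bar_aug C) u) (1 : C).
      move: u; apply: BeP_ext => [x y|x y|x p]; first exact: DD.
        by rewrite BeP_augD; have [h _ _] := bep_balanced (e := e) (bar C 0); apply: h.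
      rewrite DE BeP_augE; have [_ _ h] := bep_balanced (e := e) (bar C 0).
      by rewrite h evreg_lact mulr1.
    exists (T 1%N z); apply: etrans (DT 0%N z) _.
    rewrite aug0 (_ : BeP_aug _ z = 0); last exact: az.
    have -> : bep (P := bar C 0) 0 (1 : C) = 0.
      have [h _ _] := bep_balanced (e := e) (bar C 0).
      by apply: (addrI (bep (P := bar C 0) 0 (1 : C))); rewrite -h !addr0.
    by rewrite T0 subr0.
  have A0 : {morph (fun u => BeP_aug (e := e) (bar_aug C) (D 1%N u)) : x y / x + y}.
    by move=> x y' ; rewrite DD BeP_augD.
  move: y; apply: BeP_ext => [||x p]; [exact: A0|by move=> x y'; rewrite addr0|].
  change (BeP_aug (bar_aug C) (D 1%N (bep x p)) = 0).
  rewrite DE; apply: etrans (BeP_augE _ _ _) _.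
  rewrite (_ : bar_aug C _ = 0); last exact: (@bar_dd K C 0 p).
  by apply: val_inj; apply: mulr0.
- exact: ex.
Qed.
End BeResolution.

Lemma homology_eq0 (W U V : zmodType) (g : {additive W -> U}) (f : {additive U -> V})
    (c : cyc f) : \pi_(homology g f) c = 0 -> exists w, g w = val c.
Proof.
have -> : 0 = \pi_(homology g f) 0.
  have E : \pi_(homology g f) 0 + \pi_(homology g f) 0 = \pi_(homology g f) 0.
    by rewrite -[LHS]Quotient.pi_add addr0.
  by apply: (addrI (\pi_(homology g f) 0)); rewrite E addr0.
move/eqP; rewrite -Quotient.idealrBE subr0 inE => -[w wE].
by exists w.
Qed.

(* Any two projective resolutions being homotopy equivalent, one of them may be used
   to compute the vanishing of Tor for the other. *)
Lemma rtens_exact_transfer (R : pzRingType) (N : lmodType R) (Z Q : chain R^c)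
    (M : lmodType R^c) (zeta : {linear Z 0 -> M}) (q : {linear Q 0 -> M}) :
  proj_resolution zeta -> proj_resolution q ->
  (forall n (z : rtens N (Q n.+1)), rtens_map (ch_d Q n) z = 0 ->
    exists w, rtens_map (ch_d Q n.+1) w = z) ->
  forall n (z : rtens N (Z n.+1)), rtens_map (ch_d Z n) z = 0 ->
    exists w, rtens_map (ch_d Z n.+1) w = z.
Proof.
move=> Z_res Q_res Q_exact n z dz.
have [Z_proj Z_surj Z_aug Z_ex] := Z_res; have [Q_proj Q_surj Q_aug Q_ex] := Q_res.
have [|x|phi [phi0 phid]] := lift_chain_map (u := zeta) Z_proj (resolution_complex Z_res) Q_aug Q_ex.
- by move=> y; apply: Q_surj.
- exact: (resolution_aug Z_res).
have [|x|psi [psi0 psid]] := lift_chain_map (u := q) Q_proj (resolution_complex Q_res) Z_aug Z_ex.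
- by move=> y; apply: Z_surj.
- exact: (resolution_aug Q_res).
have [x|m x|m x|s [_ sS]] := chain_homotopy Z_proj (resolution_complex Z_res) Z_aug Z_ex
  (phi := fun m => idfun : {linear Z m -> Z m}) (psi := fun m => psi m \o phi m).
- exact: (etrans (esym (phi0 x)) (esym (psi0 (phi 0%N x)))).
- by [].
- exact: (etrans (psid m (phi m.+1 x)) (congr1 (psi m) (phid m x))).
have [w wE] : exists w, rtens_map (ch_d Q n.+1) w = rtens_map (N := N) (phi n.+1) z.
  apply: Q_exact.
  rewrite (rtens_map_comp (h := phi n \o ch_d Z n)); last exact: phid.
  rewrite -(rtens_map_comp (g := phi n) (f := ch_d Z n)) // dz; exact: raddf0.
pose hs : {linear Z n.+1 -> Z n.+1} := (ch_d Z n.+1 \o s n.+1) \+ (s n \o ch_d Z n).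
(* On homology, z = psi (phi z) + d (s z) + s (d z), where d z = 0 and phi z = d w. *)
exists (rtens_map (N := N) (psi n.+2) w + rtens_map (N := N) (s n.+1) z).
rewrite rtens_mapD -[RHS](rtens_map_idfun z).
rewrite (rtens_map_homotopic (N := N) (g := psi n.+1 \o phi n.+1) (h := hs)) ?/hs //.
congr (_ + _).
- rewrite -(rtens_map_comp (g := psi n.+1) (f := phi n.+1)) // -wE.
  apply: etrans (rtens_map_comp (N := N) (h := psi n.+1 \o ch_d Q n.+1) (psid n.+1) w) _.
  by rewrite -(rtens_map_comp (g := psi n.+1) (f := ch_d Q n.+1)).
- rewrite (rtens_map_homotopic (N := N) (g := ch_d Z n.+1 \o s n.+1) (h := s n \o ch_d Z n)) //.
  rewrite -(rtens_map_comp (g := s n) (f := ch_d Z n) (h := s n \o ch_d Z n)) // dz raddf0 addr0.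
  by rewrite -(rtens_map_comp (g := ch_d Z n.+1) (f := s n.+1)).
Qed.

Section InductionExact.
Variables (K : comPzRingType) (B : kAlgType K) (e : idem B).
Local Notation C := (corner e).

Section Functoriality.
Variables P Q S : lmodType (ev C).

Lemma ind_map_comp (g : {linear Q -> S}) (f : {linear P -> Q}) (h : {linear P -> S}) :
  (forall x, g (f x) = h x) -> forall z : ind P, ind_map g (ind_map f z) = ind_map h z.
Proof.
move=> gf; apply: (ind_ext (f := ind_map g \o ind_map f)) => p.
by rewrite /= /indg !ind_mapE gf.
Qed.

Lemma ind_map_add (f g h : {linear P -> Q}) :
  (forall x, f x = g x + h x) -> forall z : ind P, ind_map f z = ind_map g z + ind_map h z.
Proof.
move=> fgh.
have L : linear (fun z : ind P => ind_map g z + ind_map h z).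
  by move=> a x y; rewrite !linearP scalerDr addrACA.
apply: (ind_ext (g := linear_pack L)) => p.
rewrite /= /indg !ind_mapE fgh; exact: (@indgD K B e Q (g p) (h p)).
Qed.

Lemma ind_map_id z : ind_map (idfun : {linear P -> P}) z = z.
Proof. by apply: (ind_ext (g := idfun)) => p; rewrite /= /indg ind_mapE. Qed.

Lemma ind_map_zero (f : {linear P -> Q}) : (forall x, f x = 0) ->
  forall z : ind P, ind_map f z = 0.
Proof.
move=> f0; apply: (ind_ext (g := \0)) => p.
by rewrite /= /indg ind_mapE f0; apply: (@indg_zero K B e Q).
Qed.

Lemma ind_aug_comp (g : {linear Q -> evreg C}) (f : {linear P -> Q})
    (h : {linear P -> evreg C}) :
  (forall x, g (f x) = h x) -> forall z : ind P, ind_aug g (ind_map f z) = ind_aug h z.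
Proof.
move=> gf; apply: (ind_ext (f := ind_aug g \o ind_map f)) => p.
by rewrite /= /indg ind_mapE !ind_augE gf.
Qed.

Lemma ind_aug_surj (g : {linear P -> evreg C}) : (forall c, exists p, g p = c) ->
  forall z : BeB e, exists t : ind P, ind_aug g t = z.
Proof.
move=> g_surj; have [p pE] := g_surj (1 : C).
apply: tens_ind => [|x y z [t tE]]; first by exists 0; apply: linear0.
exists (indp x p y + t); apply: etrans (ind_augD g _ _) _.
congr (_ + _); last exact: tE.
apply: etrans (ind_augE _ _ _ _) _; rewrite pE; congr tpure.
exact: pmul1r.
Qed.
End Functoriality.

Section FromRtens.
Variable R : chain (ev C).
Local Notation Z := (BeP_chain (e := e) R).

(** [ind] is by construction the tensor product over C of [BeP] with e B, and [ind_map] is the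
    corresponding [rtens_map]; the two sides agree by conversion. *)
Lemma ind_exact_of_rtens :
  (forall n (z : rtens (idemB e) (Z n.+1)), rtens_map (ch_d Z n) z = 0 ->
    exists w, rtens_map (ch_d Z n.+1) w = z) ->
  forall n (z : ind (R n.+1)), ind_map (ch_d R n) z = 0 ->
    exists w, ind_map (ch_d R n.+1) w = z.
Proof. by move=> H n z dz; have [w wE] := H n z dz; exists w. Qed.

Lemma ind_aug_exact_of_rtens (r : {linear R 0%N -> evreg C}) :
  exact_at (ch_d Z 0%N) (BeP_aug_hom (e := e) r) ->
  (forall x, exists y, BeP_aug_hom (e := e) r y = x) ->
  forall z : ind (R 0%N), ind_aug r z = 0 -> exists w, ind_map (ch_d R 0%N) w = z.
Proof.
move=> ex surj z az.
by have [w wE] := rtens_right_exact (N := idemB e) ex surj (z := z) az; exists w.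
Qed.
End FromRtens.

Section Bar.
Variables (Q : chain C^c) (q : {linear Q 0 -> Bidem e}).
Hypothesis Q_res : proj_resolution q.
Hypothesis Tor0 : forall i, (0 < i)%N -> forall x : Tor Q (idemB e) i, x = 0.

Lemma Tor_exact n (z : rtens (idemB e) (Q n.+1)) : rtens_map (ch_d Q n) z = 0 ->
  exists w, rtens_map (ch_d Q n.+1) w = z.
Proof.
move=> dz; have mem : z \in cyc_pred (Tor_dout Q (idemB e) n.+1) by rewrite inE /= dz.
have [w wE] := homology_eq0 (Tor0 (ltn0Sn n) (\pi_(homology _ _) (exist _ z mem))).
by exists w.
Qed.

Lemma ind_aug_zero (P : lmodType (ev C)) (f : {linear P -> evreg C}) :
  (forall x, f x = 0) -> forall z : ind P, ind_aug f z = 0.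
Proof.
move=> f0; apply: (ind_ext (g := \0)) => p.
apply: etrans (ind_augE f (pe e) p (ep e)) _; rewrite f0.
have -> : Bract (pe e) (0 : C) = 0 by apply: val_inj; apply: mulr0.
have [h _ _] := tpure_balanced (@Bract _ _ e) (@Blact _ _ e).
by apply: (addrI (tpure (@Bract _ _ e) (@Blact _ _ e) 0 (ep e))); rewrite -h !addr0.
Qed.

Variables (Rb : chain (ev C)) (rb : {linear Rb 0 -> evreg C}).
Hypothesis Rb_res : proj_resolution rb.
Hypothesis Z_res : proj_resolution
  (BeP_aug_hom rb : {linear BeP_chain (e := e) Rb 0 -> (Bidem e : lmodType C^c)}).

Lemma ind_Rb_exact n : exact_at (ind_map (e := e) (ch_d Rb n.+1)) (ind_map (ch_d Rb n)).
Proof.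
move=> z; split=> [|[y <-]]; last first.
  rewrite (ind_map_comp (h := \0)); first exact: ind_map_zero.
  exact: (resolution_complex Rb_res).
exact: (ind_exact_of_rtens (rtens_exact_transfer Z_res Q_res Tor_exact)).
Qed.

Lemma ind_Rb_aug_exact : exact_at (ind_map (e := e) (ch_d Rb 0%N)) (ind_aug rb).
Proof.
have [_ Z_surj Z_aug _] := Z_res.
move=> z; split=> [az|[y <-]]; last first.
  rewrite (ind_aug_comp (h := \0)); first exact: ind_aug_zero.
  exact: (resolution_aug Rb_res).
exact: (ind_aug_exact_of_rtens Z_aug Z_surj az).
Qed.

Section Transfer.
Variables (R : chain (ev C)) (r : {linear R 0 -> evreg C}).
Hypothesis R_res : proj_resolution r.

(** R and [Rb] are homotopy equivalent over C^ev, and [ind] is additive, so it carries homotopies to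
    homotopies. Exactness passes from [Rb] to R, while projectivity of the terms comes from
    [ind_projective]. *)
Lemma ind_resolution_from : proj_resolution (R := ev B) (P := Chain (fun n => ind_map (e := e) (ch_d R n)))
  (ind_aug r).
Proof.
have b_res := Rb_res; have [b_proj b_surj b_aug b_ex] := b_res.
have [R_proj R_surj R_aug R_ex] := R_res.
have [phi [phi0 phid]] := @Ext_comparison K (ev C) R Rb _ _ r rb idfun R_res b_res.
have [psi [psi0 psid]] := @Ext_comparison K (ev C) Rb R _ _ rb r idfun b_res R_res.
have [x|m x|m x|s [s0 sS]] := chain_homotopy R_proj (resolution_complex R_res) R_aug R_ex
  (phi := fun m => idfun : {linear R m -> R m}) (psi := fun m => psi m \o phi m).
- exact: (etrans (esym (phi0 x)) (esym (psi0 (phi 0%N x)))).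
- by [].
- exact: (etrans (psid m (phi m.+1 x)) (congr1 (psi m) (phid m x))).
split=> [n|y|z|n z].
- exact: ind_projective.
- exact: (ind_aug_surj R_surj).
- split=> [az|[y <-]]; last first.
    change (ind_aug r (ind_map (ch_d R 0%N) y) = 0).
    rewrite (ind_aug_comp (h := \0)); first exact: ind_aug_zero.
    exact: (resolution_aug R_res).
  have /ind_Rb_aug_exact [w wE] : ind_aug rb (ind_map (phi 0%N) z) = 0.
    exact: (etrans (ind_aug_comp (g := rb) (f := phi 0%N) (h := r) phi0 z) az).
  exists (ind_map (psi 1%N) w + ind_map (s 0%N) z).
  change (ind_map (ch_d R 0%N) (ind_map (psi 1%N) w + ind_map (s 0%N) z) = z).
  rewrite linearD -[RHS](ind_map_id z).
  rewrite (ind_map_add (h := ch_d R 0%N \o s 0%N) s0).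
  congr (_ + _); last exact: ind_map_comp.
  rewrite -(ind_map_comp (g := psi 0%N) (f := phi 0%N)) // -wE.
  apply: etrans (ind_map_comp (h := psi 0%N \o ch_d Rb 0%N) (psid 0%N) w) _.
  by rewrite -(ind_map_comp (g := psi 0%N) (f := ch_d Rb 0%N)).
- split=> [dz|[y <-]]; last first.
    change (ind_map (ch_d R n) (ind_map (ch_d R n.+1) y) = 0).
    rewrite (ind_map_comp (h := \0)); first exact: ind_map_zero.
    exact: (resolution_complex R_res).
  have /ind_Rb_exact [w wE] : ind_map (ch_d Rb n) (ind_map (phi n.+1) z) = 0.
    apply: etrans (ind_map_comp (h := phi n \o ch_d R n) (phid n) z) _.
    rewrite -(ind_map_comp (g := phi n) (f := ch_d R n)) //.
    by rewrite (_ : ind_map _ z = 0); [exact: linear0|exact: dz].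
  pose hs : {linear R n.+1 -> R n.+1} := (ch_d R n.+1 \o s n.+1) \+ (s n \o ch_d R n).
  exists (ind_map (psi n.+2) w + ind_map (s n.+1) z).
  change (ind_map (ch_d R n.+1) (ind_map (psi n.+2) w + ind_map (s n.+1) z) = z).
  rewrite linearD -[RHS](ind_map_id z).
  rewrite (ind_map_add (h := hs) (sS n)) /hs.
  congr (_ + _).
    rewrite -(ind_map_comp (g := psi n.+1) (f := phi n.+1)) // -wE.
    apply: etrans (ind_map_comp (h := psi n.+1 \o ch_d Rb n.+1) (psid n.+1) w) _.
    by rewrite -(ind_map_comp (g := psi n.+1) (f := ch_d Rb n.+1)).
  rewrite (ind_map_add (g := ch_d R n.+1 \o s n.+1) (h := s n \o ch_d R n)) //.
  rewrite -(ind_map_comp (g := s n) (f := ch_d R n) (h := s n \o ch_d R n)) //.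
  rewrite (_ : ind_map (ch_d R n) z = 0); last exact: dz.
  rewrite linear0 addr0.
  by rewrite -(ind_map_comp (g := ch_d R n.+1) (f := s n.+1)).
Qed.
End Transfer.
End Bar.

Lemma ind_resolution (Q : chain C^c) (q : {linear Q 0 -> Bidem e})
    (R : chain (ev C)) (r : {linear R 0 -> evreg C}) :
  projective (kmod B) -> proj_resolution q ->
  (forall i, (0 < i)%N -> forall x : Tor Q (idemB e) i, x = 0) ->
  proj_resolution r ->
  proj_resolution (R := ev B) (P := Chain (fun n => ind_map (e := e) (ch_d R n))) (ind_aug r).
Proof.
move=> prB Q_res Tor0 R_res.
exact: (ind_resolution_from Q_res Tor0 (bar_resolution (corner_projective (e := e) prB))
  (BeP_bar_resolution e prB) R_res).
Qed.

End InductionExact.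

Section AdjointHom.
Variables (K : comPzRingType) (B : kAlgType K) (e : idem B) (P : lmodType (ev (corner e))).

Definition adj (f : {linear ind P -> evreg B}) : {linear P -> evreg (corner e)} :=
  @to_corner K B e \o cmap f \o @indc K B e P.

Lemma adj_lift (h : {linear P -> evreg (corner e)}) :
  exists f : {linear ind P -> evreg B}, forall p, f (indg p) = val (h p : corner e).
Proof. by have [f fE] := ind_lift (@of_corner K B e \o h); exists f. Qed.

Lemma corner_kin_scale k (c : evreg (corner e)) :
  val (lact (kin (corner e) k) c : corner e) = kin B k * val (c : corner e).
Proof.
apply: etrans (congr1 val (evreg_lact (kin (corner e) k) c)) _.
by rewrite /= -mulrA; congr (_ * _); apply: peircel.
Qed.
End AdjointHom.

(** * Complementary idempotents *)

Section Complementary.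
Variables (K : comPzRingType) (B : kAlgType K) (e : idem B).
Local Notation e' := (idemC e).
Local Notation C := (corner e).
Local Notation C' := (corner e').

Lemma Omega_short_exact : short_exact (@Omega_incl K B e) (@BeBsum_mul K B e).
Proof.
split=> [|y|z]; first exact: val_inj.
  split=> [y0|[x <-]]; last by have /eqP := valP x.
  have mem : y \in @Omega_pred _ _ e by rewrite inE; apply/eqP.
  by exists (exist _ y mem).
(* The preimage of z is the pair (z e (x) e, z e' (x) e'). *)
pose g (f : idem B) : BeB f := tpure (@Bract _ _ f) (@Blact _ _ f) (plmul (z : B) (pe f)) (ep f).
exists (g e, g e'); rewrite /BeBsum_mul /=.
have gE f : BeB_mul (g f) = z * (f : B) :> B.
  apply: etrans (tlift_pure (@BeB_mul_balanced _ _ f) _ _) _.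
  by rewrite /= -mulrA idvK.
apply: etrans (congr2 (fun u v : B => u + v) (gE e) (gE e')) _.
by rewrite -mulrDr addrC subrK mulr1.
Qed.

Variables (R : chain (ev C)) (R' : chain (ev C')).
Variables (r : {linear R 0 -> evreg C}) (r' : {linear R' 0 -> evreg C'}).

Lemma indsum_resolution :
  proj_resolution (R := ev B) (P := Chain (fun n => ind_map (e := e) (ch_d R n))) (ind_aug r) ->
  proj_resolution (R := ev B) (P := Chain (fun n => ind_map (e := e') (ch_d R' n))) (ind_aug r') ->
  proj_resolution (indsum_eps r r' : {linear indsum R R' 0 -> BeBsum e}).
Proof.
move=> [pr1 su1 au1 ex1] [pr2 su2 au2 ex2]; split=> [n|[y1 y2]|[z1 z2]|n [z1 z2]].
- exact: projective_prod (pr1 n) (pr2 n).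
- have [x1 x1E] := su1 y1; have [x2 x2E] := su2 y2.
  by exists (x1, x2); congr (_, _).
- split=> [[az1 az2]|[[y1 y2] [<- <-]]].
    have /au1 [y1 y1E] := az1; have /au2 [y2 y2E] := az2.
    by exists (y1, y2); congr (_, _).
  by congr (_, _); [apply/au1; exists y1|apply/au2; exists y2].
- split=> [[dz1 dz2]|[[y1 y2] [<- <-]]].
    have /ex1 [y1 y1E] := dz1; have /ex2 [y2 y2E] := dz2.
    by exists (y1, y2); congr (_, _).
  by congr (_, _); [apply/ex1; exists y1|apply/ex2; exists y2].
Qed.

Local Notation S := (indsum R R').

Definition sum_in1 n (x : ind (R n)) : S n := (x, 0).
Definition sum_in2 n (x : ind (R' n)) : S n := (0, x).
Fact sum_in1_linear n : linear (@sum_in1 n).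
Proof. by move=> a x y; congr (_, _); rewrite /= scaler0 addr0. Qed.
Fact sum_in2_linear n : linear (@sum_in2 n).
Proof. by move=> a x y; congr (_, _); rewrite /= scaler0 addr0. Qed.
HB.instance Definition _ n := GRing.isLinear.Build (ev B) (ind (R n)) (S n) _
  (@sum_in1 n) (@sum_in1_linear n).
HB.instance Definition _ n := GRing.isLinear.Build (ev B) (ind (R' n)) (S n) _
  (@sum_in2 n) (@sum_in2_linear n).

Lemma sum_in_eq n (x : S n) : x = sum_in1 x.1 + sum_in2 x.2.
Proof. by case: x => x1 x2; congr (_, _); rewrite /= ?addr0 ?add0r. Qed.

Definition adj1 n (f : {linear S n -> evreg B}) : {linear R n -> evreg C} :=
  adj (f \o @sum_in1 n).
Definition adj2 n (f : {linear S n -> evreg B}) : {linear R' n -> evreg C'} :=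
  adj (f \o @sum_in2 n).

Lemma indsum_ext n (M : lmodType (ev B)) (f g : {linear S n -> M}) :
  (forall p, f (sum_in1 (indg p)) = g (sum_in1 (indg p))) ->
  (forall p, f (sum_in2 (indg p)) = g (sum_in2 (indg p))) -> f =1 g.
Proof.
move=> fg fg' x; rewrite (sum_in_eq x) !linearD; congr (_ + _).
- exact: (ind_ext (f := f \o @sum_in1 n) (g := g \o @sum_in1 n) fg).
- exact: (ind_ext (f := f \o @sum_in2 n) (g := g \o @sum_in2 n) fg').
Qed.

Lemma indsum_lift n (h : {linear R n -> evreg C}) (h' : {linear R' n -> evreg C'}) :
  exists f : {linear S n -> evreg B}, (forall p, f (sum_in1 (indg p)) = val (h p : C)) /\
    (forall p, f (sum_in2 (indg p)) = val (h' p : C')).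
Proof.
have [f fE] := adj_lift h; have [f' f'E] := adj_lift h'.
exists (linear_pack (pair_linear f f')); split=> p /=.
  by rewrite linear0 addr0 fE.
by rewrite linear0 add0r f'E.
Qed.

Lemma indsum_d1 n p : ch_d S n (sum_in1 (indg p)) = sum_in1 (indg (ch_d R n p)).
Proof. by rewrite /sum_in1 /= /indsum_d /= linear0 /indg ind_mapE. Qed.
Lemma indsum_d2 n p : ch_d S n (sum_in2 (indg p)) = sum_in2 (indg (ch_d R' n p)).
Proof. by rewrite /sum_in2 /= /indsum_d /= linear0 /indg ind_mapE. Qed.

(** The map is bijective on cochains already: a homomorphism is determined by its values on the
    generators e (x) p (x) e, and these can be prescribed by [indsum_lift]. The differentials send
    generators to generators, so this persists in cohomology. *)
Lemma adjunction_exists :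
  exists A : forall n, {linear Ext S (evreg B) n ->
                          (Ext R (evreg C) n * Ext R' (evreg C') n)%type},
    adjunction A /\ forall n, bijective (A n).
Proof.
have L1 n : linear (adj1 (n := n) : Defs.Hom (S n) (evreg B) -> Defs.Hom (R n) (evreg C)).
  move=> k f g; apply: linear_eq => p; apply: val_inj.
  change (lact (kin B k) (f (sum_in1 (indg p)) : evreg B) + g (sum_in1 (indg p)) =
    val (lact (kin C k) (adj1 f p)) + g (sum_in1 (indg p)) :> B).
  by rewrite corner_kin_scale evreg_lact.
have L2 n : linear (adj2 (n := n) : Defs.Hom (S n) (evreg B) -> Defs.Hom (R' n) (evreg C')).
  move=> k f g; apply: linear_eq => p; apply: val_inj.
  change (lact (kin B k) (f (sum_in2 (indg p)) : evreg B) + g (sum_in2 (indg p)) =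
    val (lact (kin C' k) (adj2 f p)) + g (sum_in2 (indg p)) :> B).
  by rewrite corner_kin_scale evreg_lact.
have [n f|F1 F1E] := cochain_map_exists (X := hom_cochain S (evreg B))
    (Y := hom_cochain R (evreg C)) (phi := fun n => linear_pack (L1 n)).
  apply: linear_eq => p; apply: val_inj.
  exact: (congr1 f (indsum_d1 p)).
have [n f|F2 F2E] := cochain_map_exists (X := hom_cochain S (evreg B))
    (Y := hom_cochain R' (evreg C')) (phi := fun n => linear_pack (L2 n)).
  apply: linear_eq => p; apply: val_inj.
  exact: (congr1 f (indsum_d2 p)).
have LA n : linear (fun x : Ext S (evreg B) n => (F1 n x, F2 n x)).
  by move=> k x y; rewrite !linearP.
pose A n := linear_pack (LA n); exists A; split=> [n f x cf|n].
  exists (adj1 f), (adj2 f); split=> //; first exact: (F1E n f x cf).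
  exact: (F2E n f x cf).
apply: inj_surj_bijective => [x y|[x1 x2]].
  move=> /eqP; rewrite -subr_eq0 -linearB => /eqP; set z := x - y => Az.
  apply/eqP; rewrite -subr_eq0 -/z; apply/eqP.
  have [f cf] := coh_class_surj z.
  have c1 := F1E n f z cf; have c2 := F2E n f z cf.
  case: Az => Az1 Az2; rewrite Az1 in c1; rewrite Az2 in c2.
  have b1 := coh_class_zero c1; have b2 := coh_class_zero c2.
  apply: (coh_class_zero' cf).
  clear Az1 Az2 c1 c2 cf z x y; case: n f b1 b2 => [|n] f.
    move=> /Ext_boundary0 b1 /Ext_boundary0 b2; apply/Ext_boundary0.
    apply: (indsum_ext (g := \0)) => p.
      exact: (congr1 val (b1 p)).
    exact: (congr1 val (b2 p)).
  move=> /Ext_boundaryS [h1 h1E] /Ext_boundaryS [h2 h2E]; apply/Ext_boundaryS.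
  have [g [gE gE']] := indsum_lift h1 h2; exists g.
  apply: (indsum_ext (g := g \o ch_d S n)) => p.
    by rewrite [RHS](congr1 g (indsum_d1 p)) gE -h1E.
  by rewrite [RHS](congr1 g (indsum_d2 p)) gE' -h2E.
have [h1 c1] := coh_class_surj x1; have [h2 c2] := coh_class_surj x2.
have d1 := (Ext_cocycle _).1 (coh_class_cocycle c1).
have d2 := (Ext_cocycle _).1 (coh_class_cocycle c2).
have [f [fE fE']] := indsum_lift h1 h2.
have [|x cx] := @coh_class_exists K (hom_cochain S (evreg B)) n f.
  apply/Ext_cocycle; apply: (indsum_ext (f := f \o ch_d S n) (g := \0)) => p.
    by rewrite [LHS](congr1 f (indsum_d1 p)) fE d1.
  by rewrite [LHS](congr1 f (indsum_d2 p)) fE' d2.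
exists x; congr (_, _).
- apply: (coh_class_eq (F1E n f x cx) c1); have -> : linear_pack (L1 n) f = h1.
    by apply: linear_eq => p; apply: val_inj; apply: fE.
  by rewrite subrr; apply: boundary0.
- apply: (coh_class_eq (F2E n f x cx) c2); have -> : linear_pack (L2 n) f = h2.
    by apply: linear_eq => p; apply: val_inj; apply: fE'.
  by rewrite subrr; apply: boundary0.
Qed.
End Complementary.

(** * Restriction of Hochschild cochains to a corner *)

Section Restriction.
Variables (K : comPzRingType) (B : kAlgType K) (e : idem B).
Local Notation C := (corner e).

Fact ccut_mem (b : B) : (e : B) * b * (e : B) \in peirce_pred e e.
Proof. by apply: peirce_mem; rewrite ?mulrA ?idvK // -!mulrA idvK. Qed.
Definition ccut (b : B) : C := exist _ ((e : B) * b * (e : B)) (ccut_mem b).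

Definition svals (c : nat -> C) : nat -> B := fun j => val (c j).
Definition sres (F : (nat -> B) -> B) (c : nat -> C) : C := ccut (F (svals c)).

Lemma val_sum (I : Type) (s : seq I) (E : I -> C) :
  val (\sum_(i <- s) E i) = \sum_(i <- s) val (E i).
Proof. by elim/big_rec2: _ => // i x y _ <-. Qed.

Lemma val_sign s (c : C) : val ((-1) ^+ s * c) = (-1) ^+ s * val c.
Proof.
rewrite -signr_odd -[in RHS]signr_odd; case: odd; rewrite ?expr0 ?mul1r // !expr1 !mulN1r.
by [].
Qed.

Lemma val_corner_kin k (x : C) : val (kin C k * x) = kin B k * val x.
Proof. by rewrite /= -mulrA peircel. Qed.

Lemma kmlin_sres n F : kmlin n F -> kmlin n (sres F).
Proof.
move=> [Fd FL]; split=> [c d cd|c i ilt k x y].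
  by congr ccut; apply: Fd => j jn; rewrite /svals cd.
have E z : svals (supd c i z) = supd (svals c) i (val z).
  by apply/funext => j; rewrite /svals /supd; case: eqP.
apply: val_inj; rewrite /sres !E -[val (kin C k * x + y)]/(val (kin C k * x) + val y).
rewrite val_corner_kin.
apply: etrans (congr1 (fun b : B => (e : B) * b * (e : B)) (FL _ _ ilt k _ _)) _.
set u := F (supd _ _ (val x)); set w := F _.
change ((e : B) * (kin B k * u + w) * (e : B) =
  kin B k * (e : B) * ((e : B) * u * (e : B)) + (e : B) * w * (e : B)).
rewrite mulrDr mulrDl; congr (_ + _); rewrite [(e : B) * (_ * _)]mulrA -kinC -!mulrA.
by rewrite [in RHS](mulrA (e : B)) idvK.
Qed.

Lemma svals_smerge i c : svals (smerge i c) = smerge i (svals c).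
Proof. by apply/funext => j; rewrite /svals /smerge; case: ltnP => // _; case: eqP. Qed.

(** An entry c of e B e satisfies e c = c = c e, so e F(-) e absorbs the outer multiplications.
    Hence restriction is a cochain map on all cochains, relative or not. *)
Lemma sdiff_sres n F : sdiff n (sres F) = sres (sdiff n F).
Proof.
apply/funext => c; apply: val_inj.
change (val (c 0%N * sres F (stail c)) +
  val (\sum_(i < n) (-1) ^+ i.+1 * sres F (smerge i c)) +
  val ((-1) ^+ n.+1 * (sres F c * c n)) = (e : B) * sdiff n F (svals c) * (e : B)).
rewrite val_sum val_sign /sdiff !mulrDr !mulrDl mulr_sumr mulr_suml.
congr (_ + _ + _).
- change (svals c 0%N * ((e : B) * F (svals (stail c)) * (e : B)) =
    (e : B) * (svals c 0%N * F (stail (svals c))) * (e : B)).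
  by rewrite !mulrA corner_l corner_r.
- apply: eq_bigr => i _; rewrite val_sign /= svals_smerge signr_comm.
  by rewrite -!mulrA.
- rewrite signr_comm -mulrA; congr (_ * _).
  change ((e : B) * F (svals c) * (e : B) * svals c n =
    (e : B) * (F (svals c) * svals c n) * (e : B)).
  by rewrite -!mulrA corner_l corner_r.
Qed.

Lemma HH_restriction : exists res : forall n, {linear HH B n -> HH C n},
  forall n F (x : HH B n), sclass F x -> sclass (sres F) (res n x).
Proof.
pose th n (c : hcoch B n) : hcoch C n := hcoch_of (kmlin_sres (hcoch_mlin c)).
have thE n (c : hcoch B n) : seqfun (val (th n c)) = sres (seqfun (val c)).
  exact: seqfun_hcoch.
have thL n : linear (th n).
  move=> k c d; apply: hcoch_eq; rewrite thE.
  have -> : seqfun (val (k *: th n c + th n d)) =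
    (fun a => kin C k * seqfun (val (th n c)) a + seqfun (val (th n d)) a) by [].
  rewrite !thE; apply/funext => a; apply: val_inj.
  rewrite -[RHS]/(val (kin C k * sres (seqfun (val c)) a) + val (sres (seqfun (val d)) a)).
  rewrite val_corner_kin /=.
  change ((e : B) * (kin B k * seqfun (val c) (svals a) + seqfun (val d) (svals a)) * (e : B) =
    kin B k * ((e : B) * seqfun (val c) (svals a) * (e : B)) + (e : B) * seqfun (val d) (svals a) * (e : B)).
  by rewrite mulrDr mulrDl; congr (_ + _); rewrite mulrA -kinC -!mulrA.
have [n c|res resE] := cochain_map_exists (X := hochschild B) (Y := hochschild C)
    (phi := fun n => linear_pack (thL n)).
  apply: hcoch_eq; rewrite [RHS]seqfun_hdiff [LHS]thE [in RHS]thE sdiff_sres.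
  by rewrite -seqfun_hdiff.
exists res => n F x [c <- cx]; rewrite -thE; apply/sclass_coh.
exact: (resE n c x cx).
Qed.

(* F preserves the subalgebra D = e B e + (1 - e) B (1 - e), and F = F_e + F_(1-e) on D. *)
Definition relative (F : (nat -> B) -> B) : Prop :=
  forall a, (forall j, a j * (e : B) = (e : B) * a j) ->
  (e : B) * F a = F a * (e : B) /\ (e : B) * F a = (e : B) * F (fun j => (e : B) * a j).

Lemma svals_comm c j : svals c j * (e : B) = (e : B) * svals c j.
Proof. by rewrite /svals corner_l corner_r. Qed.

Lemma val_sres F c : relative F -> val (sres F c) = (e : B) * F (svals c).
Proof.
move=> Frel; have [E _] := Frel _ (svals_comm c).
by rewrite /= E -mulrA idvK.
Qed.

(** The idempotent missing between F and G in e F G e is supplied by commuting e past the value of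
    G. *)
Lemma sres_scup m F G : relative F -> relative G ->
  sres (scup m F G) = scup m (sres F) (sres G).
Proof.
move=> Frel Grel; apply/funext => c; apply: val_inj.
have [EG _] := Grel _ (svals_comm (fun j => c (m + j)%N)).
transitivity (val (sres F c) * val (sres G (fun j => c (m + j)%N))); last by [].
rewrite (val_sres _ Frel) (val_sres _ Grel).
change ((e : B) * (F (svals c) * G (svals (fun j => c (m + j)%N))) * (e : B) =
  (e : B) * F (svals c) * ((e : B) * G (svals (fun j => c (m + j)%N)))).
by rewrite EG !mulrA.
Qed.

(** On entries from C the value of G lies in D but perhaps not in C. The first clause of [relative]
    for G keeps the arguments of F in D; the second clause for F then replaces the value of G by its
    e-part, which is the value of the restriction of G. *)
Lemma sres_scirc m n F G : relative F -> relative G ->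
  sres (scirc m n F G) = scirc m n (sres F) (sres G).
Proof.
move=> Frel Grel; apply/funext => c; apply: val_inj.
rewrite [RHS]val_sum.
change ((e : B) * scirc m n F G (svals c) * (e : B) =
  \sum_(i < m) val ((-1) ^+ (i * n.+1) * sres F (sins i n (sres G) c))).
rewrite mulr_sumr mulr_suml; apply: eq_bigr => i _.
rewrite val_sign (val_sres _ Frel) signr_comm -!mulrA; congr (_ * _).
have Gc k : G (fun j => svals c (k + j)%N) * (e : B) = (e : B) * G (fun j => svals c (k + j)%N).
  by have [] := Grel _ (svals_comm (fun j => c (k + j)%N)).
have comm j : sins i n G (svals c) j * (e : B) = (e : B) * sins i n G (svals c) j.
  by rewrite /sins; case: ltnP => _; [|case: eqP => _]; rewrite ?Gc // svals_comm.
have [E1 E2] := Frel _ comm.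
rewrite -E1 mulrA idvK E2; congr (_ * F _); apply/funext => j.
rewrite /svals /sins; case: ltnP => _; first exact: corner_l.
case: eqP => _; last exact: corner_l.
by rewrite val_sres.
Qed.

Lemma sres_sbrk m n F G : relative F -> relative G ->
  sres (sbrk m n F G) = sbrk m n (sres F) (sres G).
Proof.
move=> Frel Grel; apply/funext => c; apply: val_inj.
rewrite /sbrk -sres_scirc // -[in RHS]sres_scirc // [RHS]/(val _ - val _) val_sign /=.
by rewrite mulrBr mulrBl signr_comm -[in X in _ - X = _]mulrA.
Qed.
End Restriction.

(** * Relative representatives of Hochschild classes by averaging *)

Section Averaging.
Variables (K : comPzRingType) (B : kAlgType K) (e : idem B).
Local Notation e' := (idemC e).

Lemma idemC_add : (e : B) + (e' : B) = 1.
Proof. by rewrite /= addrC subrK. Qed.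
Lemma idemCl : (e' : B) * (e : B) = 0.
Proof. by rewrite /= mulrBl mul1r idvK subrr. Qed.
Lemma idemCr : (e : B) * (e' : B) = 0.
Proof. by rewrite /= mulrBr mulr1 idvK subrr. Qed.

Section Step.
Variables (M : lmodType (ev B)) (t : {linear M -> M}).

(* Averaging over the separability idempotent e (x) e + e' (x) e' of K e + K e'. *)
Lemma average_step : exists T : {linear barten M -> barten M}, forall x m,
  T (bpure x m) = bpure (x * (e : B)) (lact (e : B) (t m))
                  + bpure (x * (e' : B)) (lact (e' : B) (t m)).
Proof.
have H := ev_bimodule M.
have [m n|b m|T TE] := barten_lift_linear
  (f := fun m => bpure (e : B) (lact (e : B) (t m)) + bpure (e' : B) (lact (e' : B) (t m))).
- by rewrite linearD !(bim_laDr H) !bpureDr addrACA.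
- by rewrite ract_linear !(bim_lara H) (bim_raDl (ev_bimodule _)) !barten_ract.
exists T => x m; rewrite TE (bim_laDr (ev_bimodule _)).
by rewrite !barten_lact.
Qed.
End Step.

(** The separability idempotent is inserted at every tensor sign: x (x) y is replaced by x e (x) e y
    + x e' (x) e' y. *)
Lemma average_exists : exists T : forall n, {linear bar B n -> bar B n},
  (forall y, T 0%N y = y) /\
  (forall n x (m : bar B n), T n.+1 (bpure x m) = bpure (x * (e : B)) (lact (e : B) (T n m))
                  + bpure (x * (e' : B)) (lact (e' : B) (T n m))).
Proof.
have [|n t _|T [T0 TS]] := @dependent_choice_nat (fun n => {linear bar B n -> bar B n})
  (fun n t => True) (fun n t t' => forall x (m : bar B n),
     t' (bpure x m) = bpure (x * (e : B)) (lact (e : B) (t m))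
                  + bpure (x * (e' : B)) (lact (e' : B) (t m))) idfun.
- by [].
- by have [t' t'E] := average_step t; exists t'.
by exists T; split=> // y; rewrite T0.
Qed.

Section Relative.
Variable T : forall n, {linear bar B n -> bar B n}.
Hypothesis T0 : forall y, T 0%N y = y.
Hypothesis TS : forall n x (m : bar B n), T n.+1 (bpure x m) =
  bpure (x * (e : B)) (lact (e : B) (T n m)) + bpure (x * (e' : B)) (lact (e' : B) (T n m)).

Lemma lact_split (M : lmodType (ev B)) x (m : M) :
  lact (x * (e : B)) m + lact (x * (e' : B)) m = lact x m.
Proof. by rewrite -(bim_laDl (ev_bimodule M)) -mulrDr idemC_add mulr1. Qed.

(** Multiplying across a tensor sign gives x e e y + x e' e' y = x y, so the inserted idempotents
    disappear from each merged place. *)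
Lemma average_d n z : bar_d B n (T n.+1 z) = T n (bar_d B n z).
Proof.
elim: n z => [|n IHn] z.
  apply: (bar_tens_ext (f := bar_d B 0 \o T 1%N) (g := T 0%N \o bar_d B 0)) z => [||x m];
    [exact: linearD|exact: linearD|].
  rewrite /= T0 TS linearD !bar_d0E !(bim_laA (ev_bimodule _)) -!mulrA !idvK.
  by rewrite lact_split T0.
apply: (bar_tens_ext (f := bar_d B n.+1 \o T n.+2) (g := T n.+1 \o bar_d B n.+1)) z
  => [||x m]; [exact: linearD|exact: linearD|].
have E (u : idem B) : bar_d B n.+1 (bpure (x * (u : B)) (lact (u : B) (T n.+1 m))) =
    lact (x * (u : B)) (T n.+1 m) - bpure (x * (u : B)) (lact (u : B) (T n (bar_d B n m))).
  rewrite bar_dSE (bim_laA (ev_bimodule _)) -mulrA idvK.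
  by rewrite lact_linear IHn.
change (bar_d B n.+1 (T n.+2 (bpure x m)) = T n.+1 (bar_d B n.+1 (bpure x m))).
rewrite TS linearD !E bar_dSE linearB TS lact_linear -(lact_split x).
by rewrite opprD addrACA.
Qed.

(** If the entries commute with e, the cross terms e a e' and e' a e vanish. An idempotent acting on
    the left therefore passes through all tensor signs and selects a single block. *)
Lemma average_block (u : idem B) n a y : (u = e \/ u = e') ->
  (forall j, a j * (e : B) = (e : B) * a j) ->
  lact (u : B) (T n (barw n a y)) = T n (barw n (fun j => (u : B) * a j) ((u : B) * y)).
Proof.
move=> ue; elim: n a => [|n IHn] a ae.
  by rewrite !T0 evreg_lact.
have ae' j : a j * (e' : B) = (e' : B) * a j by rewrite /= mulrBr mulrBl mulr1 mul1r ae.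
have H := ev_bimodule (bar B n).
rewrite [barw _ _ _]/= [in RHS]/= !TS (bim_laDr (ev_bimodule _)) !barten_lact.
have z0 z : bpure 0 z = 0 :> barten (bar B n).
  by apply: (addrI (bpure 0 z)); rewrite -bpureDl !addr0.
have IH := IHn (stail a) (fun j => ae j.+1).
have st : stail (fun j => (u : B) * a j) = (fun j => (u : B) * stail a j) by [].
rewrite st -IH !(bim_laA H).
have h1 : (e : B) * (a 0%N * (e' : B)) = 0 by rewrite mulrA -ae -mulrA idemCr mulr0.
have h2 : (e' : B) * (a 0%N * (e : B)) = 0 by rewrite mulrA -ae' -mulrA idemCl mulr0.
by case: ue => ->; rewrite -!mulrA ?h1 ?h2 !z0 ?addr0 ?add0r idvK.
Qed.

Lemma average_relative n (g : {linear bar B n.+1 -> evreg B}) :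
  relative e (fun a => g (T n.+1 (barg n a)) : B).
Proof.
move=> a ae; have H := ev_bimodule (bar B n).
have E b : T n.+1 (barg n b) = bpure (e : B) (lact (e : B) (T n (barw n b 1)))
    + bpure (e' : B) (lact (e' : B) (T n (barw n b 1))).
  by rewrite TS !mul1r.
have z0 z : bpure 0 z = 0 :> barten (bar B n).
  by apply: (addrI (bpure 0 z)); rewrite -bpureDl !addr0.
have l b : (forall j, b j * (e : B) = (e : B) * b j) -> (e : B) * (g (T n.+1 (barg n b)) : B) =
    g (bpure (e : B) (T n (barw n (fun j => (e : B) * b j) (e : B)))).
  move=> be; rewrite -evreg_lact -lact_linear E (bim_laDr (ev_bimodule _)) !barten_lact.
  by rewrite idvK idemCr z0 addr0 (@average_block e n b 1 (or_introl erefl) be) mulr1.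
rewrite (l a ae) (l (fun j => (e : B) * a j)); last first.
  by move=> j; rewrite -mulrA ae.
split; last first.
  by congr (g (bpure _ (T n (barw n _ _)))); apply/funext => j; rewrite mulrA idvK.
(* Multiplication by e on the right leaves the block of e as it is and kills the block of e', which
   now ends in e' e = 0. The result is the same as for multiplication on the left. *)
rewrite -evreg_ract -ract_linear E (bim_raDl (ev_bimodule _)) !barten_ract.
have r (u : idem B) : ract (lact (u : B) (T n (barw n a 1))) (e : B) =
    lact (u : B) (T n (barw n a (e : B))).
  by rewrite -(bim_lara H) -ract_linear barw_ract mul1r.
rewrite !r (@average_block e n a (e : B) (or_introl erefl) ae).
rewrite (@average_block e' n a (e : B) (or_intror erefl) ae).
rewrite idvK idemCl.
have w0 b : barw n b 0 = 0 by apply: (addrI (barw n b 0)); rewrite -barw_add !addr0.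
by rewrite w0 linear0 bpure0 addr0.
Qed.
End Relative.

Hypothesis B_proj : projective (kmod B).

(** The averaging map and the identity are two chain maps of the bar resolution over the identity of
    B, so composing a cocycle with the former does not change its class. *)
Lemma relative_representative n (x : HH B n) : exists2 F, sclass F x & relative e F.
Proof.
have [T [T0 TS]] := average_exists.
have [F cF] := sclass_surj x.
have [g gE] := bar_lift (kmlin_hom (sclass_kmlin cF)).
have gE' : (fun a => g (barg n a) : B) = F by apply/funext.
have gd : forall z, g (bar_d B n.+1 z) = 0.
  by apply/hom_cocycle_sdiff; rewrite gE'; apply: sclass_cocycle cF.
have b_res := bar_resolution B_proj; have [_ _ b_aug b_ex] := b_res.
have s1 : sbar_map (bar_aug B) (fun n a => idfun (barg n a) : bar_chain B n).
  exact: (chain_map_sbar_map (phi := fun n => idfun : {linear bar_chain B n -> bar_chain B n})).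
have s2 : sbar_map (bar_aug B) (fun n a => T n.+1 (barg n a) : bar_chain B n).
  apply: (chain_map_sbar_map (phi := fun n => T n.+1 : {linear bar_chain B n -> bar_chain B n})).
  split=> [z|m z]; last exact: (@average_d T T0 TS m.+1 z).
  exact: (etrans (@average_d T T0 TS 0 z) (T0 _)).
exists (fun a => g (T n.+1 (barg n a)) : B); last exact: average_relative.
apply: (sclass_boundary cF).
- by apply: (hom_kmlin g); apply: (mlin_hom (T n.+1) (@mlin_barg K B n)).
- exact: (sbar_map_cocycle s2 gd).
- by rewrite -gE'; apply: (sbar_map_homotopy B_proj b_aug b_ex s1 s2 gd).
Qed.

Lemma restriction_gerstenhaber (res : forall n, {linear HH B n -> HH (corner e) n}) :
  (forall n F (x : HH B n), sclass F x -> sclass (sres (e := e) F) (res n x)) ->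
  gerstenhaber_hom res.
Proof.
move=> resE.
have same n (F : (nat -> corner e) -> corner e) (x y : HH (corner e) n) :
    sclass F x -> sclass F y -> x = y.
  move=> cx cy; apply/(sclass_eq cx cy).
  by apply: sbnd_ext (sbnd0 _ n) => a; rewrite subrr.
split=> [|m n x y|m n x y|n x].
- apply: same (resE _ _ _ (gone_class B)) _.
  have -> : sres (e := e) (fun _ => 1) = fun _ => 1; last exact: gone_class.
  by apply/funext => c; apply: val_inj; rewrite /= mulr1 idvK.
- have [F cF Frel] := relative_representative x; have [G cG Grel] := relative_representative y.
  apply: same (resE _ _ _ (gcup_class cF cG)) _; rewrite sres_scup //.
  exact: gcup_class (resE _ _ _ cF) (resE _ _ _ cG).
- have [F cF Frel] := relative_representative x; have [G cG Grel] := relative_representative y.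
  apply: same (resE _ _ _ (gbrk_class cF cG)) _; rewrite sres_sbrk //.
  exact: gbrk_class (resE _ _ _ cF) (resE _ _ _ cG).
- have [F cF Frel] := relative_representative x.
  apply: same (resE _ _ _ (gsq_class cF)) _; rewrite sres_scirc //.
  exact: gsq_class (resE _ _ _ cF).
Qed.
End Averaging.

(** * Restriction to a corner compared with the adjunction *)

Section CornerComparison.
Variables (K : comPzRingType) (B : kAlgType K) (e : idem B).
Local Notation C := (corner e).
Variables (P : chain (ev B)) (p : {linear P 0 -> evreg B}).
Variables (R : chain (ev C)) (r : {linear R 0 -> evreg C}).
Hypothesis B_proj : projective (kmod B).
Hypothesis P_res : proj_resolution p.
Variable phi : forall n, {linear ind (R n) -> P n}.
Hypothesis phi0 : forall z, p (phi 0%N z) = BeB_mul (ind_aug r z).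
Hypothesis phid : forall n z, ch_d P n (phi n.+1 z) = phi n (ind_map (ch_d R n) z).

Definition cmod_chain : chain (ev C) :=
  @Chain _ (fun n => cmod e (P n)) (fun n => cmap (e := e) (ch_d P n)).
Definition cmod_aug : {linear cmod_chain 0 -> evreg C} := @to_corner K B e \o cmap (e := e) p.

Lemma cmod_aug_exact : exact_at (ch_d cmod_chain 0%N) cmod_aug.
Proof.
have [_ _ P_aug _] := P_res; move=> z; split=> [az|/(cmap_exact P_aug) dz].
  apply/(cmap_exact P_aug); apply: (can_inj (@to_cornerK K B e)).
  exact: (etrans az (esym (linear0 _))).
exact: (etrans (congr1 (@to_corner K B e) dz) (linear0 _)).
Qed.

Lemma cmod_chain_exact n : exact_at (ch_d cmod_chain n.+1) (ch_d cmod_chain n).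
Proof. by have [_ _ _ P_ex] := P_res; exact: (cmap_exact (P_ex n)). Qed.

Lemma cval_sum (M : lmodType (ev B)) (I : Type) (s : seq I) (E : I -> cmod e M) :
  cval (\sum_(i <- s) E i) = \sum_(i <- s) cval (E i).
Proof. by elim/big_rec2: _ => // i x y _ <-. Qed.

Lemma cval_signZ (M : lmodType (ev B)) s (m : cmod e M) :
  cval ((-1) ^+ s *: m) = (-1) ^+ s *: cval m.
Proof. by rewrite !signZ; case: odd. Qed.

(** Entries from C absorb e on either side, so multiplying the bar formula of B by e on the left and
    on the right turns it into that of C. *)
Lemma cut_sbar_map beta : sbar_map p beta ->
  sbar_map cmod_aug (fun n c => @cut K B e (P n) (beta n (svals c)) : cmod e (P n)).
Proof.
move=> [bL b0 bd]; split=> [n|c|n c].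
- have [bdep blin] := bL n; split=> [c c' cc|c i ilt k x y].
    by congr cut; apply: bdep => j jn; rewrite /svals cc.
  have E z : svals (supd c i z) = supd (svals c) i (val z).
    by apply/funext => j; rewrite /svals /supd; case: eqP.
  apply: cval_inj; rewrite !E -[val (kin C k * x + y)]/(val (kin C k * x) + val y).
  rewrite val_corner_kin.
  apply: etrans (congr1 (fun m : P n => evp (e : B) (e : B) *: m) (blin _ _ ilt k _ _)) _.
  set u := beta n _; set w := beta n _.
  rewrite scalerDr cvalD; congr (_ + _).
  apply: etrans _ (esym (cval_lact (kin C k) (@cut K B e (P n) u))).
  change (evp (e : B) (e : B) *: (evp (kin B k) 1 *: u) =
    evp (kin B k * (e : B)) 1 *: (evp (e : B) (e : B) *: u)).
  by rewrite !scalerA !evpM mulr1 mul1r -kinC -mulrA idvK.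
- apply: val_inj; apply: etrans (linZ p (evp (e : B) (e : B)) (beta 0%N (svals c))) _.
  apply: etrans (evregE _ _ _) _.
  have -> : (p (beta 0%N (svals c)) : B) = 1 by exact: b0.
  by rewrite mul1r idvK.
- apply: cval_inj; apply: etrans (linZ (ch_d P n) _ _) _.
  have sgnC s (m : P n) : evp (e : B) (e : B) *: ((-1) ^+ s *: m) = (-1) ^+ s *: (evp (e : B) (e : B) *: m).
    by rewrite !signZ; case: odd; rewrite // scalerN.
  rewrite bd !scalerDr !cvalD; congr (_ + _ + _).
  + rewrite cval_lact cval_cut /lact !scalerA !evpM mulr1 mul1r corner_l.
    by rewrite /svals /= corner_r.
  + rewrite cval_sum scaler_sumr; apply: eq_bigr => i _.
    by rewrite sgnC cval_signZ cval_cut svals_smerge.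
  + rewrite sgnC cval_signZ; congr (_ *: _).
    by rewrite cval_ract cval_cut /ract !scalerA !evpM mulr1 mul1r corner_l corner_r.
Qed.

Lemma sbar_map_push (T T' : chain (ev C)) (eps : {linear T 0 -> evreg C})
    (eps' : {linear T' 0 -> evreg C}) (chi : forall n, {linear T n -> T' n}) beta :
  chain_map eps eps' idfun chi -> sbar_map eps beta -> sbar_map eps' (fun n c => chi n (beta n c)).
Proof.
move=> [chi0 chid] [bL b0 bd]; split=> [n|c|n c].
- exact: (mlin_hom (chi n) (bL n)).
- exact: (etrans (chi0 (beta 0%N c)) (b0 c)).
- rewrite chid bd !linearD; congr (_ + _ + _).
  + exact: lact_linear.
  + by rewrite linear_sum; apply: eq_bigr => i _; rewrite linZ.
  + by rewrite linZ ract_linear.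
Qed.

(** Both terms are one cocycle on e P e composed with bar maps of C: the first cuts [beta] by e, the
    second pushes [betaR] through the adjoint of [phi]. As e P e is exact and the bar resolution of
    C is projective, the two bar maps are homotopic. *)
Lemma restriction_comparison beta betaR n (f : {linear P n -> evreg B}) :
  sbar_map p beta -> sbar_map r betaR -> (forall x, f (ch_d P n x) = 0) ->
  sbnd n (fun c => sres (e := e) (fun a => f (beta n a)) c - (adj (f \o phi n) (betaR n c) : C)).
Proof.
move=> bB bR fd.
pose chi m : {linear R m -> cmod_chain m} := cmap (e := e) (phi m) \o @indc K B e (R m).
have chiC : chain_map r cmod_aug idfun chi.
  split=> [x|m x].
    apply: val_inj; apply: etrans (phi0 _) _.
    apply: etrans (congr1 (@BeB_mul K B e) (ind_augE r (pe e) x (ep e))) _.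
    apply: etrans (tlift_pure (@BeB_mul_balanced _ _ e) _ _) _.
    by rewrite /= corner_l corner_r.
  apply: cval_inj; apply: etrans (phid _) _.
  by congr (phi m _); apply: ind_mapE.
have s1 := cut_sbar_map bB; have s2 := sbar_map_push chiC bR.
pose fh : {linear cmod_chain n -> evreg C} := @to_corner K B e \o cmap (e := e) f.
have fhd x : fh (ch_d cmod_chain n x) = 0.
  by apply: val_inj; apply: fd.
have := sbar_map_homotopy (corner_projective (e := e) B_proj) cmod_aug_exact cmod_chain_exact s1 s2 fhd.
apply: sbnd_ext => c; congr (_ - _).
  apply: val_inj; apply: etrans (linZ f (evp (e : B) (e : B)) (beta n (svals c))) _.
  by apply: etrans (evregE _ _ _) _; rewrite mulrA.
exact: val_inj.
Qed.
End CornerComparison.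

(** * The long exact sequence and its first map on Hochschild cohomology *)

Lemma linear_inverse (R : pzRingType) (M N : lmodType R) (f : {linear M -> N}) :
  bijective f -> exists2 g : {linear N -> M}, cancel f g & cancel g f.
Proof.
move=> [g fg gf]; have gL : linear g.
  by move=> a x y; apply: (can_inj fg); rewrite gf linearP !gf.
by exists (linear_pack gL).
Qed.

Theorem theorem3 (K : comPzRingType) (B : kAlgType K) (e : idem B)
    (B_projective : projective (kmod B))
    (* Tor^C_i (B e, e B) = 0 = Tor^C'_i (B e', e' B) for i > 0 *)
    (Q : chain (corner e)^c) (q : {linear Q 0 -> Bidem e})
    (Q_res : proj_resolution q)
    (Q' : chain (corner (idemC e))^c) (q' : {linear Q' 0 -> Bidem (idemC e)})
    (Q'_res : proj_resolution q')
    (Tor0 : forall i, (0 < i)%N -> forall x : Tor Q (idemB e) i, x = 0)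
    (Tor0' : forall i, (0 < i)%N -> forall x : Tor Q' (idemB (idemC e)) i, x = 0)
    (* projective resolutions computing the Ext groups *)
    (P : chain (ev B)) (p : {linear P 0 -> evreg B}) (P_res : proj_resolution p)
    (W : chain (ev B)) (w : {linear W 0 -> Omega e}) (W_res : proj_resolution w)
    (R : chain (ev (corner e))) (r : {linear R 0 -> evreg (corner e)})
    (R_res : proj_resolution r)
    (R' : chain (ev (corner (idemC e)))) (r' : {linear R' 0 -> evreg (corner (idemC e))})
    (R'_res : proj_resolution r') :
  short_exact (@Omega_incl K B e) (@BeBsum_mul K B e) /\
  proj_resolution (indsum_eps r r' : {linear indsum R R' 0 -> BeBsum e}) /\
  exists (A : forall n, {linear Ext (indsum R R') (evreg B) n ->
             (Ext R (evreg (corner e)) n * Ext R' (evreg (corner (idemC e))) n)%type})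
         (u : forall n, {linear Ext P (evreg B) n -> Ext (indsum R R') (evreg B) n})
         (v : forall n, {linear Ext (indsum R R') (evreg B) n -> Ext W (evreg B) n})
         (g : forall n, {linear Ext P (evreg B) n ->
             (Ext R (evreg (corner e)) n * Ext R' (evreg (corner (idemC e))) n)%type})
         (h : forall n, {linear
             (Ext R (evreg (corner e)) n * Ext R' (evreg (corner (idemC e))) n)%type ->
             Ext W (evreg B) n})
         (d : forall n, {linear Ext W (evreg B) n -> Ext P (evreg B) n.+1}),
    (* the maps *)
    [/\ adjunction A /\ (forall n, bijective (A n)),
        Ext_induced (indsum_eps r r') p (@BeBsum_mul K B e) u,
        Ext_induced w (indsum_eps r r') (@Omega_incl K B e) v,
        (forall n x, g n x = A n (u n x)) /\ (forall n x, h n (A n x) = v n x) &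
        Ext_connecting (@Omega_incl K B e) (@BeBsum_mul K B e) w p d] /\
    (* the long exact sequence *)
    [/\ injective (g 0),
        forall n, exact_at (g n) (h n),
        forall n, exact_at (h n) (d n) &
        forall n, exact_at (d n) (g n.+1)] /\
    (* the map g on Hochschild cohomology *)
    exists (k : forall n, {linear Ext P (evreg B) n -> HH B n})
           (k1 : forall n, {linear Ext R (evreg (corner e)) n -> HH (corner e) n})
           (k2 : forall n, {linear Ext R' (evreg (corner (idemC e))) n ->
                                   HH (corner (idemC e)) n})
           (gstar : forall n, {linear HH B n ->
                      gprod (HH (corner e)) (HH (corner (idemC e))) n}),
      [/\ Ext_HH p k /\ (forall n, bijective (k n)),
          Ext_HH r k1 /\ (forall n, bijective (k1 n)),
          Ext_HH r' k2 /\ (forall n, bijective (k2 n)),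
          forall n x, gstar n (k n x) = (k1 n (g n x).1, k2 n (g n x).2) &
          gerstenhaber_hom gstar].
Proof.
have ind1 := ind_resolution B_projective Q_res Tor0 R_res.
have ind2 := ind_resolution B_projective Q'_res Tor0' R'_res.
have S_res := indsum_resolution ind1 ind2.
have OSE := Omega_short_exact e.
split; first exact: OSE.
split; first exact: S_res.
have [A [A_adj A_bij]] := adjunction_exists R R'.
have [u [v [d [[u_ind v_ind d_con] [u_inj uv_ex vd_ex du_ex]]]]] :=
  Ext_long_exact (evreg B) OSE W_res S_res P_res.
have Ainv_ex n : {G : {linear (Ext R (evreg (corner e)) n *
      Ext R' (evreg (corner (idemC e))) n)%type -> Ext (indsum R R') (evreg B) n} |
    cancel (A n) G /\ cancel G (A n)}.
  by apply: cid; have [G AG GA] := linear_inverse (A_bij n); exists G.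
pose Ainv n := sval (Ainv_ex n).
have AK n : cancel (A n) (Ainv n) by have [h _] := svalP (Ainv_ex n); exact: h.
have AinvK n : cancel (Ainv n) (A n) by have [_ h] := svalP (Ainv_ex n); exact: h.
exists A, u, v, (fun n => A n \o u n), (fun n => v n \o Ainv n), d.
split.
  split=> //; split=> // n x; exact: (congr1 (v n) (AK n x)).
split.
  split=> [x y Axy|n y|n z|n z].
  - exact: (u_inj _ _ (can_inj (AK 0%N) Axy)).
  - split=> [vy|[x xE]].
      have /uv_ex [x xE] : v n (Ainv n y) = 0 by exact: vy.
      by exists x; apply: etrans (AinvK n y); apply: congr1 xE.
    by apply/uv_ex; exists x; rewrite -xE; apply/esym/AK.
  - split=> [/vd_ex [y yE]|[y yE]].
      by exists (A n y); apply: etrans yE; apply: congr1 (AK n y).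
    by apply/vd_ex; exists (Ainv n y).
  - split=> [Az|[y yE]].
      apply/du_ex; apply: (can_inj (AK n.+1)).
      exact: (etrans Az (esym (linear0 _))).
    have /du_ex uz : exists y, d n y = z by exists y.
    exact: (etrans (congr1 (A n.+1) uz) (linear0 _)).
have [k [kHH k_bij kE]] := HH_identification B_projective P_res.
have [k1 [k1HH k1_bij k1E]] :=
  HH_identification (corner_projective (e := e) B_projective) R_res.
have [k2 [k2HH k2_bij k2E]] :=
  HH_identification (corner_projective (e := idemC e) B_projective) R'_res.
have [res1 res1E] := HH_restriction e.
have [res2 res2E] := HH_restriction (idemC e).
have [res1_cup0 res1_cup res1_brk res1_sq] := restriction_gerstenhaber B_projective res1E.
have [res2_cup0 res2_cup res2_brk res2_sq] := restriction_gerstenhaber B_projective res2E.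
have gL n : linear (fun x : HH B n => (res1 n x, res2 n x) :
    gprod (HH (corner e)) (HH (corner (idemC e))) n).
  by move=> a x y; congr (_, _); apply: linearP.
exists k, k1, k2, (fun n => linear_pack (gL n)); split=> //; last first.
  split=> [|m n x y|m n x y|n x]; congr (_, _).
  - exact: res1_cup0.
  - exact: res2_cup0.
  - exact: res1_cup.
  - exact: res2_cup.
  - exact: res1_brk.
  - exact: res2_brk.
  - exact: res1_sq.
  - exact: res2_sq.
(* Commutation is tested on one cocycle f representing x. The bar maps [b], [b1] and [b2] may be
   chosen independently because the identifications do not depend on them, and each component
   reduces to [restriction_comparison]. *)
move=> n x.
have [phi [phi0 phid] uE] := u_ind.
have [f cf] := coh_class_surj x.
have fd := (Ext_cocycle _).1 (coh_class_cocycle cf).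
have [h1 [h2 [h1E h2E ch1 ch2]]] := A_adj n _ _ (uE n f x cf).
have bar_of (L : kAlgType K) (T : chain (ev L)) (eps : {linear T 0 -> evreg L}) :
    projective (kmod L) -> proj_resolution eps -> exists beta, sbar_map eps beta.
  move=> prL T_res; have [psi psiC] := Ext_comparison idfun (bar_resolution prL) T_res.
  by eexists; apply: chain_map_sbar_map psiC.
have [b bB] := bar_of _ _ _ B_projective P_res.
have [b1 b1B] := bar_of _ _ _ (corner_projective (e := e) B_projective) R_res.
have [b2 b2B] := bar_of _ _ _ (corner_projective (e := idemC e) B_projective) R'_res.
have ck := kE b bB n f x cf.
congr (_, _).
- apply/(sclass_eq (res1E _ _ _ ck) (k1E b1 b1B n h1 _ ch1)).
  have P0 z : p (phi 0%N (@sum_in1 K B e R R' _ z)) = BeB_mul (ind_aug r z).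
    apply: (etrans (phi0 _)); rewrite /= /indsum_eps /BeBsum_mul /= linear0.
    by rewrite linear0 addr0.
  have Pd m z : ch_d P m (phi m.+1 (@sum_in1 K B e R R' _ z)) = phi m (@sum_in1 K B e R R' _ (ind_map (ch_d R m) z)).
    apply: (etrans (phid _ _)); congr (phi m _); rewrite /= /indsum_d /= linear0.
    by [].
  have := @restriction_comparison K B e P p R r B_projective P_res
      (fun m => phi m \o @sum_in1 K B e R R' m) P0 Pd b b1 n f bB b1B fd.
  apply: sbnd_ext => a; congr (_ - _); apply: val_inj.
  exact: (esym (h1E _)).
- apply/(sclass_eq (res2E _ _ _ ck) (k2E b2 b2B n h2 _ ch2)).
  have P0 z : p (phi 0%N (@sum_in2 K B e R R' _ z)) = BeB_mul (ind_aug r' z).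
    apply: (etrans (phi0 _)); rewrite /= /indsum_eps /BeBsum_mul /= linear0.
    by rewrite linear0 add0r.
  have Pd m z : ch_d P m (phi m.+1 (@sum_in2 K B e R R' _ z)) = phi m (@sum_in2 K B e R R' _ (ind_map (ch_d R' m) z)).
    apply: (etrans (phid _ _)); congr (phi m _); rewrite /= /indsum_d /= linear0.
    by [].
  have := @restriction_comparison K B (idemC e) P p R' r' B_projective P_res
      (fun m => phi m \o @sum_in2 K B e R R' m) P0 Pd b b2 n f bB b2B fd.
  apply: sbnd_ext => a; congr (_ - _); apply: val_inj.
  exact: (esym (h2E _)).
Qed.
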